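(* Let $p$ be a prime with $p \equiv 1 \pmod{12}$, let $b,c$ be positive integers with $p=b^{2}+bc+c^{2}$, let $m$ be an odd integer with $3\nmid m$, and let $\mathcal Q$ be a finite self-dual directly regular $4$-polytope of type $\{\{3,6\}_{(m,0)},\{6,3\}_{(m,0)}\}$ such that $p(p^{2}-1)$ does not divide $|\Gamma(\mathcal{Q})|$. Then there exists a properly self-dual chiral $4$-polytope, whose automorphism group is isomorphic to $L_{2}(p)\times \Gamma^{+}(\mathcal{Q})$, of type $\{\{3,6\}_{(m,0)},\{6,3\}_{(m,0)}\}$ if $p\mid m$, and of type $\{\{3,6\}_{(mb,mc)},\{6,3\}_{(mb,mc)}\}$ if $p\nmid m$.
   Context: An abstract $n$-polytope is a ranked poset (ranks $-1,\dots,n$) with a least and a greatest face, all flags of size $n+2$, strongly flag-connected, and satisfying the diamond condition; $\Gamma(\mathcal P)$ is its automorphism group. $\mathcal P$ is regular if $\Gamma(\mathcal P)$ is flag-transitive, and chiral if $\Gamma(\mathcal P)$ has exactly two flag orbits with adjacent flags always in distinct orbits. For regular $\mathcal P$, $\Gamma(\mathcal P)$ is generated by involutions $\rho_0,\dots,\rho_{n-1}$; the rotation subgroup $\Gamma^+(\mathcal P)$ is generated by $\sigma_i=\rho_{i-1}\rho_i$, has index at most $2$, and $\mathcal P$ is directly regular if the index is $2$. A polytope is of type $\{\mathcal P_1,\mathcal P_2\}$ if its facets are isomorphic to $\mathcal P_1$ and its vertex-figures to $\mathcal P_2$. A polytope is self-dual if it admits a duality (incidence-reversing bijection onto itself); a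 chiral polytope is properly self-dual if it admits a duality mapping each of the two flag orbits of $\Gamma(\mathcal P)$ onto itself. $\{6,3\}_{(b,c)}$ and $\{3,6\}_{(b,c)}$ denote the toroidal maps obtained from the hexagonal, respectively triangular, tessellation of the plane by factoring out the translation lattice generated by the vector $(b,c)$ (in the usual hexagonal-lattice coordinates) and its image under rotation by $60^\circ$ (the two maps are dual); they are regular if $bc=0$ or $b=c$ and chiral otherwise. $L_2(p)=PSL_2(p)$. *)

(* Defs.v *)
From HB Require Import structures.
From mathcomp Require Import all_boot all_order all_algebra all_fingroup.
From mathcomp Require Import center.

Set Implicit Arguments.
Unset Strict Implicit.
Unset Printing Implicit Defensive.

Import GRing.Theory.
Local Open Scope ring_scope.

Definition order_iso (S T : Type) (leS : S -> S -> Prop) (leT : T -> T -> Prop) : Prop :=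
  exists2 f : S -> T, bijective f & forall x y, leS x y <-> leT (f x) (f y).

Definition chain (d : Order.disp_t) (P : finPOrderType d) (A : {set P}) : bool :=
  [forall x in A, forall y in A, (x >=< y)%O].

Definition flag (d : Order.disp_t) (P : finPOrderType d) (A : {set P}) : bool :=
  maxset (@chain d P) A.

Definition adjacent (d : Order.disp_t) (P : finPOrderType d) (A B : {set P}) : bool :=
  [&& flag A, flag B, #|A :\: B| == 1%N & #|B :\: A| == 1%N].

Definition strongly_flag_connected (d : Order.disp_t) (P : finPOrderType d) : Prop :=
  forall A B : {set P}, flag A -> flag B ->
    connect [rel C D | [&& adjacent C D, A :&: B \subset C & A :&: B \subset D]] A B.

Record is_polytope (n : nat) (d : Order.disp_t) (P : finPOrderType d)
    (rank : P -> int) : Prop := IsPolytope {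
  polytope_rank_bounds : forall x, - 1 <= rank x <= n%:Z;
  polytope_rank_mono : forall x y, (x < y)%O -> rank x < rank y;
  polytope_least : exists x0 : P, forall x, (x0 <= x)%O;
  polytope_greatest : exists x1 : P, forall x, (x <= x1)%O;
  polytope_flag_size : forall A : {set P}, flag A -> #|A| = n.+2;
  polytope_connected : strongly_flag_connected P;
  polytope_diamond : forall x y : P, (x < y)%O -> rank y = rank x + 2%:Z ->
    #|[set z | (x < z < y)%O]| = 2%N
}.

(** Only finite polytopes are considered: a polytope with finite automorphism
    group and finitely many flag orbits is finite. *)
Record polytope (n : nat) : Type := Polytope {
  polytope_disp : Order.disp_t;
  face :> finPOrderType polytope_disp;
  rank : face -> int;
  polytopeP : is_polytope n rank
}.

Definition flags (n : nat) (P : polytope n) : {set {set P}} := [set A | flag A].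

Definition i_adjacent (n : nat) (P : polytope n) (i : nat) (A B : {set P}) : bool :=
  adjacent A B && [forall x in A :\: B, rank x == i%:Z].

Definition Gamma (n : nat) (P : polytope n) : {set {perm P}} :=
  [set g : {perm P} | [forall x, forall y, (g x <= g y)%O == (x <= y)%O]].

Lemma Gamma_group_set (n : nat) (P : polytope n) : group_set (Gamma P).
Proof.
apply/group_setP; split=> [|g h].
  by rewrite inE; apply/forallP=> x; apply/forallP=> y; rewrite !perm1.
rewrite !inE => /forallP hg /forallP hh.
apply/forallP=> x; apply/forallP=> y; rewrite !permM.
by rewrite (eqP (forallP (hh _) _)) (eqP (forallP (hg _) _)).
Qed.

Canonical Gamma_group (n : nat) (P : polytope n) : {group {perm P}} :=
  Group (Gamma_group_set P).

Definition flag_orbits (n : nat) (P : polytope n) : {set {set {set P}}} :=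
  orbit 'P^*%act (Gamma P) @: flags P.

Definition regular (n : nat) (P : polytope n) : Prop :=
  [transitive Gamma P, on flags P | 'P^*].

Definition chiral (n : nat) (P : polytope n) : Prop :=
  #|flag_orbits P| = 2%N /\
  forall A B : {set P}, adjacent A B -> B \notin orbit 'P^*%act (Gamma P) A.

(** For [P] regular and [A] a (base) flag, [rho A i] with [i < n] is the unique
    automorphism taking [A] to its [i]-adjacent flag. *)
Definition rho (n : nat) (P : polytope n) (A : {set P}) (i : nat) : {perm P} :=
  odflt 1%g [pick g in Gamma P | i_adjacent i A (g @: A)].

Definition Gamma_plus (n : nat) (P : polytope n) (A : {set P}) : {set {perm P}} :=
  <<[set (rho A i * rho A i.+1)%g | i : 'I_n.-1]>>%g.

Canonical Gamma_plus_group (n : nat) (P : polytope n) (A : {set P}) :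
    {group {perm P}} :=
  Eval hnf in [group of Gamma_plus A].

Definition directly_regular (n : nat) (P : polytope n) (A : {set P}) : Prop :=
  regular P /\ #|Gamma P : Gamma_plus A|%g = 2%N.

Definition duality (n : nat) (P : polytope n) (delta : {perm P}) : Prop :=
  forall x y : P, (delta x <= delta y)%O = (y <= x)%O.

Definition self_dual (n : nat) (P : polytope n) : Prop :=
  exists delta : {perm P}, duality delta.

Definition properly_self_dual (n : nat) (P : polytope n) : Prop :=
  exists2 delta : {perm P}, duality delta &
    forall O, O \in flag_orbits P -> [set delta @: A | A : {set P} in O] = O.

Definition has_type (n : nat) (P : polytope n) (S T : Type)
    (leS : S -> S -> Prop) (leT : T -> T -> Prop) : Prop :=
  (forall F : P, rank F = n%:Z - 1 ->
     order_iso (fun x y : {x : P | (x <= F)%O} => (sval x <= sval y)%O) leS) /\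
  (forall v : P, rank v = 0 ->
     order_iso (fun x y : {x : P | (v <= x)%O} => (sval x <= sval y)%O) leT).

(** The pair [(x, y)] is the point [x + y w] of the triangular lattice, where
    [w] is the complex number of modulus 1 and argument 60 degrees; hence
    [w ^ 2 = w - 1]. *)
Definition point : Type := (int * int)%type.

Definition rot60 (v : point) : point := (- v.2, v.1 + v.2).

Definition unit_vec (k : nat) : point := iter k rot60 (1, 0).

(** Every edge and every triangle of the tessellation is listed exactly once:
    those based at the lattice point [v] are the edges from [v] in the
    directions [1, w, w ^ 2], and the two triangles at [v] between consecutive
    such directions. *)
Inductive tess_face : Type :=
  | TEmpty
  | TVertex of point
  | TEdge of point & 'I_3
  | TTriangle of point & 'I_2
  | TPlane.

(** [TPlane] is treated separately in [tri_le]. *)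
Definition corners (f : tess_face) : seq point :=
  match f with
  | TVertex v => [:: v]
  | TEdge v k => [:: v; v + unit_vec k]
  | TTriangle v k => [:: v; v + unit_vec k; v + unit_vec k.+1]
  | TEmpty | TPlane => [::]
  end.

Definition tri_le (f g : tess_face) : Prop :=
  match f, g with
  | _, TPlane => True
  | TPlane, _ => False
  | _, _ => {subset corners f <= corners g}
  end.

(** The hexagonal tessellation is the dual of the triangular one: its tiles are
    centred at the lattice points, so both have the same translations. *)
Definition hex_le (f g : tess_face) : Prop := tri_le g f.

Definition translate (t : point) (f : tess_face) : tess_face :=
  match f with
  | TVertex v => TVertex (v + t)
  | TEdge v k => TEdge (v + t) k
  | TTriangle v k => TTriangle (v + t) k
  | TEmpty => TEmpty
  | TPlane => TPlane
  end.

Definition in_lattice (u : point) (t : point) : Prop :=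
  exists r s : int, t = u *~ r + rot60 u *~ s.

Definition translation_orbit (u : point) (f : tess_face) : tess_face -> Prop :=
  fun g => exists2 t, in_lattice u t & g = translate t f.

Definition torus_face (u : point) : Type :=
  {A : tess_face -> Prop | exists f, A = translation_orbit u f}.

Definition torus_le (le : tess_face -> tess_face -> Prop) (u : point)
    (A B : torus_face u) : Prop :=
  exists f g, [/\ sval A f, sval B g & le f g].

(** [{3,6}_u] and [{6,3}_u]. *)
Definition map36 (u : point) := torus_le tri_le (u := u).
Definition map63 (u : point) := torus_le hex_le (u := u).

Definition SL2 (p : nat) : {set {'GL_2(p)}} :=
  [set g : {'GL_2(p)} | \det (GLval g) == 1].

Lemma SL2_group_set (p : nat) : group_set (SL2 p).
Proof.
apply/group_setP; split=> [|g h]; first by rewrite inE /= det1.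
by rewrite !inE GL_MxE det_mulmx => /eqP-> /eqP->; rewrite mulr1.
Qed.

Canonical SL2_group (p : nat) : {group {'GL_2(p)}} := Group (SL2_group_set p).

Definition PSL2 (p : nat) : {set coset_of 'Z(SL2 p)} := (SL2 p / 'Z(SL2 p))%g.

Canonical PSL2_group (p : nat) : {group coset_of 'Z(SL2 p)} :=
  Eval hnf in [group of PSL2 p].

(* Main.v *)
(** Both [Gamma_plus Phi] and [PSL2 p] are generated by three elements that
    satisfy the relations of the rotations of a self-dual 4-polytope with
    triangulated toroidal facets. In [PSL2 p] the translations of the facet are
    unipotent, and [w = - b / c], a primitive sixth root of unity modulo [p],
    acts on them as the rotation by 60 degrees; so the translation by [(x, y)]
    is trivial exactly when [p] divides [c x - b y]. By Goursat's lemma, since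
    [PSL2 p] is simple and its order does not divide that of [Gamma_plus Phi],
    the pairs of corresponding generators generate the whole direct product.
    The cosets of the face stabilisers form a polytope, whose facets are the
    quotients of the tessellation by the translations trivial in both factors.
    If it were not chiral, the product would have an automorphism taking the
    translation by [(b, c)] to a conjugate of its mirror image, the translation
    by [(c, b)]. By simplicity that automorphism preserves the factor
    [Gamma_plus Phi], which contains the first translation but not the second. *)

Require Import Defs.
From HB Require Import structures.
From mathcomp Require Import all_boot all_order all_algebra all_fingroup.
From mathcomp Require Import center gseries cyclic finfield boolp zify ring.

Set Implicit Arguments.
Unset Strict Implicit.
Unset Printing Implicit Defensive.

Import Order.TTheory GRing.Theory Num.Theory.
Local Open Scope ring_scope.

(** * Flags of finite posets *)

Section FinitePosets.
Variables (disp : Order.disp_t) (P : finPOrderType disp).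
Implicit Types (A B : {set P}) (x y z : P).

Lemma chainP A : reflect {in A &, forall x y, (x >=< y)%O} (chain A).
Proof.
apply: (iffP forall_inP) => [cA x y xA yA|cA x xA].
  exact: (forall_inP (cA x xA)).
by apply/forall_inP=> y yA; apply: cA.
Qed.

Lemma flag_chain A : flag A -> chain A.
Proof. exact: maxsetp. Qed.

Lemma chain_sub_flag A : chain A -> exists2 B, flag B & A \subset B.
Proof. by case/maxset_exists=> B ? ?; exists B. Qed.

Lemma mem_flag A z : flag A -> {in A, forall x, (z >=< x)%O} -> z \in A.
Proof.
move=> fA zA; suff <- : z |: A = A by rewrite !inE eqxx.
have /maxsetP[/chainP cA maxA] := fA; apply: maxA; last exact: subsetUr.
apply/chainP=> u v; rewrite !inE; case/orP=> [/eqP->|uA].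
  by case/orP=> [/eqP->|/zA //]; rewrite comparablexx.
by case/orP=> [/eqP->|vA]; [rewrite comparable_sym zA | apply: cA].
Qed.

Lemma face_in_flag x : exists2 A, flag A & x \in A.
Proof.
have cx : chain [set x].
  by apply/chainP=> y z /set1P-> /set1P->; rewrite comparablexx.
by have [A fA] := chain_sub_flag cx; rewrite sub1set => xA; exists A.
Qed.

Lemma chain_imset (f : P -> P) A :
  (forall x y, (f x >=< f y)%O = (x >=< y)%O) -> chain (f @: A) = chain A.
Proof.
move=> fE; apply/chainP/chainP=> cA.
  by move=> x y xA yA; rewrite -fE; apply: cA; apply: imset_f.
by move=> _ _ /imsetP[x xA ->] /imsetP[y yA ->]; rewrite fE; apply: cA.
Qed.

Lemma adjacent_sym A B : adjacent A B = adjacent B A.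
Proof. by rewrite /adjacent andbCA [X in _ && (_ && X)]andbC. Qed.

Lemma adjacent_off_fiber (T : eqType) (r : P -> T) (i : T) A B :
  flag A -> flag B -> #|A| = #|B| -> {in A &, injective r} -> A != B ->
  {in A, forall x, r x != i -> x \in B} -> adjacent A B.
Proof.
move=> fA fB cardAB r_inj neqAB subAB.
have -> : adjacent A B = (#|A :\: B| == 1%N).
  have eqD : #|A :\: B| = #|B :\: A|.
    by apply/eqP; rewrite -(eqn_add2l #|A :&: B|) cardsID setIC cardsID cardAB.
  by rewrite /adjacent fA fB -eqD andbb.
rewrite eqn_leq card_gt0 setD_eq0; apply/andP; split; last first.
  by apply: contraNN neqAB => sAB; rewrite eqEcard sAB cardAB leqnn.
have fiber x : x \in A :\: B -> r x = i.
  by case/setDP=> xA xB; apply/eqP; apply: contraNT xB; apply: subAB.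
apply/card_le1_eqP=> x y xD yD.
have [[xA _] [yA _]] := (setDP xD, setDP yD).
by apply: r_inj => //; rewrite !fiber.
Qed.

End FinitePosets.

Section PermImages.
Variable T : finType.
Implicit Types (g h : {perm T}) (A : {set T}).

Lemma imset_permM g h A : (g * h)%g @: A = h @: (g @: A).
Proof. by rewrite -imset_comp; apply: eq_imset => x; rewrite permM. Qed.

Lemma imset_perm1 A : (1%g : {perm T}) @: A = A.
Proof. by rewrite -[RHS]imset_id; apply: eq_imset => x; rewrite perm1. Qed.

Lemma imset_perm_filter g A (p q : pred T) : (forall x, q (g x) = p x) ->
  g @: [set x in A | p x] = [set x in g @: A | q x].
Proof.
move=> qg; apply/setP=> y; rewrite inE; apply/imsetP/andP.
  by case=> x; rewrite inE => /andP[xA px] ->; rewrite imset_f ?qg.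
by case=> /imsetP[x xA ->]; rewrite qg => px; exists x; rewrite // inE xA.
Qed.

End PermImages.

(** * Flags and automorphisms of polytopes *)

Section Polytope.
Variables (n : nat) (P : polytope n).
Implicit Types (A B C D E : {set P}) (x y z : P) (g h d : {perm P}).

Lemma rank_lt x y : (x < y)%O -> rank x < rank y.
Proof. exact: (polytope_rank_mono (polytopeP P)). Qed.

Lemma rank_range x : -1 <= rank x <= n%:Z.
Proof. exact: (polytope_rank_bounds (polytopeP P)). Qed.

Lemma flag_size A : flag A -> #|A| = n.+2.
Proof. exact: (polytope_flag_size (polytopeP P)). Qed.

Lemma chain_flag A : chain A -> #|A| = n.+2 -> flag A.
Proof.
move=> /chain_sub_flag[B fB sAB] sizeA; suff -> : A = B by [].
by apply/eqP; rewrite eqEcard sAB sizeA flag_size ?leqnn.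
Qed.

Lemma flag_sub_eq A B : flag A -> flag B -> A \subset B -> A = B.
Proof. by move=> fA fB sAB; apply/eqP; rewrite eqEcard sAB !flag_size ?leqnn. Qed.

Lemma flag_le A x y : flag A -> x \in A -> y \in A ->
  (x <= y)%O = (rank x <= rank y).
Proof.
move=> /flag_chain/chainP cA xA yA; have := cA x y xA yA.
case/comparable_ltgtP=> [/rank_lt|/rank_lt|->]; rewrite ?lexx //.
  by move=> /ltW ->.
by rewrite ltNge => /negbTE->.
Qed.

Lemma flag_lt A x y : flag A -> x \in A -> y \in A ->
  (x < y)%O = (rank x < rank y).
Proof. by move=> fA xA yA; rewrite lt_leAnge !(flag_le fA) // -lt_leAnge. Qed.

Lemma flag_rank_inj A : flag A -> {in A &, injective (@rank n P)}.
Proof.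
by move=> fA x y xA yA eq_rank; apply/le_anti; rewrite !(flag_le fA) // eq_rank lexx.
Qed.

Definition rank_ord x : 'I_n.+2 := inord `|rank x + 1|.

Lemma rank_ordE x : (rank_ord x : nat)%:Z = rank x + 1.
Proof. by have /andP[rx_ge rx_le] := rank_range x; rewrite /rank_ord inordK; lia. Qed.

Lemma flag_rank_ord_inj A : flag A -> {in A &, injective rank_ord}.
Proof.
move=> fA x y xA yA eq_ord; apply: (flag_rank_inj fA) => //.
by apply: (addIr 1); rewrite -!rank_ordE eq_ord.
Qed.

Lemma flag_rank_surj A (i : int) : flag A -> -1 <= i <= n%:Z ->
  exists2 x, x \in A & rank x = i.
Proof.
move=> fA /andP[i_ge i_le].
have ordA : rank_ord @: A = setT.
  apply/eqP; rewrite eqEcard subsetT cardsT card_ord.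
  by rewrite (card_in_imset (flag_rank_ord_inj fA)) flag_size ?leqnn.
have : inord `|i + 1| \in rank_ord @: A by rewrite ordA inE.
case/imsetP=> x xA /(congr1 (fun j : 'I_n.+2 => (j : nat)%:Z)).
by rewrite rank_ordE inordK => [eq_i|]; [exists x => //|]; lia.
Qed.

Lemma flag_card_lt A x : flag A -> x \in A ->
  #|[set y in A | (y < x)%O]|%:Z = rank x + 1.
Proof.
move=> fA xA; rewrite -rank_ordE; congr Posz.
rewrite -(card_in_imset (f := rank_ord)); last first.
  by move=> y z /setIdP[yA _] /setIdP[zA _]; apply: (flag_rank_ord_inj fA).
pose below := widen_ord (ltnW (ltn_ord (rank_ord x))).
have below_inj : injective below by move=> i j /(congr1 val) /= /val_inj.
rewrite -[RHS]card_ord -[RHS]cardsT -(card_imset _ below_inj).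
congr #|pred_of_set _|; apply/setP=> i; apply/imsetP/imsetP=> [[y]|[j _ ->]].
  case/setIdP=> yA; rewrite (flag_lt fA) // => lt_yx ->.
  have lt_ord : (rank_ord y < rank_ord x)%N.
    by move: lt_yx; rewrite -(ltrD2r 1) -!rank_ordE.
  by exists (Ordinal lt_ord) => //; apply: val_inj.
have lt_jx := ltn_ord j; have rx := rank_ordE x.
have [|y yA ry] := flag_rank_surj (i := (j : nat)%:Z - 1) fA.
  by have := rank_range x; lia.
exists y; first by rewrite inE yA (flag_lt fA) //; lia.
by apply/val_inj/eqP => /=; rewrite -eqz_nat rank_ordE ry subrK.
Qed.

Lemma flag_card_gt A x : flag A -> x \in A ->
  #|[set y in A | (x < y)%O]|%:Z = n%:Z - rank x.
Proof.
move=> fA xA; have below := flag_card_lt fA xA; have := flag_size fA.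
rewrite -(cardsID [set y in A | (y < x)%O]) (setIidPr _); last first.
  by apply/subsetP=> y /setIdP[].
rewrite (cardsD1 x (A :\: _)) !inE xA ltxx /=.
suff -> : (A :\: [set y in A | (y < x)%O]) :\ x = [set y in A | (x < y)%O].
  by move: #|_| #|_| below => u v; lia.
apply/setP=> y; rewrite !inE; case yA: (y \in A); rewrite /= ?andbF // andbT.
by rewrite !(flag_lt fA) // -leNgt lt_neqAle (inj_in_eq (flag_rank_inj fA)) // eq_sym.
Qed.

Definition face_at A (i : int) : option P := [pick x in A | rank x == i].

Lemma face_atE A x : flag A -> x \in A -> face_at A (rank x) = Some x.
Proof.
move=> fA xA; rewrite /face_at; case: pickP => [y /andP[yA /eqP ry]|/(_ x)].
  by congr Some; apply: (flag_rank_inj fA).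
by rewrite xA eqxx.
Qed.

Lemma face_at_mem A i x : face_at A i = Some x -> x \in A /\ rank x = i.
Proof. by rewrite /face_at; case: pickP => // y /andP[yA /eqP ry] [<-]. Qed.

Lemma face_at_flag A i : flag A -> -1 <= i <= n%:Z ->
  exists x, [/\ x \in A, rank x = i & face_at A i = Some x].
Proof.
move=> fA ri; have [x xA rx] := flag_rank_surj fA ri.
by exists x; rewrite -rx face_atE.
Qed.

Lemma face_at_None A i : flag A -> ~~ (-1 <= i <= n%:Z) -> face_at A i = None.
Proof.
move=> fA; case face: (face_at A i) => [x|] //.
by have [_ <-] := face_at_mem face; rewrite rank_range.
Qed.

Lemma flag_ext A B : flag A -> flag B -> face_at A =1 face_at B -> A = B.
Proof.
move=> fA fB eqAB; apply: flag_sub_eq => //; apply/subsetP=> x xA.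
by have := face_atE fA xA; rewrite eqAB => /face_at_mem[].
Qed.

Lemma i_adjacentP (i : nat) A B : flag A -> flag B ->
  reflect (A <> B /\ {in A, forall x, rank x <> i%:Z -> x \in B})
          (i_adjacent i A B).
Proof.
move=> fA fB; apply: (iffP andP) => [[adjAB /forall_inP rankD]|[/eqP neqAB subAB]].
  split=> [eqAB|x xA rx].
    by case/and4P: adjAB => _ _; rewrite eqAB setDv cards0.
  by apply: contraT => xB; case: rx; apply/eqP/rankD; rewrite inE xB.
split.
  apply: (adjacent_off_fiber (i := i%:Z) fA fB _ (flag_rank_inj fA)) => //.
    by rewrite !flag_size.
  by move=> x xA /eqP; apply: subAB.
apply/forall_inP=> x /setDP[xA xB].
by apply: contraNT xB => /eqP; apply: subAB.
Qed.

Lemma i_adjacent_flags i A B : i_adjacent i A B -> flag A /\ flag B.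
Proof. by case/andP=> /and4P[]. Qed.

Lemma i_adjacent_face_atP (i : nat) A B : flag A -> flag B ->
  reflect (forall j, (face_at A j == face_at B j) = (j != i%:Z)) (i_adjacent i A B).
Proof.
move=> fA fB; apply: (iffP (i_adjacentP i fA fB)) => [[neqAB subAB] j|eqAB].
  have off k : k != i%:Z -> face_at A k = face_at B k.
    have [rk|/negP out_range] := boolP (-1 <= k <= n%:Z); last first.
      by rewrite !face_at_None //; apply/negP.
    have [x [xA <- ->]] := face_at_flag fA rk => /eqP rx.
    by rewrite face_atE //; apply: subAB.
  have [->|/off->] := eqVneq j i%:Z; last exact: eqxx.
  apply: contra_notF neqAB => /eqP at_i; apply: flag_ext => // k.
  by have [->|/off] := eqVneq k i%:Z.
split=> [eq_flags|x xA /eqP rx].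
  by have := eqAB i%:Z; rewrite eq_flags !eqxx.
by have := eqAB (rank x); rewrite rx face_atE // => /eqP/esym/face_at_mem[].
Qed.

Lemma i_adjacent_face_at i A B j :
  i_adjacent i A B -> (face_at A j == face_at B j) = (j != i%:Z).
Proof.
by move=> ab; have [fA fB] := i_adjacent_flags ab; apply/i_adjacent_face_atP.
Qed.

Lemma i_adjacent_sym i A B : i_adjacent i A B -> i_adjacent i B A.
Proof.
move=> ab; have [fA fB] := i_adjacent_flags ab.
by apply/i_adjacent_face_atP=> // j; rewrite eq_sym (i_adjacent_face_at j ab).
Qed.

Lemma diamondP x a y : (x < a < y)%O -> rank y = rank x + 2%:Z ->
  exists2 b, b != a & forall z, (x < z < y)%O = (z == a) || (z == b).
Proof.
move=> xay ry; have /andP[xa ay] := xay.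
have/eqP := polytope_diamond (polytopeP P) (lt_trans xa ay) ry.
set S := [set z | _]; rewrite (cardsD1 a) inE xay add1n eqSS => /cards1P[b Sb].
have bS : b \in S :\ a by rewrite Sb set11.
exists b => [|z]; first by case/setD1P: bS.
have [->|za] := eqVneq z a; first by rewrite xay.
by rewrite -in_set1 -Sb !inE za.
Qed.

Lemma face_at_diamond (i : int) A B C : 0 <= i < n%:Z ->
  flag A -> flag B -> flag C ->
  {in [:: i - 1; i + 1], face_at A =1 face_at B} ->
  {in [:: i - 1; i + 1], face_at A =1 face_at C} ->
  face_at A i != face_at B i -> face_at A i != face_at C i ->
  face_at B i = face_at C i.
Proof.
move=> ri fA fB fC eqAB eqAC.
have [|x [xA rx Ax]] := @face_at_flag A (i - 1) fA; first by lia.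
have [|y [yA ry Ay]] := @face_at_flag A (i + 1) fA; first by lia.
have low : i - 1 \in [:: i - 1; i + 1] by rewrite inE eqxx.
have high : i + 1 \in [:: i - 1; i + 1] by rewrite !inE eqxx orbT.
have between D : flag D -> face_at D (i - 1) = Some x -> face_at D (i + 1) = Some y ->
    exists2 z, face_at D i = Some z & (x < z < y)%O.
  move=> fD /face_at_mem[xD _] /face_at_mem[yD _].
  have [|z [zD rz Dz]] := @face_at_flag D i fD; first by clear -ri; lia.
  by exists z; rewrite // !(flag_lt fD) // rx ry rz; clear; lia.
have [a -> xay] := between A fA Ax Ay.
have [b -> xby] := between B fB (etrans (esym (eqAB _ low)) Ax) (etrans (esym (eqAB _ high)) Ay).
have [c -> xcy] := between C fC (etrans (esym (eqAC _ low)) Ax) (etrans (esym (eqAC _ high)) Ay).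
have [|z _ inter] := diamondP xay; first by rewrite rx ry; clear; lia.
move: xby xcy; rewrite !inter => /orP[]/eqP-> /orP[]/eqP->; by rewrite ?eqxx.
Qed.

Lemma i_adjacent_uniq i A B C : (i < n)%N ->
  i_adjacent i A B -> i_adjacent i A C -> B = C.
Proof.
move=> lt_in ab ac; have [fA fB] := i_adjacent_flags ab.
have [_ fC] := i_adjacent_flags ac.
have off D : i_adjacent i A D -> forall j, j != i%:Z -> face_at A j = face_at D j.
  by move=> ad j; rewrite -(i_adjacent_face_at j ad) => /eqP.
apply: flag_ext => // j; have [->|ne] := eqVneq j i%:Z; last first.
  by rewrite -(off B) // -(off C).
have near k : k \in [:: i%:Z - 1; i%:Z + 1] -> k != i%:Z.
  by rewrite !inE; clear; lia.
apply: (face_at_diamond (A := A)) => // [k /near|k /near||]; try exact: off.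
- by rewrite (i_adjacent_face_at _ ab) eqxx.
- by rewrite (i_adjacent_face_at _ ac) eqxx.
Qed.

Lemma flag_exchange A a b : flag A -> a \in A -> b \notin A ->
  {in A :\ a, forall z, (b >=< z)%O} -> flag (b |: (A :\ a)).
Proof.
move=> fA aA bA bz; apply: chain_flag; last first.
  rewrite -(flag_size fA) (cardsD1 a A) aA cardsU1.
  by rewrite (_ : b \notin _) // inE negb_and bA orbT.
apply/chainP=> u v /setU1P[->|uA] /setU1P[->|vA].
- exact: comparablexx.
- exact: bz.
- by rewrite comparable_sym; apply: bz.
- by apply: (chainP _ (flag_chain fA)); [case/setD1P: uA | case/setD1P: vA].
Qed.

Lemma i_adjacent_exists i A : (i < n)%N -> flag A -> exists B, i_adjacent i A B.
Proof.
move=> lt_in fA.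
have [|x [xA rx _]] := @face_at_flag A (i%:Z - 1) fA; first by lia.
have [|a [aA ra _]] := @face_at_flag A i%:Z fA; first by lia.
have [|y [yA ry _]] := @face_at_flag A (i%:Z + 1) fA; first by lia.
have [||b ba inter] := @diamondP x a y.
- by rewrite !(flag_lt fA) //; lia.
- by lia.
have /andP[xb by_] : (x < b < y)%O by rewrite inter eqxx orbT.
have rb : rank b = i%:Z by have := rank_lt xb; have := rank_lt by_; lia.
have bA : b \notin A.
  by apply: contra ba => bA; apply/eqP/(flag_rank_inj fA); rewrite ?ra.
exists (b |: (A :\ a)); apply/i_adjacentP => //; last split=> [eqA|z zA rz].
- apply: flag_exchange => // z /setD1P[za zA].
  have rz : rank z != i%:Z by rewrite -ra (inj_in_eq (flag_rank_inj fA)).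
  have [zx|] := lerP (rank z) (i%:Z - 1).
    by rewrite comparable_sym; apply/lt_comparable/(le_lt_trans _ xb); rewrite (flag_le fA) ?rx.
  move=> xz; apply/lt_comparable/(lt_le_trans by_).
  by rewrite (flag_le fA) // ry; move: rz xz; clear; lia.
- by move: bA; rewrite eqA setU11.
- by apply/setU1P; right; apply/setD1P; split=> //; apply/eqP=> za; case: rz; rewrite za.
Qed.

Lemma i_adjacent_comm i j A B C D E : (i < n)%N -> (j < n)%N ->
    (i.+1 < j)%N || (j.+1 < i)%N ->
    i_adjacent i A B -> i_adjacent j B C ->
    i_adjacent j A D -> i_adjacent i D E -> C = E.
Proof.
move=> lt_in lt_jn far ab bc ad de; apply: (i_adjacent_uniq lt_in _ de).
have [[fA fB] [_ fC] [_ fD]] :=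
  And3 (i_adjacent_flags ab) (i_adjacent_flags bc) (i_adjacent_flags ad).
have [AB BC AD] : [/\ forall l, (face_at A l == face_at B l) = (l != i%:Z),
    forall l, (face_at B l == face_at C l) = (l != j%:Z)
    & forall l, (face_at A l == face_at D l) = (l != j%:Z)].
  by split=> l; apply: i_adjacent_face_at.
apply/i_adjacent_face_atP=> // l; have [->|lj] := eqVneq l j%:Z; last first.
  by rewrite -AB; have /eqP-> := etrans (AD l) lj; have /eqP-> := etrans (BC l) lj.
have ji : j%:Z != i%:Z by clear -far; lia.
have ABj : face_at A j = face_at B j by apply/eqP; rewrite AB.
have near k : k \in [:: j%:Z - 1; j%:Z + 1] -> (k != i%:Z) && (k != j%:Z).
  by rewrite !inE; clear -far; lia.
have -> : face_at D j = face_at C j; last by rewrite eqxx ji.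
apply: (face_at_diamond (A := A)) => // [k /near|k /near||] => [/andP[ki kj]|/andP[ki kj]||].
- by apply/eqP; rewrite AD.
- by have /eqP-> := etrans (AB k) ki; apply/eqP; rewrite BC.
- by rewrite AD eqxx.
- by rewrite ABj BC eqxx.
Qed.

Lemma adjacent_i_adjacent A B : adjacent A B ->
  exists2 i, i_adjacent i A B & (i < n)%N.
Proof.
move=> ab; have /and4P[fA fB /cards1P[x xE] _] := ab.
have /setDP[xA xB] : x \in A :\: B by rewrite xE set11.
have [bot botP] := polytope_least (polytopeP P).
have [top topP] := polytope_greatest (polytopeP P).
have bot_x : (bot < x)%O.
  rewrite lt_neqAle botP andbT; apply: contraNneq xB => <-.
  by apply: mem_flag => // z _; rewrite /Order.comparable botP.
have x_top : (x < top)%O.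
  rewrite lt_neqAle topP andbT; apply: contraNneq xB => ->.
  by apply: mem_flag => // z _; rewrite /Order.comparable topP orbT.
have rx : 0 <= rank x < n%:Z.
  have := rank_lt bot_x; have := rank_lt x_top.
  by have := rank_range bot; have := rank_range top; lia.
exists `|rank x|%N; last by lia.
rewrite /i_adjacent ab /=; apply/forall_inP=> y; rewrite xE => /set1P->.
by apply/eqP; lia.
Qed.

Lemma greatest_rank top : (forall x, (x <= top)%O) -> rank top = n%:Z.
Proof.
move=> topP; have [A fA _] := face_in_flag top.
have [|x _ rx] := flag_rank_surj (i := n%:Z) fA; first by rewrite lexx andbT.
have := topP x; rewrite le_eqVlt => /orP[/eqP<- //|/rank_lt].
by rewrite rx ltNge; have /andP[_ ->] := rank_range top.
Qed.

Lemma GammaP g : reflect (forall x y, (g x <= g y)%O = (x <= y)%O) (g \in Gamma P).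
Proof.
rewrite inE; apply: (iffP forallP) => [gE x y|gE x].
  exact: (eqP (forallP (gE x) y)).
by apply/forallP=> y; apply/eqP.
Qed.

Lemma Gamma_lt g x y : g \in Gamma P -> (g x < g y)%O = (x < y)%O.
Proof. by move/GammaP=> gE; rewrite !lt_leAnge !gE. Qed.

Lemma duality_lt d x y : duality d -> (d x < d y)%O = (y < x)%O.
Proof. by move=> dE; rewrite !lt_leAnge !dE. Qed.

Lemma perm_flag g A : (forall x y, (g x >=< g y)%O = (x >=< y)%O) ->
  flag A -> flag (g @: A).
Proof.
move=> gE fA; apply: chain_flag; first by rewrite chain_imset ?flag_chain.
by rewrite (card_imset _ perm_inj) flag_size.
Qed.

Lemma Gamma_flag g A : g \in Gamma P -> flag A -> flag (g @: A).
Proof.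
by move/GammaP=> gE; apply: perm_flag => x y; rewrite /Order.comparable !gE.
Qed.

Lemma duality_flag d A : duality d -> flag A -> flag (d @: A).
Proof.
by move=> dE; apply: perm_flag => x y; rewrite /Order.comparable !dE orbC.
Qed.

Lemma Gamma_rank g x : g \in Gamma P -> rank (g x) = rank x.
Proof.
move=> gG; have [A fA xA] := face_in_flag x; apply: (addIr 1).
rewrite -(flag_card_lt (Gamma_flag gG fA) (imset_f g xA)) -(flag_card_lt fA xA).
rewrite -(@imset_perm_filter _ g A (fun y => y < x)%O) => [|y]; last exact: Gamma_lt.
by rewrite (card_imset _ perm_inj).
Qed.

Lemma duality_rank d x : duality d -> rank (d x) = n%:Z - 1 - rank x.
Proof.
move=> dE; have [A fA xA] := face_in_flag x; apply: (addIr 1).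
rewrite -(flag_card_lt (duality_flag dE fA) (imset_f d xA)) addrAC subrK.
rewrite -(flag_card_gt fA xA).
rewrite -(@imset_perm_filter _ d A (fun y => x < y)%O) => [|y]; last exact: duality_lt.
by rewrite (card_imset _ perm_inj).
Qed.

Lemma Gamma_i_adjacent g i A B : g \in Gamma P ->
  i_adjacent i A B -> i_adjacent i (g @: A) (g @: B).
Proof.
move=> gG ab; have [fA fB] := i_adjacent_flags ab.
have /(i_adjacentP _ fA fB)[neqAB subAB] := ab.
apply/i_adjacentP; rewrite ?Gamma_flag //; split=> [/(imset_inj perm_inj)//|].
by move=> _ /imsetP[x xA ->]; rewrite Gamma_rank // => /(subAB _ xA); apply: imset_f.
Qed.

Lemma duality_i_adjacent d i j A B : duality d -> (i + j).+1 = n ->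
  i_adjacent i A B -> i_adjacent j (d @: A) (d @: B).
Proof.
move=> dE ij ab; have [fA fB] := i_adjacent_flags ab.
have /(i_adjacentP _ fA fB)[neqAB subAB] := ab.
apply/i_adjacentP; rewrite ?duality_flag //; split=> [/(imset_inj perm_inj)//|].
move=> _ /imsetP[x xA ->]; rewrite duality_rank // => rx.
by apply/imset_f/subAB => // rx'; apply: rx; rewrite rx'; lia.
Qed.

(* An automorphism fixing a flag fixes its adjacent flags, hence all flags by
   connectedness. *)
Lemma Gamma_free g A : g \in Gamma P -> flag A -> g @: A = A -> g = 1%g.
Proof.
move=> gG fA gA.
have fix_adjacent C D : adjacent C D -> g @: C = C -> g @: D = D.
  case/adjacent_i_adjacent=> i cd lt_in gC; apply: (i_adjacent_uniq lt_in _ cd).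
  by rewrite -[X in i_adjacent _ X _]gC; apply: Gamma_i_adjacent.
have fix_flag B : flag B -> g @: B = B.
  move=> fB; have /connectP[s sP ->] := polytope_connected (polytopeP P) fA fB.
  have {sP} : path (@adjacent _ P) A s by apply: sub_path sP => C D /and3P[].
  by elim: s A gA {fA} => //= C s IH A gA /andP[/fix_adjacent/(_ gA)/IH].
apply/permP=> x; rewrite perm1; have [B fB xB] := face_in_flag x.
apply: (flag_rank_inj fB) => //; last exact: Gamma_rank.
by rewrite -(fix_flag B fB); apply: imset_f.
Qed.

Lemma Gamma_eq g h A : g \in Gamma P -> h \in Gamma P -> flag A ->
  g @: A = h @: A -> g = h.
Proof.
move=> gG hG fA eq_gh; apply/eqP; rewrite eq_mulgV1; apply/eqP.
apply: (Gamma_free (A := A)) => //; first by rewrite groupM ?groupV.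
by rewrite imset_permM eq_gh -imset_permM mulgV imset_perm1.
Qed.

End Polytope.

(** * The triangular tessellation and its toroidal quotients *)

Ltac case_mod6 k :=
  move: (k %% 6)%N (ltn_pmod k (isT : (0 < 6)%N)) => [|[|[|[|[|[|//]]]]]] _.

Section Tessellation.
Implicit Types (u v w s t : point) (f g : tess_face) (i j k l : nat).

Lemma unit_vecD6 k : unit_vec (k + 6) = unit_vec k.
Proof. by rewrite /unit_vec iterD; congr iter. Qed.

Lemma unit_vec_mod6 k : unit_vec (k %% 6) = unit_vec k.
Proof.
rewrite [in RHS](divn_eq k 6); elim: (k %/ 6)%N => // q IHq.
by rewrite mulSn -addnA addnC unit_vecD6.
Qed.

Lemma unit_vec_neq0 k : unit_vec k != 0.
Proof. by rewrite -unit_vec_mod6; case_mod6 k. Qed.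

Lemma unit_vec_eq k l : (unit_vec k == unit_vec l) = (k == l %[mod 6]).
Proof. by rewrite -unit_vec_mod6 -(unit_vec_mod6 l); case_mod6 k; case_mod6 l. Qed.

Lemma unit_vecS k : unit_vec k.+1 = unit_vec k + unit_vec (k + 2).
Proof. by rewrite addn2 /=; case: (unit_vec k) => a b; congr pair => /=; ring. Qed.

Lemma rot60_is_additive : {morph rot60 : v w / v + w}.
Proof. by move=> [a b] [c d]; congr pair; rewrite /= ?opprD // addrACA. Qed.

Lemma iter_rot60D k : {morph iter k rot60 : v w / v + w}.
Proof. by move=> v w; elim: k => //= k ->; apply: rot60_is_additive. Qed.

Lemma iter_rot60_0 k : iter k rot60 0 = 0.
Proof. by elim: k => //= k ->. Qed.

Lemma iter_rot60N k : {morph iter k rot60 : v / - v}.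
Proof.
by move=> v; apply: (addrI (iter k rot60 v)); rewrite -iter_rot60D !subrr iter_rot60_0.
Qed.

Lemma point_mulz (a b c : int) : (a, b) *~ c = (a * c, b * c) :> point.
Proof.
have mul_nat (n : nat) : (a, b) *+ n = (a * n%:Z, b * n%:Z) :> point.
  elim: n => [|n IHn]; first by rewrite !mulr0.
  by rewrite mulrS IHn intS !mulrDr !mulr1.
by case: c => n; rewrite ?NegzE ?mulrNz -pmulrn mul_nat ?mulrN.
Qed.

(** The edge from [v] in the direction [unit_vec k], and the triangle at [v]
    between the directions [unit_vec k] and [unit_vec k.+1]. *)
Definition tedge v k : tess_face :=
  if (k %% 6 < 3)%N then TEdge v (inord (k %% 6))
  else TEdge (v + unit_vec k) (inord (k %% 6 - 3)).

Definition ttri v k : tess_face :=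
  match (k %% 6)%N with
  | 0 => TTriangle v (inord 0)
  | 1 => TTriangle v (inord 1)
  | 2 => TTriangle (v + unit_vec 3) (inord 0)
  | 3 => TTriangle (v + unit_vec 4) (inord 1)
  | 4 => TTriangle (v + unit_vec 4) (inord 0)
  | _ => TTriangle (v + unit_vec 5) (inord 1)
  end.

(** The faces of the flag [(v, k)], indexed by their rank plus one. *)
Definition tface (i : nat) v k : tess_face :=
  match i with
  | 0 => TEmpty
  | 1 => TVertex v
  | 2 => tedge v k
  | 3 => ttri v k
  | _ => TPlane
  end.

Definition tess_rank f : nat :=
  match f with
  | TEmpty => 0
  | TVertex _ => 1
  | TEdge _ _ => 2
  | TTriangle _ _ => 3
  | TPlane => 4
  end.

Lemma tess_rank_tface i v k : (i <= 4)%N -> tess_rank (tface i v k) = i.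
Proof.
case: i => [|[|[|[|[|//]]]]] //= _; first by rewrite /tedge; case: ifP.
by rewrite /ttri; case: (k %% 6)%N => [|[|[|[|[|]]]]].
Qed.

Lemma tess_rank_translate t f : tess_rank (translate t f) = tess_rank f.
Proof. by case: f. Qed.

Lemma tface_mod6 i v k : tface i v (k %% 6) = tface i v k.
Proof.
by case: i => [|[|[|[|i]]]] //=; rewrite /tedge /ttri modn_mod ?unit_vec_mod6.
Qed.

Lemma tface_eqmod i v k l : k = l %[mod 6] -> tface i v k = tface i v l.
Proof. by move=> kl; rewrite -tface_mod6 kl tface_mod6. Qed.

Lemma tface_translate i v k t : tface i (v + t) k = translate t (tface i v k).
Proof.
case: i => [|[|[|[|i]]]] //=.
  by rewrite /tedge; case: ifP => _ //=; rewrite addrAC.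
by rewrite /ttri; case: (k %% 6)%N => [|[|[|[|[|j]]]]] //=; rewrite addrAC.
Qed.

Lemma tedgeD3 v k : tedge (v + unit_vec k) (k + 3) = tedge v k.
Proof.
rewrite -[LHS](tface_mod6 2) -[RHS](tface_mod6 2) -modnDml -unit_vec_mod6.
case_mod6 k; rewrite /= /tedge /= -?addrA //; congr (TEdge _ _);
  by rewrite -[RHS]addr0; congr (_ + _).
Qed.

Lemma ttriD2 v k : ttri (v + unit_vec k) (k + 2) = ttri v k.
Proof.
rewrite -[LHS](tface_mod6 3) -[RHS](tface_mod6 3) -modnDml -unit_vec_mod6.
case_mod6 k; rewrite /= /ttri /= -?addrA //; congr (TTriangle _ _);
  by rewrite -[RHS]addr0; congr (_ + _).
Qed.

Lemma ttriD4 v k : ttri (v + unit_vec k.+1) (k + 4) = ttri v k.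
Proof.
rewrite -(ttriD2 v k) -(ttriD2 (v + unit_vec k)) -!addnA; congr (ttri _ _).
by rewrite -addrA -unit_vecS.
Qed.

Lemma translate0 f : translate 0 f = f.
Proof. by case: f => //= *; rewrite addr0. Qed.

Lemma translateD s t f : translate s (translate t f) = translate (t + s) f.
Proof. by case: f => //= *; rewrite addrA. Qed.

Lemma corners_translate t f : corners (translate t f) = map (+%R^~ t) (corners f).
Proof. by case: f => //= *; rewrite ![_ + t + _]addrAC. Qed.

Lemma corners_tface i v k : (i < 4)%N ->
  corners (tface i v k) =i take i [:: v; v + unit_vec k; v + unit_vec k.+1].
Proof.
move=> lt_i4; have -> : [:: v; v + unit_vec k; v + unit_vec k.+1] =
    map (+%R^~ v) [:: 0; unit_vec k; unit_vec k.+1].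
  by rewrite /= add0r ![_ + v]addrC.
rewrite -{1}[v]add0r tface_translate corners_translate -map_take.
apply/eq_mem_map/perm_mem.
rewrite -tface_mod6 -(unit_vec_mod6 k) -(unit_vec_mod6 k.+1) -(addn1 k) -modnDml.
by case: i lt_i4 => [|[|[|[|//]]]] _; case_mod6 k;
  rewrite // /= ?/tedge ?/ttri /= !inordK.
Qed.

Lemma tfaceP f : exists v k, f = tface (tess_rank f) v k.
Proof.
case: f => [|v|v l|v l|].
- by exists 0, 0.
- by exists v, 0.
- exists v, l; case: l => -[|[|[|//]]] lt; rewrite /= /tedge /=;
  by congr TEdge; apply: val_inj; rewrite /= inordK.
- exists v, l; case: l => -[|[|//]] lt; rewrite /= /ttri /=;
  by congr TTriangle; apply: val_inj; rewrite /= inordK.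
- by exists 0, 0.
Qed.

Lemma mem_corners w f : w \in corners f ->
  exists k, f = tface (tess_rank f) w k.
Proof.
have [v [k ->]] := tfaceP f; move: (tess_rank f) => i wf.
have lt_i4 : (i < 4)%N by case: i wf => [|[|[|[|]]]].
rewrite tess_rank_tface 1?ltnW //; move: wf; rewrite corners_tface //.
case: i lt_i4 => [|[|[|[|//]]]] _; rewrite ?in_cons ?orbF //=.
- by move=> /eqP->; exists k.
- by case/orP=> /eqP->; [exists k | exists (k + 3)%N; rewrite tedgeD3].
- case/or3P=> /eqP->; first by exists k.
    by exists (k + 2)%N; rewrite ttriD2.
  by exists (k + 4)%N; rewrite ttriD4.
Qed.

Lemma tri_le_translate t f g : tri_le (translate t f) (translate t g) <-> tri_le f g.
Proof.
have sub_translate : {subset corners (translate t f) <= corners (translate t g)} <->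
    {subset corners f <= corners g}.
  rewrite !corners_translate; split=> sub x.
    by move/(map_f (+%R^~ t))/sub/mapP=> [y yg /addIr->].
  by case/mapP=> y /sub yg ->; apply: map_f.
by case: f sub_translate => [|v|v l|v l|]; case: g => [|v'|v' l'|v' l'|] //=.
Qed.

Lemma tri_leE f g : (tess_rank f < 4)%N -> (tess_rank g < 4)%N ->
  tri_le f g <-> {subset corners f <= corners g}.
Proof. by case: f => [|v|v l|v l|]; case: g. Qed.

Lemma tface_le i j v k : (i <= j <= 4)%N -> tri_le (tface i v k) (tface j v k).
Proof.
case/andP=> le_ij; rewrite leq_eqVlt => /orP[/eqP->|lt_j4].
  by rewrite /=; case: (tface i v k).
have lt_i4 := leq_ltn_trans le_ij lt_j4.
apply/tri_leE; rewrite ?tess_rank_tface // ?(ltnW lt_i4) ?(ltnW lt_j4) // => x.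
rewrite !corners_tface //.
by rewrite -(take_takel _ le_ij) => /mem_take.
Qed.

Lemma mem_take_directions v k l j : (j < 4)%N ->
  v + unit_vec k \in take j [:: v; v + unit_vec l; v + unit_vec l.+1] ->
  (1 < j)%N && (k == l %[mod 6]) || (j == 3) && (k == l.+1 %[mod 6]).
Proof.
rewrite -!unit_vec_eq.
case: j => [|[|[|[|//]]]] _ //=; rewrite ?inE -{2}[v]addr0 !(inj_eq (addrI v));
  by rewrite (negPf (unit_vec_neq0 k)) ?orbF.
Qed.

Lemma tface_sub_common_flag i j v k l : (0 < i < 4)%N -> (j < 4)%N ->
  {subset corners (tface i v k) <= corners (tface j v l)} ->
  exists v' k', [/\ (i <= j)%N, tface i v k = tface i v' k'
                  & tface j v l = tface j v' k'].
Proof.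
move=> /andP[i_gt0 lt_i4] lt_j4 sub.
have {}sub x : x \in take i [:: v; v + unit_vec k; v + unit_vec k.+1] ->
    x \in take j [:: v; v + unit_vec l; v + unit_vec l.+1].
  by rewrite -!corners_tface //; apply: sub.
case: i i_gt0 lt_i4 sub => [|[|[|[|//]]]] // _ _ sub.
- have := sub v (mem_head _ _); case: j lt_j4 {sub} => // j _ _.
  by exists v, l.
- have /(mem_take_directions lt_j4) := sub (v + unit_vec k) (mem_last v [:: v + unit_vec k]).
  case/orP=> [/andP[j_gt1 /eqP kl]|/andP[/eqP-> /eqP kl]].
    by exists v, l; rewrite (tface_eqmod 2 v kl).
  exists (v + unit_vec k), (k + 3)%N; rewrite /= tedgeD3; split=> //.
  have /eqP-> : unit_vec k == unit_vec l.+1 by rewrite unit_vec_eq; apply/eqP.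
  by rewrite -(ttriD4 v l); apply: (tface_eqmod 3); rewrite -[RHS]modnDml kl modnDml addSnnS.
- have u1 := sub (v + unit_vec k); rewrite !inE eqxx orbT in u1.
  have {u1}/(mem_take_directions lt_j4) := u1 isT.
  have /(mem_take_directions lt_j4) :=
    sub (v + unit_vec k.+1) (mem_last v [:: v + unit_vec k; v + unit_vec k.+1]).
  have [-> kl1 kl|] := eqVneq j 3; last by clear; lia.
  by exists v, l; rewrite (@tface_eqmod 3 v k l) //; move: kl1 kl; clear; lia.
Qed.

Lemma tri_leP f g : tri_le f g -> exists v k,
  [/\ (tess_rank f <= tess_rank g)%N, f = tface (tess_rank f) v k
    & g = tface (tess_rank g) v k].
Proof.
have [-> _|g_proper] := pselect (g = TPlane).
  by have [v [k fE]] := tfaceP f; exists v, k; split=> //; case: (f).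
have [-> _|f_proper] := pselect (f = TEmpty).
  by have [v [k gE]] := tfaceP g; exists v, k.
have lt_g4 : (tess_rank g < 4)%N by case: g g_proper.
move=> le_fg; have rf : (0 < tess_rank f < 4)%N.
  by case: f g f_proper le_fg lt_g4 {g_proper} => [|v|v l|v l|] [].
have {le_fg}/(tri_leE (andP rf).2 lt_g4) sub := le_fg.
have [v [k fE]] := tfaceP f.
have v_f : v \in corners f.
  case/andP: rf => r0 r4; rewrite fE corners_tface //.
  by case: (tess_rank f) r0 => // i _; rewrite mem_head.
have [l gE] := mem_corners (sub v v_f).
rewrite fE gE in sub.
have [v' [k' [le_fg fE' gE']]] := tface_sub_common_flag rf lt_g4 sub.
by exists v', k'; rewrite -fE' -gE'.
Qed.

Lemma tedge_translate_mod3 v w t k l :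
  tedge v k = translate t (tedge w l) -> k = l %[mod 3].
Proof.
have tedge_dir v1 k1 : exists v2, tedge v1 k1 = TEdge v2 (inord (k1 %% 3)).
  rewrite /tedge; case: ifP => k3; [exists v1 | exists (v1 + unit_vec k1)];
  by congr (TEdge _ (inord _)); move: k3; clear; lia.
have [v1 ->] := tedge_dir v k; have [v2 ->] := tedge_dir w l.
by move=> [_ /(congr1 val)]; rewrite /= !inordK ?ltn_mod.
Qed.

Lemma ttri_translate_odd v w t k l :
  ttri v k = translate t (ttri w l) -> odd k = odd l.
Proof.
have ttri_dir v1 k1 : exists v2, ttri v1 k1 = TTriangle v2 (inord (odd k1)).
  have -> : odd k1 = odd (k1 %% 6) by rewrite {1}(divn_eq k1 6) oddD oddM andbF.
  by rewrite /ttri; case_mod6 k1; eexists.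
have [v1 ->] := ttri_dir v k; have [v2 ->] := ttri_dir w l.
move=> [_ /(congr1 val)]; rewrite /= !inordK ?ltnS ?leq_b1 //.
by case: (odd k) (odd l) => -[].
Qed.

Lemma in_lattice0 u : in_lattice u 0.
Proof. by exists 0, 0; rewrite !mulr0z addr0. Qed.

Lemma in_latticeB u s t : in_lattice u s -> in_lattice u t -> in_lattice u (s - t).
Proof.
case=> a [b ->] [c [d ->]]; exists (a - c), (b - d).
by rewrite !mulrzBr opprD addrACA.
Qed.

Lemma in_latticeN u t : in_lattice u t -> in_lattice u (- t).
Proof. by rewrite -sub0r; apply/in_latticeB/in_lattice0. Qed.

Lemma in_latticeD u s t : in_lattice u s -> in_lattice u t -> in_lattice u (s + t).
Proof. by move=> us ut; rewrite -[t]opprK; apply/in_latticeB/in_latticeN. Qed.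

Lemma translation_orbit_refl u f : translation_orbit u f f.
Proof. by exists 0; [apply: in_lattice0 | rewrite translate0]. Qed.

Lemma translation_orbit_sym u f g : translation_orbit u f g -> translation_orbit u g f.
Proof.
case=> t ut ->; exists (- t); first exact: in_latticeN.
by rewrite translateD subrr translate0.
Qed.

Lemma translation_orbit_trans u f g g' :
  translation_orbit u f g -> translation_orbit u g g' -> translation_orbit u f g'.
Proof.
case=> t ut -> [s us ->]; exists (t + s); first exact: in_latticeD.
by rewrite translateD.
Qed.

Lemma tess_rank_orbit u f g : translation_orbit u f g -> tess_rank g = tess_rank f.
Proof. by case=> t _ ->; rewrite tess_rank_translate. Qed.

Definition torus_class u f : torus_face u :=
  exist _ (translation_orbit u f) (ex_intro _ f erefl).

Lemma torus_class_surj u (A : torus_face u) : exists f, torus_class u f = A.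
Proof. by case: A => A [f AE]; exists f; apply: eq_exist. Qed.

Lemma torus_class_eqP u f g :
  torus_class u f = torus_class u g <-> translation_orbit u f g.
Proof.
split=> [/(congr1 sval) /= ->|fg]; first exact: translation_orbit_refl.
apply: eq_exist; apply/funext=> f'; apply/propext; split.
  exact/translation_orbit_trans/translation_orbit_sym.
exact: translation_orbit_trans.
Qed.

Lemma torus_class_leP u f g : torus_le tri_le (torus_class u f) (torus_class u g) <->
  exists2 g', translation_orbit u g g' & tri_le f g'.
Proof.
split=> [[_ [g1 [/= [t ut ->] gg1 le_fg1]]]|[g' gg' le_fg']]; last first.
  by exists f, g'; split=> //=; apply: translation_orbit_refl.
exists (translate (- t) g1).
  by apply: translation_orbit_trans gg1 _; exists (- t) => //; apply: in_latticeN.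
by apply/(tri_le_translate t); rewrite [X in tri_le _ X]translateD addNr translate0.
Qed.

(** [h] identifies the quotient of the triangular tessellation by the lattice
    of [u] with the set of the elements below [F]. *)
Record torus_cover u (disp : Order.disp_t) (P : porderType disp) (F : P)
    (h : tess_face -> P) : Prop := TorusCover {
  cover_image : forall x, (x <= F)%O <-> exists f, h f = x;
  cover_fiber : forall f g, h f = h g <-> translation_orbit u f g;
  cover_le : forall f g, (h f <= h g)%O <->
    exists2 g', translation_orbit u g g' & tri_le f g'
}.

Lemma cover_plane u (disp : Order.disp_t) (P : porderType disp) (F : P) h :
  torus_cover u F h -> h TPlane = F.
Proof.
move=> hF; have [f fF] := (cover_image hF F).1 (lexx F).
apply/le_anti/andP; split; first by apply/(cover_image hF); exists TPlane.
rewrite -fF; apply/(cover_le hF); exists TPlane; first exact: translation_orbit_refl.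
by case: (f).
Qed.

Lemma cover_homo u (disp : Order.disp_t) (P : porderType disp) (F : P) h f g :
  torus_cover u F h -> tri_le f g -> (h f <= h g)%O.
Proof.
by move=> hF le_fg; apply/(cover_le hF); exists g; first exact: translation_orbit_refl.
Qed.

Lemma torus_coverP u (disp : Order.disp_t) (P : porderType disp) (F : P) :
  (exists h, torus_cover u F h) <->
  order_iso (fun x y : {x : P | (x <= F)%O} => (sval x <= sval y)%O) (@map36 u).
Proof.
split=> [[h [h_image h_fiber h_le]]|[phi [psi phiK psiK] phi_le]].
  have lift (x : {x : P | (x <= F)%O}) : exists f, h f = sval x.
    by apply/h_image; exact: (svalP x).
  pose phi x := torus_class u (sval (cid (lift x))).
  have phiE x f : h f = sval x -> phi x = torus_class u f.
    by move=> hf; apply/torus_class_eqP/h_fiber; rewrite hf; exact: (svalP (cid (lift x))).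
  have below f : (h f <= F)%O by apply/h_image; exists f.
  exists phi => [|x y]; last first.
    have [[f fx] [g gy]] := (lift x, lift y).
    by rewrite (phiE x f) // (phiE y g) // -fx -gy h_le; symmetry; apply: torus_class_leP.
  exists (fun A => exist (fun x => is_true (x <= F)%O) _
      (below (sval (cid (torus_class_surj A))))) => [x|A].
    case: cid => f /= /torus_class_eqP/h_fiber hf; apply: val_inj => /=.
    by rewrite hf; exact: (svalP (cid (lift x))).
  by case: cid => f fA /=; rewrite (phiE _ f).
exists (fun f => sval (psi (torus_class u f))); split=> [x|f g|f g].
- split=> [xF|[f <-]]; last exact: (svalP (psi _)).
  have [f fE] := torus_class_surj (phi (exist _ x xF)).
  by exists f; rewrite fE phiK.
- by rewrite -torus_class_eqP; split=> [/val_inj/(can_inj psiK)|->].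
- by rewrite phi_le !psiK; apply: torus_class_leP.
Qed.

Lemma dual_has_type n (P : polytope n) (d : {perm P}) u : duality d ->
  (forall F : P, rank F = n%:Z - 1 -> exists h, torus_cover u F h) ->
  has_type P (@map36 u) (@map63 u).
Proof.
move=> dE facets.
have {}facets F rF := (torus_coverP u F).1 (facets F rF).
split=> // v rv.
have [phi phi_bij phi_le] : order_iso
    (fun x y : {x : P | (x <= d v)%O} => (sval x <= sval y)%O) (@map36 u).
  by apply: facets; rewrite (duality_rank _ dE) rv subr0.
have to_le (x : {x : P | (v <= x)%O}) : (d (sval x) <= d v)%O.
  by rewrite dE; apply: (svalP x).
have of_le (y : {y : P | (y <= d v)%O}) : (v <= (d^-1)%g (sval y))%O.
  by rewrite -dE permKV; apply: (svalP y).
exists (fun x => phi (exist _ (d (sval x)) (to_le x))).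
  apply: (bij_comp phi_bij); exists (fun y => exist _ ((d^-1)%g (sval y)) (of_le y)).
    by case=> x vx; apply: eq_exist; rewrite /= permK.
  by case=> y yv; apply: eq_exist; rewrite /= permKV.
move=> x y; rewrite -dE.
have := phi_le (exist _ (d (sval y)) (to_le y)) (exist _ (d (sval x)) (to_le x)).
by move=> /= ->; split=> -[f [g [? ? ?]]]; exists g, f.
Qed.

End Tessellation.

(** * Groups acting as rotations of the triangular lattice *)

Section GroupPreliminaries.
Local Open Scope group_scope.
Variable gT : finGroupType.
Implicit Types (g h : gT) (H : {group gT}).

Lemma gen_ind (S : {set gT}) (Pr : gT -> Prop) :
  Pr 1 -> (forall x g, x \in S -> Pr g -> Pr (x * g)) -> {in <<S>>, forall g, Pr g}.
Proof.
move=> Pr1 PrM g /gen_prodgP[n [c cS ->]].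
elim: n c cS => [|n IHn] c cS; first by rewrite big_ord0.
by rewrite big_ord_recl; apply: PrM => //; apply: IHn.
Qed.

Lemma gen_set2 g h : g \in <<[set g; h]>> /\ h \in <<[set g; h]>>.
Proof. by split; apply: mem_gen; rewrite !inE eqxx ?orbT. Qed.

Lemma gen_set2_sub g h H : (<<[set g; h]>> \subset H) = (g \in H) && (h \in H).
Proof. by rewrite gen_subG subUset !sub1set. Qed.

Lemma gen_set2V g h : <<[set g^-1; h^-1]>> = <<[set g; h]>>.
Proof.
apply/eqP; rewrite eqEsubset !gen_set2_sub; apply/andP; split.
  by have [gH hH] := gen_set2 g h; rewrite !groupV gH.
by have [gH hH] := gen_set2 g^-1 h^-1; rewrite -groupV gH -groupV.
Qed.

Lemma cycle_expg2 g h : g ^+ 2 = 1 -> h \in <[g]> -> h = 1 \/ h = g.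
Proof.
move=> g2 /cycleP[n ->]; rewrite -(expg_mod n g2).
by move: (n %% 2)%N (ltn_pmod n (isT : 0 < 2)%N) => [|[|//]] _; [left | right].
Qed.

Lemma cycle_expg3 g h : g ^+ 3 = 1 -> h \in <[g]> -> h = 1 \/ g \in <[h]>.
Proof.
move=> g3 /cycleP[n ->]; rewrite -(expg_mod n g3).
move: (n %% 3)%N (ltn_pmod n (isT : 0 < 3)%N) => [|[|[|//]]] _; first by left.
  by right; apply: cycle_id.
by right; apply/cycleP; exists 2; rewrite -expgM (expgD g 3 1) g3 mul1g.
Qed.

Lemma cycle3_disjoint g h z : g ^+ 3 = 1 -> g \notin <[h]> ->
  z \in <[g]> -> z \in <[h]> -> z = 1.
Proof.
move=> g3 gh zg zh; have [//|gz] := cycle_expg3 g3 zg.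
by case/negP: gh; apply: (subsetP _ g gz); rewrite cycle_subG.
Qed.

Lemma invg_expg2 g : g ^+ 2 = 1 -> g^-1 = g.
Proof. by move=> g2; apply: (mulgI g); rewrite mulgV -expg2. Qed.

(* [h] inverts [g]. *)
Lemma dihedral_prod g h :
  h ^+ 2 = 1 -> (g * h) ^+ 2 = 1 -> <<[set g; h]>> = <[g]> * <[h]>.
Proof.
move=> h2 gh2; rewrite -[<<_>>]/([set g] <*> [set h]) -joing_idl -joing_idr.
rewrite norm_joinEr // cycle_subG; apply/normP/eqP; rewrite -cycleJ.
suff -> : g ^ h = g^-1 by rewrite cycleV.
by rewrite conjgE (invg_expg2 h2); apply: (mulgI g); rewrite mulgV -gh2 expg2 !mulgA.
Qed.

Lemma dihedral_prod_mul g h :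
  h ^+ 2 = 1 -> (g * h) ^+ 2 = 1 -> <<[set g; h]>> = <[g]> * <[g * h]>.
Proof.
move=> h2 gh2; rewrite -dihedral_prod //; last first.
  have -> : g * (g * h) = h ^ g^-1.
    by rewrite conjgE invgK -(invg_expg2 gh2) invMg (invg_expg2 h2) mulgA.
  by rewrite -conjXg h2 conj1g.
apply/eqP; rewrite eqEsubset !gen_set2_sub; apply/andP; split.
  by have [gH ghH] := gen_set2 g (g * h); rewrite gH -(groupMl _ gH).
by have [gH hH] := gen_set2 g h; rewrite gH groupM.
Qed.

Lemma group_mulC (A B : {group gT}) H : H = A * B :> {set gT} -> A * B = B * A.
Proof. by move=> HE; apply/comm_group_setP; rewrite -HE groupP. Qed.

Lemma mulg_cycle2_sub H h : h ^+ 2 = 1 -> H * <[h]> \subset H :|: H :* h.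
Proof.
move=> h2; apply/subsetP=> _ /mulsgP[u v uH /(cycle_expg2 h2) vE ->].
by case: vE => ->; rewrite inE mem_rcoset ?mulg1 ?mulgK uH ?orbT.
Qed.

End GroupPreliminaries.

Section IntegerPowers.
Local Open Scope group_scope.
Variable gT : finGroupType.
Implicit Types (x y : gT) (a b : int).

Definition expgz x a : gT :=
  match a with Posz n => x ^+ n | Negz n => x ^- n.+1 end.

Lemma expgz_subn x (n m : nat) : expgz x (n%:Z - m%:Z)%R = x ^+ n * x ^- m.
Proof.
have [le_mn|/ltnW le_nm] := leqP m n.
  by rewrite subzn //= -{2}(subnK le_mn) expgD mulgK.
have -> : (n%:Z - m%:Z)%R = (- (m - n)%N%:Z)%R by rewrite -subzn // opprB.
rewrite -{2}(subnK le_nm) expgD invMg mulKVg.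
by case: (m - n)%N => //=; rewrite !expg0 invg1.
Qed.

Lemma int_subn a : exists n m : nat, a = (n%:Z - m%:Z)%R.
Proof.
case: a => n; first by exists n, 0; rewrite subr0.
by exists 0, n.+1; rewrite sub0r NegzE.
Qed.

Lemma groupXz (H : {group gT}) x a : x \in H -> expgz x a \in H.
Proof. by move=> xH; case: a => n /=; rewrite ?groupV groupX. Qed.

Lemma commuteXz x y a b : commute x y -> commute (expgz x a) (expgz y b).
Proof.
move=> /cent1P xy; apply/commute_sym/cent1P/groupXz/cent1P/commute_sym/cent1P.
exact: groupXz.
Qed.

Lemma expgzD x a b : expgz x (a + b)%R = expgz x a * expgz x b.
Proof.
have [n1 [m1 ->]] := int_subn a; have [n2 [m2 ->]] := int_subn b.
rewrite addrACA -opprD -!PoszD !expgz_subn !expgD invMg -!mulgA; congr (_ * _).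
rewrite mulgA -(expgz_subn x n2 m2).
have -> : x ^- m1 = expgz x (0%:Z - m1%:Z)%R by rewrite expgz_subn expg0 mul1g.
exact: commuteXz.
Qed.

Lemma expgzN x a : expgz x (- a)%R = (expgz x a)^-1.
Proof. by apply: (mulgI (expgz x a)); rewrite -expgzD subrr mulgV. Qed.

Lemma expVgz x a : expgz x^-1 a = expgz x (- a)%R.
Proof. by rewrite expgzN; case: a => n /=; rewrite expVgn ?invgK. Qed.

Lemma exp1gz a : expgz (1 : gT) a = 1.
Proof. by case: a => n /=; rewrite expg1n ?invg1. Qed.

Lemma conjXgz x y a : (expgz x a) ^ y = expgz (x ^ y) a.
Proof. by case: a => n /=; rewrite ?conjVg conjXg. Qed.

Lemma expMgz x y a : commute x y -> expgz (x * y) a = expgz x a * expgz y a.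
Proof.
move=> xy; case: a => n /=; rewrite expgMn // invMg.
by apply: commuteV; apply/commute_sym/commuteV/commute_sym/commuteX2.
Qed.

End IntegerPowers.

Lemma morphXz (aT rT : finGroupType) (D : {group aT}) (f : {morphism D >-> rT}) x (a : int) :
  x \in D -> f (expgz x a) = expgz (f x) a.
Proof. by move=> xD; case: a => n /=; rewrite ?morphV ?morphX ?groupX. Qed.

Section HexActions.
Local Open Scope group_scope.
Variable gT : finGroupType.
Implicit Types (v w : point) (k l : nat).

(** [x] acts as the unit translation, and [q] as the rotation by 60 degrees, of
    a quotient of the triangular lattice. *)
Definition hex_action (q x : gT) : Prop :=
  [/\ commute x (x ^ q), x ^ (q ^+ 2) = x^-1 * x ^ q & q ^+ 6 = 1].

Definition transl (q x : gT) v : gT := expgz x v.1 * expgz (x ^ q) v.2.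

(** The rotation by [60 k] degrees followed by the translation by [v]. *)
Definition rotransl (q x : gT) v k : gT := q ^+ k * transl q x v.

Definition rotation_faithful (q x : gT) : Prop :=
  forall v k, rotransl q x v k = 1 -> (6 %| k)%N.

(** The rotation by 240 degrees about the centre of a triangle. *)
Definition tri_rot (q x : gT) : gT := q ^+ 3 * x * q.

Lemma transl0 q x : transl q x 0%R = 1. Proof. exact: mulg1. Qed.

Lemma transl_unit q x : transl q x (1, 0)%R = x.
Proof. by rewrite /transl /= expg0 mulg1. Qed.

Lemma transl_conjg q x v g : transl (q ^ g) (x ^ g) v = transl q x v ^ g.
Proof. by rewrite /transl -conjJg -!conjXgz -conjMg. Qed.

Lemma transl_mem (H : {group gT}) q x v : q \in H -> x \in H -> transl q x v \in H.
Proof. by move=> qH xH; rewrite groupM ?groupXz ?groupJ. Qed.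

Lemma rotransl_mem (H : {group gT}) q x v k :
  q \in H -> x \in H -> rotransl q x v k \in H.
Proof. by move=> qH xH; rewrite groupM ?groupX ?transl_mem. Qed.

End HexActions.

Section HexActionTheory.
Local Open Scope group_scope.
Variables (gT : finGroupType) (q x : gT).
Hypothesis qx : hex_action q x.
Implicit Types (v w : point) (k l : nat).
Local Notation transl := (transl q x).
Local Notation rotransl := (rotransl q x).
Local Notation tri_rot := (tri_rot q x).

Lemma translD v w : transl (v + w)%R = transl v * transl w.
Proof.
have [xxq _ _] := qx; rewrite /transl /= !expgzD -!mulgA; congr (_ * _).
by rewrite !mulgA; congr (_ * _); apply: commuteXz.
Qed.

Lemma translN v : transl (- v)%R = (transl v)^-1.
Proof. by apply: (mulgI (transl v)); rewrite -translD subrr transl0 mulgV. Qed.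

Lemma translXz v a : expgz (transl v) a = transl (v *~ a)%R.
Proof.
have translX w n : transl w ^+ n = transl (w *+ n)%R.
  by elim: n => [|n IHn]; rewrite ?transl0 // expgS IHn -translD mulrS.
case: a => n /=; first by rewrite translX pmulrn.
by rewrite translX -translN NegzE mulrNz -pmulrn.
Qed.

Lemma translJ v : (transl v) ^ q = transl (rot60 v).
Proof.
have [xxq xqq _] := qx; rewrite /transl conjMg !conjXgz -conjgM -expg2 xqq /=.
rewrite (@expMgz _ x^-1 (x ^ q)); last exact: commute_sym (commuteV (commute_sym xxq)).
rewrite expVgz expgzD !mulgA; congr (_ * _).
exact/commute_sym/commuteXz.
Qed.

Lemma translJX v k : (transl v) ^ (q ^+ k) = transl (iter k rot60 v).
Proof.
elim: k => [|k IHk]; first by rewrite expg0 conjg1.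
by rewrite expgSr conjgM IHk translJ.
Qed.

Lemma rotranslM v k w l :
  rotransl v k * rotransl w l = rotransl (iter l rot60 v + w)%R (k + l).
Proof.
rewrite /rotransl mulgA -(mulgA (q ^+ k)) [transl v * _]conjgC translJX.
by rewrite expgD translD !mulgA.
Qed.

Lemma rotation_expg_mod6 k : q ^+ (k %% 6) = q ^+ k.
Proof. by have [_ _ q6] := qx; rewrite expg_mod. Qed.

Lemma rotransl_eqmod v k l : k = l %[mod 6] -> rotransl v k = rotransl v l.
Proof. by move=> kl; rewrite /rotransl -rotation_expg_mod6 kl rotation_expg_mod6. Qed.

Lemma rotation_invE : q^-1 = rotransl 0%R 5.
Proof.
have [_ _ q6] := qx; rewrite /rotransl transl0 mulg1.
by apply: (mulgI q); rewrite mulgV -expgS.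
Qed.

Lemma tri_rotE : tri_rot = rotransl (unit_vec 1) 4.
Proof.
by rewrite /tri_rot /rotransl -mulgA [x * q]conjgC -{1}[x](transl_unit q) translJ mulgA -expgSr.
Qed.

Lemma rotation_inv_rotransl v k : q^-1 * rotransl v k = rotransl v (k + 5).
Proof. by rewrite rotation_invE rotranslM iter_rot60_0 add0r addnC. Qed.

Lemma tri_rot_rotransl v k : tri_rot * rotransl v k = rotransl (v + unit_vec k.+1)%R (k + 4).
Proof. by rewrite tri_rotE rotranslM addrC addnC /unit_vec -iterD addn1. Qed.

Lemma edge_rot_rotransl v k :
  tri_rot * q^-1 * rotransl v k = rotransl (v + unit_vec k)%R (k + 3).
Proof.
rewrite -mulgA rotation_inv_rotransl tri_rot_rotransl -addnS unit_vecD6.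
by apply: rotransl_eqmod; rewrite -addnA -[(5 + 4)%N]/(3 + 6)%N addnA modnDr.
Qed.

Lemma gen_rotranslP g :
  reflect (exists v k, g = rotransl v k) (g \in <<[set q^-1; tri_rot]>>).
Proof.
apply: (iffP idP) => [|[v [k ->]]]; last first.
  have [qK rK] := gen_set2 q^-1 tri_rot; rewrite groupV in qK.
  apply: rotransl_mem => //; have xE : x = q ^- 3 * tri_rot * q^-1.
    by rewrite /tri_rot -(mulgA (q ^+ 3)) mulKg mulgK.
  rewrite [X in X \in _]xE.
  exact: groupM (groupM (groupVr (groupX 3 qK)) rK) (groupVr qK).
move: g; apply: gen_ind => [|y g]; first by exists 0%R, 0; rewrite /rotransl transl0 mulg1.
case/set2P=> -> [v [k ->]]; first by exists v, (k + 5)%N; rewrite rotation_inv_rotransl.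
by exists (v + unit_vec k.+1)%R, (k + 4)%N; rewrite tri_rot_rotransl.
Qed.

Lemma rotransl_inj v k w l : rotation_faithful q x ->
  rotransl v k = rotransl w l -> transl (v - w)%R = 1 /\ k = l %[mod 6].
Proof.
have [_ _ q6] := qx; move=> faithful eq_vw.
have quotient1 : rotransl (v - w)%R (5 * l + k) = 1.
  transitivity (q ^+ (5 * l) * (rotransl v k * (transl w)^-1)).
    by rewrite /rotransl translD translN expgD !mulgA.
  by rewrite eq_vw /rotransl mulgK -expgD -mulSnr expgM q6 expg1n.
have dvd6 := faithful _ _ quotient1; split; last by move: dvd6; clear; lia.
by rewrite -quotient1 /rotransl -rotation_expg_mod6 (eqP dvd6) expg0 mul1g.
Qed.

End HexActionTheory.

Section MorphHexActions.
Local Open Scope group_scope.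
Variables (aT rT : finGroupType) (D : {group aT}) (f : {morphism D >-> rT}).

Lemma morph_transl q x v : q \in D -> x \in D ->
  f (transl q x v) = transl (f q) (f x) v.
Proof.
move=> qD xD; have xqD : x ^ q \in D by rewrite groupJ.
by rewrite /transl morphM ?groupXz // !morphXz // morphJ.
Qed.

Lemma morph_rotransl q x v k : q \in D -> x \in D ->
  f (rotransl q x v k) = rotransl (f q) (f x) v k.
Proof.
by move=> qD xD; rewrite /rotransl -morph_transl // morphM ?morphX ?groupX ?transl_mem.
Qed.

End MorphHexActions.
Section ToroidalRotations.
Local Open Scope group_scope.
Variable gT : finGroupType.

Definition unit_transl (s1 s2 : gT) : gT := s2 ^+ 3 * s1 * s2.

(** The relations of the rotations of a self-dual 4-polytope with facets
    [{3,6}]. Here [L] is the lattice of the translations that act trivially on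
    the facet, and [d] is a duality fixing the base flag. *)
Record toroidal_rotations (s1 s2 s3 d : gT) (L : point -> Prop) : Prop :=
  ToroidalRotations {
    rot1_expg3 : s1 ^+ 3 = 1;
    rot12_expg2 : (s1 * s2) ^+ 2 = 1;
    rot123_expg2 : (s1 * s2 * s3) ^+ 2 = 1;
    rot_hex_action : hex_action s2^-1 (unit_transl s1 s2);
    rot_transl_eq1 : forall v, transl s2^-1 (unit_transl s1 s2) v = 1 <-> L v;
    rot_transl_vertex : forall v,
      transl s2^-1 (unit_transl s1 s2) v \in <<[set s2; s3]>> -> L v;
    rot1_dual : s1 ^ d = s3^-1;
    rot2_dual : s2 ^ d = s2^-1;
    rot3_dual : s3 ^ d = s1^-1
  }.

Lemma tri_rot_unit_transl s1 s2 : tri_rot s2^-1 (unit_transl s1 s2) = s1.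
Proof. by rewrite /tri_rot /unit_transl -(mulgA (s2^-1 ^+ 3)) mulgK expVgn mulKg. Qed.

Lemma toroidal_rotations_iff s1 s2 s3 d (L L' : point -> Prop) :
  (forall v, L v <-> L' v) ->
  toroidal_rotations s1 s2 s3 d L -> toroidal_rotations s1 s2 s3 d L'.
Proof. by move=> LL' [? ? ? ? tr1 trV ? ? ?]; split=> // v; rewrite -LL' // => /trV. Qed.

End ToroidalRotations.

(** * Rotations of a regular polytope with toroidal facets *)

Section RegularPolytope.
Variables (n : nat) (Q : polytope n) (Phi : {set Q}).

Definition sigma (i : nat) : {perm Q} := (rho Phi i.-1 * rho Phi i)%g.

Lemma Gamma_plus_sub : Gamma_plus Phi \subset Gamma Q.
Proof.
have rhoG i : rho Phi i \in Gamma Q.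
  by rewrite /rho; case: pickP => [g /andP[]|_] //=; apply: group1.
by rewrite gen_subG; apply/subsetP=> _ /imsetP[i _ ->]; apply: groupM.
Qed.

Hypothesis Phi_flag : flag Phi.
Hypothesis Q_regular : regular Q.
Local Notation r := (rho Phi).
Implicit Types (g d : {perm Q}) (A B : {set Q}) (i j : nat).

Lemma regular_trans A B : flag A -> flag B -> exists2 g, g \in Gamma Q & g @: A = B.
Proof.
move=> fA fB; have trQ : [transitive Gamma Q, on flags Q | 'P^*] := Q_regular.
have [||g gG ->] := atransP2 trQ (x := A) (y := B); rewrite ?inE //; by exists g.
Qed.

Lemma rhoP i : (i < n)%N -> r i \in Gamma Q /\ i_adjacent i Phi (r i @: Phi).
Proof.
move=> lt_in; rewrite /rho; case: pickP => [g /andP[gG ag]|none] //=.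
have [B adj] := i_adjacent_exists lt_in Phi_flag.
have [_ fB] := i_adjacent_flags adj.
have [g gG gB] := regular_trans Phi_flag fB.
by have := none g; rewrite gG gB adj.
Qed.

Lemma rho_Gamma i : (i < n)%N -> r i \in Gamma Q.
Proof. by case/rhoP. Qed.

Lemma rho_adjacent i g : (i < n)%N -> g \in Gamma Q ->
  i_adjacent i (g @: Phi) ((r i * g)%g @: Phi).
Proof.
by move=> /rhoP[_ adj] gG; rewrite imset_permM; apply: Gamma_i_adjacent.
Qed.

Lemma rho_imset i g A : (i < n)%N -> g \in Gamma Q -> i_adjacent i (g @: Phi) A ->
  (r i * g)%g @: Phi = A.
Proof. by move=> lt_in gG; apply: i_adjacent_uniq (rho_adjacent lt_in gG). Qed.

Lemma rho_expg2 i : (i < n)%N -> (r i ^+ 2 = 1)%g.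
Proof.
move=> lt_in; have [rG adj] := rhoP lt_in.
apply: (Gamma_eq (A := Phi)); rewrite ?groupX ?group1 // imset_perm1.
by rewrite expg2; apply: rho_imset => //; apply: i_adjacent_sym.
Qed.

Lemma rho_comm i j : (i < n)%N -> (j < n)%N -> (i.+1 < j)%N || (j.+1 < i)%N ->
  (r i * r j = r j * r i)%g.
Proof.
move=> lt_in lt_jn far; have [riG adi] := rhoP lt_in; have [rjG adj] := rhoP lt_jn.
apply: (Gamma_eq (A := Phi)); rewrite ?groupM //.
rewrite orbC in far.
exact: (i_adjacent_comm lt_jn lt_in far adj (rho_adjacent lt_in rjG) adi (rho_adjacent lt_jn riG)).
Qed.

Lemma rho_fix i x : (i < n)%N -> x \in Phi -> rank x <> i%:Z -> r i x = x.
Proof.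
move=> lt_in xP rx; have [rG adj] := rhoP lt_in; have [_ fR] := i_adjacent_flags adj.
apply: (flag_rank_inj fR); [exact: imset_f | | exact: Gamma_rank].
by move/(i_adjacentP _ Phi_flag fR): adj => [_]; apply.
Qed.

Lemma self_dual_fixing_flag : self_dual Q ->
  exists2 d, duality d & d @: Phi = Phi.
Proof.
case=> d dE; have [g gG gd] := regular_trans (duality_flag dE Phi_flag) Phi_flag.
exists (d * g)%g; last by rewrite imset_permM.
by move=> x y; rewrite !permM (GammaP _ gG) dE.
Qed.

Lemma rho_conj_duality d i j : duality d -> d @: Phi = Phi -> (i + j).+1 = n ->
  (r i ^ d)%g = r j.
Proof.
move=> dE dPhi ij.
have [riG adi] : r i \in Gamma Q /\ i_adjacent i Phi (r i @: Phi).
  by apply: rhoP; rewrite -ij ltnS leq_addr.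
have lt_jn : (j < n)%N by rewrite -ij ltnS leq_addl.
have [rjG adj] := rhoP lt_jn.
have dV : d^-1%g @: Phi = Phi by rewrite -{1}dPhi -imset_permM mulgV imset_perm1.
apply: (Gamma_eq (A := Phi)) => //.
  apply/GammaP=> x y; rewrite conjgE !permM dE (GammaP _ riG).
  by rewrite -dE !permKV.
apply: i_adjacent_uniq lt_jn _ adj.
by rewrite conjgE !imset_permM dV -{1}dPhi; apply: duality_i_adjacent dE ij adi.
Qed.

End RegularPolytope.

Section FacetFlags.
Variables (Q : polytope 4) (u : point) (h : tess_face -> Q) (F top : Q).
Hypothesis hF : torus_cover u F h.
Hypothesis rankF : rank F = 3%:Z.
Hypothesis topP : forall x, (x <= top)%O.
Implicit Types (e : bool) (v w t : point) (f : tess_face) (i j k l : nat).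

(** The two flags of the tessellation at the vertex [v] and the edge
    [tedge v k]; [e] tells whether the triangle is on the right of the edge. *)
Definition flag_face e v k i : tess_face :=
  if e && (i == 3) then ttri v (k + 5) else tface i v k.

Lemma flag_faceS v k i : (1 < i)%N ->
  flag_face true v k i = tface i (v + unit_vec k) (k + 3).
Proof.
case: i => [|[|[|[|i]]]] //= _; first by rewrite tedgeD3.
rewrite /flag_face /= -(ttriD4 v (k + 5)) -addnS unit_vecD6.
by apply: (tface_eqmod 3); rewrite -addnA -[(5 + 4)%N]/(3 + 6)%N addnA modnDr.
Qed.

Lemma flag_face_eqmod e v i k l : k = l %[mod 6] -> flag_face e v k i = flag_face e v l i.
Proof.
move=> kl; rewrite /flag_face (tface_eqmod i v kl); case: ifP => // _.
by apply: (@tface_eqmod 3); rewrite -modnDml kl modnDml.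
Qed.

Lemma tess_rank_flag_face e v k i : (i <= 4)%N -> tess_rank (flag_face e v k i) = i.
Proof.
rewrite /flag_face; case: andP => [[_ /eqP->] _|_]; first exact: (@tess_rank_tface 3).
exact: tess_rank_tface.
Qed.

Lemma flag_face_le e v k i j : (i <= j <= 4)%N ->
  tri_le (flag_face e v k i) (flag_face e v k j).
Proof.
case: e => ij; last exact: tface_le.
have [i2|i2] := ltnP 1 i.
  by rewrite !flag_faceS ?(leq_trans i2) //; [apply: tface_le | case/andP: ij].
have -> : flag_face true v k i = tface i v (k + 5).
  by case: i i2 {ij} => [|[|]].
rewrite /flag_face; case: eqP ij => [->|_] ij /=; first exact: (@tface_le _ 3).
have -> : tface i v (k + 5) = tface i v k by case: i i2 {ij} => [|[|]].
exact: tface_le.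
Qed.

Lemma facet_rank f : rank (h f) = (tess_rank f)%:Z - 1.
Proof.
have lt v k i j : (i < j <= 4)%N -> (h (tface i v k) < h (tface j v k))%O.
  case/andP=> ij j4; have le_ij : (i <= j <= 4)%N by rewrite ltnW.
  rewrite lt_neqAle (cover_homo hF (tface_le v k le_ij)) andbT.
  apply/eqP=> /(cover_fiber hF)/tess_rank_orbit.
  by rewrite !tess_rank_tface ?(leq_trans (ltnW ij)) // => /eqP; rewrite gtn_eqF.
have [v [k fE]] := tfaceP f.
have r01 := rank_lt (lt v k 0%N 1%N isT); have r12 := rank_lt (lt v k 1%N 2%N isT).
have r23 := rank_lt (lt v k 2%N 3%N isT); have r34 := rank_lt (lt v k 3%N 4%N isT).
have /andP[r0 _] := rank_range (h (tface 0 v k)).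
have r4 : rank (h (tface 4 v k)) = 3%:Z by rewrite /= (cover_plane hF).
rewrite [in LHS]fE; have : (tess_rank f <= 4)%N by case: (f).
by case: (tess_rank f) => [|[|[|[|[|//]]]]] _; move: r01 r12 r23 r34 r0 r4; clear; lia.
Qed.

Definition facet_flag e v k : {set Q} := top |: [set h (flag_face e v k i) | i : 'I_5].

Lemma mem_facet_flag e v k i : (i <= 4)%N -> h (flag_face e v k i) \in facet_flag e v k.
Proof.
by move=> i4; apply/setU1P; right; apply/imsetP; exists (Ordinal (i4 : (i < 5)%N)).
Qed.

Lemma facet_flag_flag e v k : flag (facet_flag e v k).
Proof.
have i4 (i : 'I_5) : (i <= 4)%N := ltn_ord i.
apply: chain_flag.
  apply/chainP=> x y /setU1P[->|/imsetP[i _ ->]].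
    by rewrite /Order.comparable topP orbT.
  case/setU1P=> [->|/imsetP[j _ ->]]; first by rewrite /Order.comparable topP.
  case/orP: (leq_total i j) => ij; apply/orP; [left | right];
    by apply/(cover_homo hF)/flag_face_le; rewrite ij i4.
rewrite cardsU1 card_imset ?card_ord.
  case: imsetP => // -[i _ /(congr1 (@rank 4 Q))].
  by rewrite (greatest_rank topP) facet_rank tess_rank_flag_face //; have := i4 i; clear; lia.
move=> i j /(cover_fiber hF)/tess_rank_orbit; rewrite !tess_rank_flag_face //.
by move/esym/val_inj.
Qed.

Lemma facet_flag_adjacent i e v k e' v' k' : (i < 3)%N ->
  h (flag_face e v k i.+1) <> h (flag_face e' v' k' i.+1) ->
  (forall j, (j <= 3)%N -> j != i.+1 -> flag_face e v k j = flag_face e' v' k' j) ->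
  i_adjacent i (facet_flag e v k) (facet_flag e' v' k').
Proof.
move=> i3 neq agree; have fl := facet_flag_flag; have i4 : (i.+1 <= 4)%N := ltnW i3.
apply/i_adjacentP => //; split=> [eq_flags|x].
  apply: neq; apply: (flag_rank_inj (fl e v k)); rewrite ?facet_rank ?tess_rank_flag_face //.
  - by rewrite mem_facet_flag.
  - by rewrite eq_flags mem_facet_flag.
case/setU1P=> [->|/imsetP[j _ ->] rx]; first by rewrite setU11.
apply/setU1P; right; apply/imsetP; exists j => //; congr h.
have j5 := ltn_ord j; rewrite facet_rank tess_rank_flag_face // in rx.
have [->|j4] := eqVneq (j : nat) 4; first by rewrite /flag_face !andbF.
by apply: agree; move: rx j4 j5; clear; lia.
Qed.

Lemma facet_flag_eqmod e v k l : k = l %[mod 6] -> facet_flag e v k = facet_flag e v l.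
Proof.
move=> kl; congr (_ |: _); apply: eq_imset => i.
by rewrite (flag_face_eqmod e v i kl).
Qed.

Lemma facet_flag_translate v t k : in_lattice u t ->
  facet_flag false (v + t) k = facet_flag false v k.
Proof.
move=> ut; congr (_ |: _); apply: eq_imset => i.
by apply/esym/(cover_fiber hF); exists t; rewrite // /flag_face /= tface_translate.
Qed.

Lemma facet_flag_inj v k w l : facet_flag false v k = facet_flag false w l ->
  in_lattice u (v - w).
Proof.
move=> eq_flags; have : h (TVertex w) = h (TVertex v).
  apply: (flag_rank_inj (facet_flag_flag false v k)); rewrite ?facet_rank //.
    by rewrite eq_flags (mem_facet_flag false w l (i := 1)).
  exact: (mem_facet_flag false v k (i := 1)).
by move/(cover_fiber hF) => [t ut [->]]; rewrite addrC addKr.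
Qed.

Lemma facet_flag_adjacent2 v k : i_adjacent 2 (facet_flag false v k) (facet_flag true v k).
Proof.
apply: facet_flag_adjacent => // [|j _ j3]; last by rewrite /flag_face (negPf j3) andbF.
move/esym/(cover_fiber hF) => [t _ /ttri_translate_odd].
by rewrite oddD; case: (odd k).
Qed.

Lemma facet_flag_adjacent1 v k : i_adjacent 1 (facet_flag false v k) (facet_flag true v k.+1).
Proof.
apply: facet_flag_adjacent => // [|].
  by move/esym/(cover_fiber hF) => [t _ /tedge_translate_mod3]; clear; lia.
case=> [|[|[|[|//]]]] //= _ _; rewrite /flag_face /= addSnnS.
by apply: (tface_eqmod 3); rewrite modnDr.
Qed.

Lemma vertex_below_edge x v k : rank x = 0 -> (x <= h (tedge v k))%O ->
  x = h (TVertex v) \/ x = h (TVertex (v + unit_vec k)).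
Proof.
move=> rx x_le; have /(cover_image hF)[f fx] : (x <= F)%O.
  by apply: (le_trans x_le); apply/(cover_image hF); exists (tedge v k).
have [w fE] : exists w, f = TVertex w.
  have : tess_rank f = 1%N by have := facet_rank f; rewrite fx rx; clear; lia.
  by case: (f) => // w _; exists w.
rewrite -fx fE in x_le *; have [_ [t ut ->] w_le] := (cover_le hF _ _).1 x_le.
have : w \in corners (translate t (tedge v k)).
  have lt_g : (tess_rank (translate t (tedge v k)) < 4)%N.
    by rewrite tess_rank_translate (@tess_rank_tface 2).
  exact: (tri_leE (f := TVertex w) isT lt_g).1 w_le _ (mem_head _ _).
rewrite corners_translate => /mapP[z]; rewrite (@corners_tface 2) // => z_in ->.
have -> : h (TVertex (z + t)) = h (TVertex z).
  by apply/esym/(cover_fiber hF); exists t.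
by move: z_in; rewrite !inE => /orP[]/eqP->; [left | right].
Qed.

(* The 0-adjacent flag provides a second vertex of the edge in the quotient. *)
Lemma edge_vertices_neq v k : h (TVertex v) <> h (TVertex (v + unit_vec k)).
Proof.
have fM := facet_flag_flag false v k.
have [B adj] := i_adjacent_exists (isT : (0 < 4)%N) fM.
have [_ fB] := i_adjacent_flags adj.
have [neq sub] := i_adjacentP _ fM fB adj.
have memM i : (i <= 4)%N -> h (tface i v k) \in facet_flag false v k.
  exact: (@mem_facet_flag false v k i).
have vM := memM 1%N isT; rewrite /= in vM.
have eB : h (tedge v k) \in B.
  by apply: sub; [exact: (memM 2) | rewrite (facet_rank (tface 2 v k)) tess_rank_tface].
have [b bB rb] := flag_rank_surj (i := 0) fB isT.
have b_le : (b <= h (tedge v k))%O.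
  by rewrite (flag_le fB) // rb (facet_rank (tface 2 v k)) tess_rank_tface.
have b_new : b <> h (TVertex v).
  move=> bE; apply: neq; apply: flag_sub_eq => //; apply/subsetP=> x xM.
  have [rx|/eqP/sub->//] := eqVneq (rank x) 0.
  by rewrite (flag_rank_inj fM xM vM) -bE ?rx.
by case: (vertex_below_edge rb b_le) => [/b_new//|<- /esym/b_new].
Qed.

Lemma facet_flag_adjacent0 v k :
  i_adjacent 0 (facet_flag true v k) (facet_flag false (v + unit_vec k) (k + 3)).
Proof.
apply: facet_flag_adjacent => //; first exact: edge_vertices_neq.
by case=> [|[|j]] // _ _; rewrite flag_faceS.
Qed.

End FacetFlags.

Section FacetAction.
Variables (Q : polytope 4) (Phi : {set Q}) (u : point) (h : tess_face -> Q) (F top : Q).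
Hypothesis Phi_flag : flag Phi.
Hypothesis Q_regular : regular Q.
Hypothesis hF : torus_cover u F h.
Hypothesis rankF : rank F = 3%:Z.
Hypothesis topP : forall x, (x <= top)%O.
Hypothesis Phi_base : facet_flag h top false 0 0 = Phi.
Local Notation fflag := (facet_flag h top).
Local Notation r := (rho Phi).
Local Notation s1 := (sigma Phi 1).
Local Notation s2 := (sigma Phi 2).
Local Notation s3 := (sigma Phi 3).
Local Notation q := (s2^-1)%g.
Local Notation x := (unit_transl s1 s2).
Local Open Scope group_scope.
Implicit Types (g : {perm Q}) (v w : point) (k l : nat).

(** [g] acts on the flags of the facet like the rotation taking the flag
    [(0, 0)] of the tessellation to [(v, k)]. *)
Definition acts_as g v k : Prop := g \in Gamma Q /\
  forall g0 v0 k0, g0 \in Gamma Q -> g0 @: Phi = fflag false v0 k0 ->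
    (g * g0) @: Phi = fflag false (v0 + iter k0 rot60 v)%R (k0 + k)%N.

Lemma acts_as1 : acts_as 1 0%R 0.
Proof. by split=> // g0 v0 k0 _ E; rewrite mul1g E iter_rot60_0 addr0 addn0. Qed.

Lemma acts_asM g v k g' v' k' : acts_as g v k -> acts_as g' v' k' ->
  acts_as (g * g') (v' + iter k' rot60 v)%R (k + k')%N.
Proof.
move=> [gG gP] [gG' gP']; split=> [|g0 v0 k0 g0G E]; first exact: groupM.
rewrite -mulgA (gP _ _ _ _ (gP' _ _ _ g0G E)) ?groupM //.
by rewrite iter_rot60D addrA -iterD addnA addnAC.
Qed.

Lemma acts_as_eqmod g v k l : k = l %[mod 6] -> acts_as g v k -> acts_as g v l.
Proof.
move=> kl [gG gP]; split=> // g0 v0 k0 g0G E; rewrite (gP _ _ _ g0G E).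
by apply: facet_flag_eqmod; rewrite -modnDmr kl modnDmr.
Qed.

Lemma acts_as_imset g v k : acts_as g v k -> g @: Phi = fflag false v k.
Proof.
move=> [gG gP]; have := gP 1 0%R 0 (group1 _).
by rewrite mulg1 imset_perm1 Phi_base add0r; apply.
Qed.

Lemma acts_as_inj g v k g' v' k' : acts_as g v k -> acts_as g' v' k' ->
  in_lattice u (v - v')%R -> k = k' %[mod 6] -> g = g'.
Proof.
move=> gP gP' uv kk'; apply: (Gamma_eq (A := Phi)) => //; try by [case: gP | case: gP'].
rewrite (acts_as_imset gP) (acts_as_imset gP') (facet_flag_eqmod _ _ _ _ kk').
by rewrite -[v](subrK v') addrC (facet_flag_translate top hF).
Qed.

Lemma acts_as_uniq g g' v k k' :
  acts_as g v k -> acts_as g' v k' -> k = k' %[mod 6] -> g = g'.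
Proof.
by move=> gP gP'; apply: acts_as_inj gP gP' _; rewrite subrr; apply: in_lattice0.
Qed.

Lemma acts_asV g v : acts_as g v 0 -> acts_as g^-1 (- v)%R 0.
Proof.
move=> [gG gP]; split=> [|g0 v0 k0 g0G E]; first by rewrite groupV.
have fM := facet_flag_flag hF rankF topP false (v0 - iter k0 rot60 v)%R k0.
have [g1 g1G E1] := regular_trans Q_regular Phi_flag fM.
have := gP _ _ _ g1G E1; rewrite addn0 subrK -E => E2.
have <- : g * g1 = g0 by apply: Gamma_eq Phi_flag E2; rewrite ?groupM.
by rewrite mulKg E1 iter_rot60N ?addn0.
Qed.

Lemma acts_asX g v n : acts_as g v 0 -> acts_as (g ^+ n) (v *+ n)%R 0.
Proof.
move=> gP; elim: n => [|n IHn]; first by rewrite expg0 mulr0n; apply: acts_as1.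
by rewrite expgSr mulrS; apply: (acts_asM IHn gP).
Qed.

Lemma acts_asXz g v (a : int) : acts_as g v 0 -> acts_as (expgz g a) (v *~ a)%R 0.
Proof.
case: a => n gP /=; first by rewrite -pmulrn; apply: acts_asX.
by rewrite -expVgn NegzE mulrNz -mulNrz -pmulrn; apply/acts_asX/acts_asV.
Qed.

Lemma acts_as_sigma1 : acts_as s1 (unit_vec 1) 4.
Proof.
have [G0 G1] : r 0 \in Gamma Q /\ r 1 \in Gamma Q by split; apply: rho_Gamma.
split=> [|g0 v0 k0 g0G E]; first by rewrite groupM.
rewrite -mulgA; apply: rho_imset => //; first by rewrite groupM.
have -> : (r 1 * g0) @: Phi = fflag true v0 k0.+1.
  by apply: rho_imset => //; rewrite E; apply: (facet_flag_adjacent1 hF rankF topP).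
have -> : (v0 + iter k0 rot60 (unit_vec 1) = v0 + unit_vec k0.+1)%R.
  by rewrite /unit_vec -iterD addn1.
have -> : (k0 + 4 = k0.+1 + 3)%N by rewrite addSnnS.
exact: (facet_flag_adjacent0 hF rankF topP).
Qed.

Lemma acts_as_sigma2 : acts_as s2 0%R 5.
Proof.
have [G1 G2] : r 1 \in Gamma Q /\ r 2 \in Gamma Q by split; apply: rho_Gamma.
split=> [|g0 v0 k0 g0G E]; first by rewrite groupM.
rewrite -mulgA; apply: rho_imset => //; first by rewrite groupM.
have -> : (r 2 * g0) @: Phi = fflag true v0 k0.
  by apply: rho_imset => //; rewrite E; apply: (facet_flag_adjacent2 hF rankF topP).
rewrite iter_rot60_0 addr0; apply: i_adjacent_sym.
have <- : fflag true v0 (k0 + 5).+1 = fflag true v0 k0.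
  by apply: facet_flag_eqmod; rewrite -addnS modnDr.
exact: (facet_flag_adjacent1 hF rankF topP).
Qed.

Lemma acts_as_sigma2X n : acts_as (s2 ^+ n) 0%R (n * 5).
Proof.
elim: n => [|n IHn]; first by rewrite expg0; apply: acts_as1.
by rewrite expgSr mulSnr -[0%R](addr0 0%R) -{2}(iter_rot60_0 5); apply: acts_asM acts_as_sigma2.
Qed.

Lemma sigma2_expg6 : s2 ^+ 6 = 1.
Proof. exact: acts_as_uniq (acts_as_sigma2X 6) acts_as1 _. Qed.

Lemma acts_as_sigma2V : acts_as q 0%R 1.
Proof.
have -> : q = s2 ^+ 5 by apply: (mulgI s2); rewrite mulgV -expgS sigma2_expg6.
by apply: acts_as_eqmod (acts_as_sigma2X 5).
Qed.

Lemma acts_as_sigma12 : acts_as (s1 * s2) (1, 0)%R 9.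
Proof. exact: acts_asM acts_as_sigma1 acts_as_sigma2. Qed.

Lemma acts_as_unit_transl : acts_as x (1, 0)%R 0.
Proof.
rewrite /unit_transl -mulgA; have := acts_asM (acts_as_sigma2X 3) acts_as_sigma12.
by rewrite iter_rot60_0 addr0; apply: acts_as_eqmod.
Qed.

Lemma acts_asJ g v : acts_as g v 0 -> acts_as (g ^ q) (rot60 v) 0.
Proof.
move=> gP; rewrite conjgE invgK.
have := acts_asM acts_as_sigma2 (acts_asM gP acts_as_sigma2V).
by rewrite iter_rot60_0 addr0 /= add0r; apply: acts_as_eqmod.
Qed.

Lemma sigma_hex_action : hex_action q x.
Proof.
have xP := acts_as_unit_transl; have xqP := acts_asJ xP.
split; last by rewrite expVgn sigma2_expg6 invg1.
- have := acts_asM xqP xP; rewrite /= addrC => xqxP.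
  exact: acts_as_uniq (acts_asM xP xqP) xqxP _.
- rewrite expg2 conjgM.
  exact: acts_as_uniq (acts_asJ xqP) (acts_asM (acts_asV xP) xqP) _.
Qed.

Lemma acts_as_transl v : acts_as (transl q x v) v 0.
Proof.
have := acts_asM (acts_asXz v.1 acts_as_unit_transl)
                 (acts_asXz v.2 (acts_asJ acts_as_unit_transl)).
suff -> : (rot60 (1, 0) *~ v.2 + iter 0 rot60 ((1, 0) *~ v.1) = v)%R by [].
by case: v => a b; rewrite /= /rot60 /= !point_mulz; congr pair => /=; ring.
Qed.

Lemma transl_eq1 v : transl q x v = 1 <-> in_lattice u v.
Proof.
split=> [E|uv]; last by apply: acts_as_inj (acts_as_transl v) acts_as1 _ _; rewrite ?subr0.
have := acts_as_imset (acts_as_transl v); rewrite E imset_perm1 -Phi_base.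
by move/esym/(facet_flag_inj hF rankF topP); rewrite subr0.
Qed.

Lemma transl_vertex_stab v : transl q x v \in <<[set s2; s3]>> -> in_lattice u v.
Proof.
move=> in_stab; pose x0 := h (TVertex 0%R).
have x0_Phi : x0 \in Phi by rewrite -Phi_base (mem_facet_flag h top false 0%R 0 (i := 1)).
have rx0 w : rank (h (TVertex w)) = 0%R by rewrite (facet_rank hF rankF).
have fix_x0 i : (0 < i < 4)%N -> r i x0 = x0.
  case/andP=> i0 i4; apply: (rho_fix Phi_flag Q_regular i4 x0_Phi).
  by rewrite rx0; case: (i) i0.
have /astab1P fix_transl : transl q x v \in 'C[x0 | 'P].
  move: in_stab; apply/subsetP; rewrite gen_set2_sub; apply/andP.
  by split; apply/astab1P; rewrite /= /aperm permM !fix_x0.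
have : h (TVertex v) = x0.
  have fM := facet_flag_flag hF rankF topP false v 0.
  apply: (flag_rank_inj fM); last by rewrite !rx0.
    exact: (mem_facet_flag h top false v 0 (i := 1)).
  by rewrite -(acts_as_imset (acts_as_transl v)) -{1}fix_transl; apply: imset_f.
by move/esym/(cover_fiber hF) => [t ut [->]]; rewrite add0r.
Qed.

Lemma sigma_relations : [/\ s1 ^+ 3 = 1, (s1 * s2) ^+ 2 = 1 & (s1 * s2 * s3) ^+ 2 = 1].
Proof.
split.
- exact: acts_as_uniq (acts_asM acts_as_sigma1 (acts_asM acts_as_sigma1 acts_as_sigma1))
    acts_as1 _.
- exact: acts_as_uniq (acts_asM acts_as_sigma12 acts_as_sigma12) acts_as1 _.
have rr i : (i < 4)%N -> r i * r i = 1 by move=> i4; rewrite -expg2 rho_expg2.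
have -> : s1 * s2 * s3 = r 0 * r 3.
  by rewrite /sigma /= -!mulgA (mulgA (r 1)) rr // mul1g (mulgA (r 2)) rr // mul1g.
rewrite expg2 {1}(rho_comm Phi_flag Q_regular (i := 0) (j := 3)) //.
by rewrite -mulgA (mulgA (r 0)) rr // mul1g rr.
Qed.

End FacetAction.

Lemma torus_cover_Gamma n (Q : polytope n) u (F : Q) h g : g \in Gamma Q ->
  torus_cover u F h -> torus_cover u (g F) (g \o h).
Proof.
move=> /GammaP gE [h_image h_fiber h_le]; split=> [y|f f'|f f'] /=.
- rewrite -{1}[y](permKV g) gE h_image.
  by split=> -[f fy]; exists f; rewrite ?fy ?permKV // -fy permK.
- by rewrite -h_fiber; split=> [/perm_inj|->].
- by rewrite gE.
Qed.

Lemma base_facet_cover (Q : polytope 4) (Phi : {set Q}) u :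
  flag Phi -> regular Q ->
  (forall F : Q, rank F = 3%:Z -> exists h, torus_cover u F h) ->
  exists h (F top : Q), [/\ torus_cover u F h, rank F = 3%:Z,
    forall x, (x <= top)%O & facet_flag h top false 0 0 = Phi].
Proof.
move=> fP regQ facets; have [F FPhi rF] := flag_rank_surj (i := 3%:Z) fP isT.
have [h hF] := facets F rF; have [top topP] := polytope_greatest (polytopeP Q).
have fM := facet_flag_flag hF rF topP false 0 0.
have [g gG gM] := regular_trans regQ fM fP.
exists (g \o h), (g F), top; split=> //; first exact: torus_cover_Gamma.
  by rewrite Gamma_rank.
have g_top : g top = top.
  by apply/le_anti; rewrite topP -{1}(permKV g top) (GammaP _ gG) topP.
by rewrite -gM /facet_flag imsetU1 -imset_comp g_top.
Qed.

Lemma Gamma_plusE (Q : polytope 4) (Phi : {set Q}) :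
  Gamma_plus Phi = <<[set sigma Phi 1; sigma Phi 2; sigma Phi 3]>>%g.
Proof.
congr <<_>>%g; apply/setP=> g; rewrite !inE; apply/imsetP/idP.
  by case=> -[[|[|[|//]]] lt] _ -> /=; rewrite eqxx ?orbT.
case/orP=> [/orP[]|] /eqP->.
- by exists (@Ordinal 3 0 isT).
- by exists (@Ordinal 3 1 isT).
- by exists (@Ordinal 3 2 isT).
Qed.

Lemma regular_toroidal_rotations (Q : polytope 4) (Phi : {set Q}) (u : point) :
  flag Phi -> regular Q -> self_dual Q ->
  (forall F : Q, rank F = 3%:Z -> exists h, torus_cover u F h) ->
  exists d, toroidal_rotations (sigma Phi 1) (sigma Phi 2) (sigma Phi 3) d (in_lattice u).
Proof.
move=> fP regQ sdQ facets; have [d dE dPhi] := self_dual_fixing_flag fP regQ sdQ.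
have [h [F [top [hF rF topP Phi0]]]] := base_facet_cover fP regQ facets.
have [s1_3 s12_2 s123_2] := sigma_relations fP regQ hF rF topP Phi0.
have rV i : (i < 4)%N -> ((rho Phi i)^-1 = rho Phi i)%g.
  by move=> i4; apply/invg_expg2/rho_expg2.
have rd := rho_conj_duality fP regQ dE dPhi.
have sigma_d i j : (0 < i < 4)%N -> (i + j = 4)%N -> (sigma Phi i ^ d = (sigma Phi j)^-1)%g.
  move=> i4 ij; rewrite /sigma conjMg (rd _ j) ?(rd _ j.-1) ?invMg ?rV //; move: i4 ij; clear; lia.
exists d; split=> //; try exact: sigma_d.
- exact: (sigma_hex_action fP regQ hF rF topP Phi0).
- exact: (transl_eq1 fP regQ hF rF topP Phi0).
- exact: (transl_vertex_stab fP regQ hF rF topP Phi0).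
Qed.

(** * Projective special linear groups *)

Section TwoByTwoMatrices.
Variable R : comPzRingType.
Implicit Types a b c d : R.

Definition mx2 a b c d : 'M[R]_2 :=
  \matrix_(i < 2, j < 2) if i == 0 then (if j == 0 then a else b)
                         else (if j == 0 then c else d).

Lemma mx2M a b c d a' b' c' d' : mx2 a b c d *m mx2 a' b' c' d' =
  mx2 (a * a' + b * c') (a * b' + b * d') (c * a' + d * c') (c * b' + d * d').
Proof.
apply/matrixP=> i j; rewrite !mxE big_ord_recl big_ord1 !mxE /=.
by case: (i == 0); case: (j == 0).
Qed.

Lemma det_mx2 a b c d : \det (mx2 a b c d) = a * d - b * c.
Proof.
rewrite (expand_det_row _ 0) big_ord_recl big_ord1 /cofactor !det_mx11 !mxE /=.
by ring.
Qed.

Lemma mx2_eta (A : 'M[R]_2) : A = mx2 (A 0 0) (A 0 1) (A 1 0) (A 1 1).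
Proof.
apply/matrixP=> i j; rewrite !mxE.
by case: i => -[|[|//]] ?; case: j => -[|[|//]] ?; congr (A _ _); apply: val_inj.
Qed.

Lemma mx2_inj a b c d a' b' c' d' : mx2 a b c d = mx2 a' b' c' d' ->
  [/\ a = a', b = b', c = c' & d = d'].
Proof.
move/matrixP=> E.
by split; [have := E 0 0 | have := E 0 1 | have := E 1 0 | have := E 1 1]; rewrite !mxE.
Qed.

End TwoByTwoMatrices.

Section SpecialLinear.
Variable F : finFieldType.
Implicit Types (a b c d x y t : F) (g : {'GL_2[F]}).

Definition SL2F : {set {'GL_2[F]}} := [set g : {'GL_2[F]} | \det (GLval g) == 1].

Lemma SL2F_group_set : group_set SL2F.
Proof.
apply/group_setP; split=> [|g h]; first by rewrite inE /= det1.
by rewrite !inE GL_MxE det_mulmx => /eqP-> /eqP->; rewrite mulr1.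
Qed.

Canonical SL2F_group := Group SL2F_group_set.

(** The identity matrix when [a * d = b * c]. *)
Definition gl2 a b c d : {'GL_2[F]} := insubd (1%g : {'GL_2[F]}) (mx2 a b c d).

Lemma gl2E a b c d : a * d - b * c != 0 -> GLval (gl2 a b c d) = mx2 a b c d.
Proof. by move=> nz; apply: insubdK; rewrite -topredE /= unitmxE det_mx2 unitfE. Qed.

Lemma gl2P g : exists a b c d, a * d - b * c != 0 /\ g = gl2 a b c d.
Proof.
exists (GLval g 0 0), (GLval g 0 1), (GLval g 1 0), (GLval g 1 1).
have nz : \det (GLval g) != 0 by apply: GL_det.
rewrite [GLval g]mx2_eta det_mx2 in nz; split=> //.
by apply: val_inj; rewrite -[RHS]/(GLval _) gl2E // -mx2_eta.
Qed.

Lemma gl2M a b c d a' b' c' d' : a * d - b * c != 0 -> a' * d' - b' * c' != 0 ->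
  (gl2 a b c d * gl2 a' b' c' d')%g =
  gl2 (a * a' + b * c') (a * b' + b * d') (c * a' + d * c') (c * b' + d * d').
Proof.
move=> nz nz'; apply: val_inj; rewrite -[LHS]/(GLval _) -[RHS]/(GLval _) GL_MxE !gl2E //.
  exact: mx2M.
by rewrite -det_mx2 -mx2M det_mulmx !det_mx2 mulf_neq0.
Qed.

Lemma gl2_1 : gl2 1 0 0 1 = 1%g.
Proof.
apply: val_inj; rewrite -[LHS]/(GLval _) -[RHS]/(GLval _) gl2E.
  by rewrite -[RHS]/(1 : 'M_2) [RHS]mx2_eta !mxE.
by rewrite mulr1 mulr0 subr0 oner_eq0.
Qed.

Lemma gl2_inj a b c d a' b' c' d' : a * d - b * c != 0 -> a' * d' - b' * c' != 0 ->
  gl2 a b c d = gl2 a' b' c' d' -> [/\ a = a', b = b', c = c' & d = d'].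
Proof. by move=> nz nz' /(congr1 (@GLval _ _)); rewrite !gl2E //; apply: mx2_inj. Qed.

Lemma det1_neq0 a b c d : a * d = 1 + b * c -> a * d - b * c != 0.
Proof. by move->; rewrite addrK oner_eq0. Qed.

Lemma det1M a b c d a' b' c' d' : a * d = 1 + b * c -> a' * d' = 1 + b' * c' ->
  (a * a' + b * c') * (c * b' + d * d') = 1 + (a * b' + b * d') * (c * a' + d * c').
Proof. by move=> D D'; ring: D D'. Qed.

Lemma det1_upper x : 1 * 1 = 1 + x * 0 :> F. Proof. by ring. Qed.
Lemma det1_lower x : 1 * 1 = 1 + 0 * x :> F. Proof. by ring. Qed.
Lemma det1_scalarN1 : -1 * -1 = 1 + 0 * 0 :> F. Proof. by ring. Qed.

Lemma gl2_SL2F a b c d : a * d = 1 + b * c -> gl2 a b c d \in SL2F.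
Proof. by move=> D; rewrite inE gl2E ?det1_neq0 // det_mx2 D addrK. Qed.

Lemma SL2FP g : g \in SL2F -> exists a b c d, a * d = 1 + b * c /\ g = gl2 a b c d.
Proof.
have [a [b [c [d [nz ->]]]]] := gl2P g.
by rewrite inE gl2E // det_mx2 subr_eq => /eqP D; exists a, b, c, d.
Qed.

Lemma det1_scalar a : a * a = 1 -> a = 1 \/ a = -1.
Proof.
move=> a2; have : (a - 1) * (a + 1) == 0 by apply/eqP; ring: a2.
by rewrite mulf_eq0 subr_eq0 addr_eq0 => /orP[]/eqP; [left | right].
Qed.

Lemma center_SL2F g : g \in 'Z(SL2F)%g -> g = 1%g \/ g = gl2 (-1) 0 0 (-1).
Proof.
case/centerP=> /SL2FP[a [b [c [d [D ->]]]]] cent; have nz := det1_neq0 D.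
have nU := det1_neq0 (det1_upper 1); have nL := det1_neq0 (det1_lower 1).
have := cent _ (gl2_SL2F (det1_upper 1)); have := cent _ (gl2_SL2F (det1_lower 1)).
rewrite /commute !(gl2M nz) // !(gl2M _ nz) // => eqL eqU.
have [] := gl2_inj (det1_neq0 (det1M D (det1_lower 1)))
                   (det1_neq0 (det1M (det1_lower 1) D)) eqL.
have [] := gl2_inj (det1_neq0 (det1M D (det1_upper 1)))
                   (det1_neq0 (det1M (det1_upper 1) D)) eqU.
rewrite !mulr1 !mulr0 !mul1r !mul0r !addr0 => c_eq ad_eq _ _ b_eq _ _ _.
have c0 : c = 0 by apply: (addrI a); rewrite addr0.
have b0 : b = 0 by apply: (addrI a); rewrite addr0.
have da : d = a by apply: (addrI b); rewrite -ad_eq addrC.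
move: D; rewrite da b0 c0 mul0r addr0 => /det1_scalar[]->; last by right.
by left; apply: gl2_1.
Qed.

Lemma commute_scalarN1 g : commute g (gl2 (-1) 0 0 (-1)).
Proof.
have [a [b [c [d [nz ->]]]]] := gl2P g.
rewrite /commute (gl2M nz (det1_neq0 det1_scalarN1)) (gl2M (det1_neq0 det1_scalarN1) nz).
by congr gl2; ring.
Qed.

Lemma scalarN1_center : gl2 (-1) 0 0 (-1) \in 'Z(SL2F)%g.
Proof.
apply/centerP; split=> [|g _]; first exact/gl2_SL2F/det1_scalarN1.
exact/commute_sym/commute_scalarN1.
Qed.

Lemma norm_center_SL2F g : g \in 'N('Z(SL2F))%g.
Proof.
apply: (subsetP (cent_sub _)); apply/centP=> z /center_SL2F[->|->].
  exact: commute1.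
exact: commute_scalarN1.
Qed.

Lemma card_SL2F : #|SL2F| = (#|F| * (#|F| ^ 2 - 1))%N.
Proof.
pose det_unit (g : {'GL_2[F]}) : {unit F} := insubd (1%g : {unit F}) (\det (GLval g)).
have det_unitE g : val (det_unit g) = \det (GLval g).
  have nz : \det (GLval g) != 0 by apply: GL_det.
  by apply: insubdK; rewrite -topredE /= unitfE.
have detM : {in [set: {'GL_2[F]}] &, {morph det_unit : g h / (g * h)%g}}.
  by move=> g h _ _; apply: val_inj; rewrite /= !det_unitE GL_MxE det_mulmx.
have kerE : ('ker (Morphism detM) = SL2F)%g.
  apply/setP=> g; rewrite !inE /= -det_unitE.
  by apply/eqP/eqP => [->|E] //; apply: val_inj.
have imE : (Morphism detM @* setT)%g = setT.
  apply/setP=> x; rewrite inE; apply/morphimP.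
  have x0 : val x != 0 by rewrite -unitfE; apply: (valP x).
  have nz : val x * 1 - 0 * 0 != 0 by rewrite mulr1 mulr0 subr0.
  exists (gl2 (val x) 0 0 1); rewrite ?inE //; apply: val_inj => /=.
  by rewrite det_unitE gl2E // det_mx2 mulr1 mulr0 subr0.
have q_gt1 := finNzRing_gt1 F.
have := card_morphim (Morphism detM) setT; rewrite imE setIT kerE card_finField_unit.
rewrite -divgS ?subsetT // card_GL_2 => unitsE.
have dvd_SL : (#|SL2F| %| #|F| * #|F|.-1 ^ 2 * #|F|.+1)%N.
  by rewrite -card_GL_2; apply: cardSg (subsetT SL2F_group).
have q1_gt0 : (0 < #|F|.-1)%N by rewrite -subn1 subn_gt0.
apply/eqP; rewrite -(eqn_pmul2l q1_gt0) {1}unitsE divnK //; apply/eqP.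
by case: #|F| q_gt1 => // n _ /=; clear; nia.
Qed.

End SpecialLinear.

Section ProjectiveSpecialLinear.
Variable F : finFieldType.
Implicit Types (a b c d x y t : F) (N : {group coset_of 'Z(SL2F F)%g}).
Local Notation Z := 'Z(SL2F F)%g.

Definition PSL2F : {set coset_of Z} := (SL2F F / Z)%g.

Canonical PSL2F_group := Eval hnf in [group of PSL2F].

Lemma card_PSL2F : (#|F| * (#|F| ^ 2 - 1) %| 2 * #|PSL2F|)%N.
Proof.
have nZ : SL2F F \subset 'N(Z)%g by apply/subsetP=> g _; apply: norm_center_SL2F.
have -> : (#|F| * (#|F| ^ 2 - 1) = #|Z| * #|PSL2F|)%N.
  by rewrite -card_SL2F /PSL2F (card_quotient nZ) (Lagrange (center_sub _)).
apply: dvdn_mul => //; have : (#|Z| <= 2)%N.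
  apply: (@leq_trans #|[set (1%g : {'GL_2[F]}); gl2 (-1) 0 0 (-1)]|).
    by apply/subset_leq_card/subsetP=> z /center_SL2F[]->; rewrite !inE eqxx ?orbT.
  by rewrite cards2 ltnS leq_b1.
by have := cardG_gt0 Z; case: #|Z| => [|[|[|]]].
Qed.

Definition pgl2 a b c d : coset_of Z := coset Z (gl2 a b c d).
#[global] Arguments pgl2 (a b c d)%_ring_scope.

Lemma pgl2M a b c d a' b' c' d' : a * d - b * c != 0 -> a' * d' - b' * c' != 0 ->
  (pgl2 a b c d * pgl2 a' b' c' d')%g =
  pgl2 (a * a' + b * c') (a * b' + b * d') (c * a' + d * c') (c * b' + d * d').
Proof. by move=> D D'; rewrite /pgl2 -(gl2M D D') coset_morphM ?norm_center_SL2F. Qed.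

Lemma psl2M a b c d a' b' c' d' a2 b2 c2 d2 :
  a * d = 1 + b * c -> a' * d' = 1 + b' * c' ->
  a * a' + b * c' = a2 -> a * b' + b * d' = b2 ->
  c * a' + d * c' = c2 -> c * b' + d * d' = d2 ->
  (pgl2 a b c d * pgl2 a' b' c' d')%g = pgl2 a2 b2 c2 d2.
Proof. by move=> /det1_neq0 D /det1_neq0 D' <- <- <- <-; apply: pgl2M. Qed.

Lemma pgl2_PSL2F a b c d : a * d = 1 + b * c -> pgl2 a b c d \in PSL2F.
Proof. by move=> D; apply/mem_quotient/gl2_SL2F. Qed.

Lemma PSL2FP z : z \in PSL2F -> exists a b c d, a * d = 1 + b * c /\ z = pgl2 a b c d.
Proof. by case/morphimP=> g _ /SL2FP[a [b [c [d [D ->]]]]] ->; exists a, b, c, d. Qed.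

Lemma pgl2_1 : pgl2 1 0 0 1 = 1%g.
Proof. by rewrite /pgl2 gl2_1; apply/coset_id/group1. Qed.

Lemma pgl2_scalarN1 : pgl2 (-1) 0 0 (-1) = 1%g.
Proof. exact: coset_id (scalarN1_center F). Qed.

Lemma psl2_inj a b c d a' b' c' d' : a * d = 1 + b * c -> a' * d' = 1 + b' * c' ->
  pgl2 a b c d = pgl2 a' b' c' d' ->
  [/\ a = a', b = b', c = c' & d = d'] \/
  [/\ a = - a', b = - b', c = - c' & d = - d'].
Proof.
move=> D D' E.
have : gl2 a b c d \in (coset Z (gl2 a' b' c' d') : {set _}).
  by rewrite -[coset _ _]E /pgl2 val_coset ?norm_center_SL2F // rcoset_refl.
rewrite val_coset ?norm_center_SL2F // => /rcosetP[z /center_SL2F[]->].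
  by rewrite mul1g => /gl2_inj[]; rewrite ?det1_neq0 //; left.
have DN1 := det1_scalarN1 F; rewrite (gl2M (det1_neq0 DN1) (det1_neq0 D')) => E2; right.
have [-> -> -> ->] := gl2_inj (det1_neq0 D) (det1_neq0 (det1M DN1 D')) E2.
by split; ring.
Qed.

Lemma psl2V a b c d : a * d = 1 + b * c -> (pgl2 a b c d)^-1%g = pgl2 d (- b) (- c) a.
Proof.
move=> D; apply: (mulgI (pgl2 a b c d)); rewrite mulgV -pgl2_1.
by apply/esym/psl2M; ring: D.
Qed.

Definition upper x := pgl2 1 x 0 1.
Definition lower x := pgl2 1 0 x 1.
Definition diagonal t := pgl2 t 0 0 t^-1.
Definition weyl := pgl2 0 1 (-1) 0.
#[global] Arguments upper x%_ring_scope.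
#[global] Arguments lower x%_ring_scope.
#[global] Arguments diagonal t%_ring_scope.

Lemma det1_weyl : 0 * 0 = 1 + 1 * -1 :> F. Proof. by ring. Qed.

Lemma det1_diagonal t : t != 0 -> t * t^-1 = 1 + 0 * 0.
Proof. by move=> t0; rewrite mulfV // mulr0 addr0. Qed.

Lemma upper_PSL2F x : upper x \in PSL2F.
Proof. exact/pgl2_PSL2F/det1_upper. Qed.

Lemma lower_PSL2F x : lower x \in PSL2F.
Proof. exact/pgl2_PSL2F/det1_lower. Qed.

Lemma diagonal_PSL2F t : t != 0 -> diagonal t \in PSL2F.
Proof. by move/det1_diagonal/pgl2_PSL2F. Qed.

Lemma weyl_PSL2F : weyl \in PSL2F.
Proof. exact/pgl2_PSL2F/det1_weyl. Qed.

Lemma upperD x y : upper (x + y) = (upper x * upper y)%g.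
Proof. by apply/esym/psl2M; ring. Qed.

Lemma lowerD x y : lower (x + y) = (lower x * lower y)%g.
Proof. by apply/esym/psl2M; ring. Qed.

Lemma upper0 : upper 0 = 1%g. Proof. exact: pgl2_1. Qed.
Lemma lower0 : lower 0 = 1%g. Proof. exact: pgl2_1. Qed.

Lemma upperN x : upper (- x) = (upper x)^-1%g.
Proof. by apply: (mulgI (upper x)); rewrite mulgV -upperD subrr upper0. Qed.

Lemma lowerN x : lower (- x) = (lower x)^-1%g.
Proof. by apply: (mulgI (lower x)); rewrite mulgV -lowerD subrr lower0. Qed.

Lemma upperMn x n : upper (x *+ n) = (upper x ^+ n)%g.
Proof. by elim: n => [|n IHn]; rewrite ?upper0 // mulrS upperD IHn expgS. Qed.

Lemma lowerMn x n : lower (x *+ n) = (lower x ^+ n)%g.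
Proof. by elim: n => [|n IHn]; rewrite ?lower0 // mulrS lowerD IHn expgS. Qed.

Lemma upperMz x (n : int) : upper (x *~ n) = expgz (upper x) n.
Proof.
case: n => n; first by rewrite -pmulrn upperMn.
by rewrite NegzE mulrNz -pmulrn upperN upperMn.
Qed.

Lemma upper_eq1 x : upper x = 1%g -> x = 0.
Proof.
rewrite -upper0 => /(psl2_inj (det1_upper x) (det1_upper 0)) [[]|[_ + _ _]] //.
by rewrite oppr0.
Qed.

Lemma diagonalV t : t != 0 -> (diagonal t)^-1%g = diagonal t^-1.
Proof. by move=> t0; rewrite /diagonal psl2V ?det1_diagonal // oppr0 invrK. Qed.

Lemma diagonalX t n : t != 0 -> (diagonal t ^+ n)%g = diagonal (t ^+ n).
Proof.
move=> t0; elim: n => [|n IHn]; first by rewrite expg0 expr0 /diagonal invr1 pgl2_1.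
rewrite expgS IHn; apply: psl2M; rewrite ?det1_diagonal ?expf_neq0 //.
- by rewrite exprS; ring.
- by ring.
- by ring.
- by rewrite exprS invfM; ring.
Qed.

Lemma psl2J_diagonal a b c d t : t != 0 -> a * d = 1 + b * c ->
  (pgl2 a b c d ^ diagonal t)%g = pgl2 a (b / t ^+ 2) (c * t ^+ 2) d.
Proof.
move=> t0 D; rewrite conjgE diagonalV //.
have -> : (pgl2 a b c d * diagonal t)%g = pgl2 (a * t) (b / t) (c * t) (d / t).
  by apply: psl2M; rewrite ?det1_diagonal //; ring.
apply: psl2M; first by rewrite invrK mulrC det1_diagonal.
- by rewrite mulrACA mulfV // mulr1 D; field.
all: by rewrite ?invrK; field.
Qed.

Lemma upperJ_diagonal x t : t != 0 -> (upper x ^ diagonal t)%g = upper (x / t ^+ 2).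
Proof. by move=> t0; rewrite [LHS](psl2J_diagonal t0 (det1_upper x)) mul0r. Qed.

Lemma lowerJ_diagonal x t : t != 0 -> (lower x ^ diagonal t)%g = lower (x * t ^+ 2).
Proof. by move=> t0; rewrite [LHS](psl2J_diagonal t0 (det1_lower x)) mul0r. Qed.

Lemma lowerJ_lower_triangular x a c d : a * d = 1 + 0 * c ->
  (lower x ^ pgl2 a 0 c d)%g = lower (x * a ^+ 2).
Proof.
move=> D; rewrite conjgE psl2V //.
have -> : (lower x * pgl2 a 0 c d)%g = pgl2 a 0 (x * a + c) d by apply: psl2M; ring: D.
by apply: psl2M; ring: D.
Qed.

Lemma psl2J_weyl a b c d : a * d = 1 + b * c ->
  (pgl2 a b c d ^ weyl)%g = pgl2 d (- c) (- b) a.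
Proof.
move=> D; rewrite conjgE psl2V ?det1_weyl //.
have -> : (pgl2 a b c d * weyl)%g = pgl2 (- b) a (- d) c by apply: psl2M; ring: D.
by apply: psl2M; ring: D.
Qed.

Lemma PSL2F_sub_unipotent N :
  (forall x, upper x \in N) -> (forall x, lower x \in N) -> PSL2F \subset N.
Proof.
move=> upN lowN; apply/subsetP=> z /PSL2FP[a [b [c [d [D ->]]]]].
have factor a' b' c' d' : a' * d' = 1 + b' * c' -> c' != 0 -> pgl2 a' b' c' d' \in N.
  move=> D' c0; pose x := (a' - 1) / c'.
  have left : (upper x * lower c')%g = pgl2 a' x c' 1 by apply: psl2M; rewrite /x; field.
  have right : (pgl2 a' x c' 1 * upper ((d' - 1) / c')%R)%g = pgl2 a' b' c' d'.
    have bE : b' = (a' * d' - 1) / c' by rewrite D' addrC addKr mulfK.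
    by apply: psl2M; rewrite ?bE /x; field.
  by rewrite -right -left !groupM.
have [c0|] := eqVneq c 0; last exact: factor.
have a0 : a != 0.
  by apply: contra_eqN D => /eqP->; rewrite c0 mul0r mulr0 addr0 eq_sym oner_eq0.
rewrite -(groupMl _ (lowN 1)) (_ : (_ * _)%g = pgl2 a b (a + c) (b + d)).
  by apply: factor; [ring: D | rewrite c0 addr0].
by apply: psl2M; ring: D.
Qed.

Section NormalSubgroups.
Variable N : {group coset_of Z}.
Hypothesis nNPSL : PSL2F \subset 'N(N)%g.

Lemma normalJ z h : z \in N -> h \in PSL2F -> (z ^ h)%g \in N.
Proof. by move=> zN hP; rewrite memJ_norm // (subsetP nNPSL). Qed.

Lemma normal_lower x y : 2%:R != 0 :> F -> x != 0 -> lower x \in N -> lower y \in N.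
Proof.
move=> nz2 x0 xN.
have lower_sqr t : lower (x * t ^+ 2) \in N.
  have [->|t0] := eqVneq t 0; first by rewrite expr0n mulr0 lower0 group1.
  by rewrite -lowerJ_diagonal // normalJ // diagonal_PSL2F.
have -> : y = x * ((y / x + 1) / 2%:R) ^+ 2 + - (x * ((y / x - 1) / 2%:R) ^+ 2).
  by field; rewrite nz2 x0.
by rewrite lowerD lowerN groupM ?groupV.
Qed.

Lemma normal_lower_left_neq0 : N \subset PSL2F -> (N :!=: 1)%g ->
  exists a b c d, [/\ a * d = 1 + b * c, c != 0 & pgl2 a b c d \in N].
Proof.
move=> sNPSL /trivgPn[z zN z1].
have [a [b [c [d [D zE]]]]] := PSL2FP (subsetP sNPSL z zN); rewrite {}zE in zN z1.
have [c0|c0] := eqVneq c 0; last by exists a, b, c, d.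
have [b0|b0] := eqVneq b 0; last first.
  exists d, (- c), (- b), a; rewrite oppr_eq0 -psl2J_weyl // normalJ ?weyl_PSL2F //.
  by split=> //; ring: D.
move: D z1 zN; rewrite b0 c0 mul0r addr0 => D z1 zN.
have ad : d != a.
  apply: contraNneq z1 => da; rewrite da in D *.
  by have [->|->] := det1_scalar D; rewrite ?pgl2_1 ?pgl2_scalarN1.
have D0 : a * d = 1 + 0 * 0 by rewrite D; ring.
exists a, 0, (d - a), d; rewrite subr_eq0; split=> //; first by rewrite D; ring.
have -> : pgl2 a 0 (d - a) d = (pgl2 a 0 0 d ^ lower 1)%g.
  rewrite conjgE -lowerN; apply/esym.
  have -> : (pgl2 a 0 0 d * lower 1)%g = pgl2 a 0 d d by apply: psl2M; ring: D.
  by apply: psl2M; ring: D.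
by rewrite normalJ // lower_PSL2F.
Qed.

Lemma normal_upper_left_eq0 a b c d : a * d = 1 + b * c -> c != 0 ->
  pgl2 a b c d \in N -> pgl2 0 (- c^-1) c (a + d) \in N.
Proof.
move=> D c0 zN; have -> : pgl2 0 (- c^-1) c (a + d) = (pgl2 a b c d ^ upper (a / c))%g.
  rewrite conjgE -upperN; apply/esym.
  have -> : (pgl2 a b c d * upper (a / c))%g = pgl2 a (a / c * a + b) c (a + d).
    by apply: psl2M; rewrite ?D //; field.
  have bE : b = (a * d - 1) / c by rewrite D addrC addKr mulfK.
  by apply: psl2M; rewrite ?bE; field.
by rewrite normalJ // upper_PSL2F.
Qed.

(* The commutator of [z := pgl2 0 (- c^-1) c e] with a diagonal matrix is lower
   triangular, and so its commutator with [lower 1] is unipotent. *)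
Lemma normal_lower_unipotent c e t : c != 0 -> t != 0 ->
  pgl2 0 (- c^-1) c e \in N -> lower (t ^- 4 - 1) \in N.
Proof.
move=> c0 t0 zN; set z := pgl2 _ _ _ _ in zN.
have D : 0 * e = 1 + - c^-1 * c by field.
have triangular : (z ^ diagonal t * z^-1)%g = pgl2 (t ^- 2) 0 (c * e * (t ^+ 2 - 1)) (t ^+ 2).
  by rewrite psl2J_diagonal // psl2V //; apply: psl2M; field; rewrite ?c0 ?t0.
have yN : pgl2 (t ^- 2) 0 (c * e * (t ^+ 2 - 1)) (t ^+ 2) \in N.
  by rewrite -triangular groupM ?groupV // normalJ ?diagonal_PSL2F.
set y := pgl2 _ _ _ _ in yN.
have -> : lower (t ^- 4 - 1) = ((y^-1) ^ lower 1 * y)%g.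
  have -> : ((y^-1) ^ lower 1 * y)%g = ((lower 1)^-1 * lower 1 ^ y)%g.
    by rewrite !conjgE !mulgA.
  rewrite lowerJ_lower_triangular; last by rewrite mulVf ?expf_neq0 // mul0r addr0.
  by rewrite -lowerN -lowerD; congr lower; field.
by rewrite groupM // normalJ ?groupV // lower_PSL2F.
Qed.

End NormalSubgroups.

Theorem PSL2F_simple t : 2%:R != 0 :> F -> t != 0 -> t ^+ 4 != 1 -> simple PSL2F.
Proof.
move=> nz2 t0 t4; apply/simpleP; split=> [|N /andP[sNPSL nNPSL]].
  apply/trivgPn; exists (upper 1); first exact: upper_PSL2F.
  by apply: contraNneq (oner_neq0 F) => /upper_eq1->.
have [N1|ntN] := eqVneq N 1%G; [left | right]; first by rewrite N1.
have [a [b [c [d [D c0 zN]]]]] := normal_lower_left_neq0 nNPSL sNPSL ntN.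
have nz : t ^- 4 - 1 != 0 by rewrite subr_eq0 invr_eq1.
have lowN x : lower x \in N.
  apply: (normal_lower nNPSL x nz2 nz).
  apply: (normal_lower_unipotent nNPSL c0 t0).
  exact: (normal_upper_left_eq0 nNPSL D c0 zN).
apply/eqP; rewrite eqEsubset sNPSL /=; apply: PSL2F_sub_unipotent => // x.
have -> : upper x = (lower (- x) ^ weyl)%g.
  by rewrite (psl2J_weyl (det1_lower _)) oppr0 opprK.
by apply: normalJ => //; apply: weyl_PSL2F.
Qed.

End ProjectiveSpecialLinear.

Lemma sixth_root_primitive (F : fieldType) (z : F) :
  z * z = z - 1 -> 2%:R != 0 :> F -> 3%:R != 0 :> F -> 6.-primitive_root z.
Proof.
move=> z2 nz2 nz3; have z3 : z ^+ 3 = -1 by rewrite !exprS expr0; ring: z2.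
have z6 : z ^+ 6 = 1 by rewrite (exprM z 3 2) z3 sqrrN expr1n.
have [m m_prim m_dvd] := prim_order_exists (isT : 0 < 6)%N z6.
have zm := prim_expr_order m_prim.
have : m \in divisors 6 by rewrite -dvdn_divisors.
rewrite !inE => /or4P[] /eqP m_eq; rewrite m_eq in zm m_prim => //; exfalso.
- by have := z2; rewrite (zm : z = 1) mulr1 subrr => /eqP; rewrite oner_eq0.
- have z_2 : z = 2%:R by apply: (addIr (-1)); rewrite -z2 -expr2 zm; ring.
  by case/eqP: nz3; have := z2; rewrite z_2 => /eqP; rewrite -subr_eq0 => /eqP <-; ring.
- by case/eqP: nz2; apply: (addIr (-1)); rewrite -[in RHS]z3 zm; ring.
Qed.

Lemma finField_sqrtN1 (F : finFieldType) : 2%:R != 0 :> F -> (4 %| #|F|.-1)%N ->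
  exists i : F, i * i = -1.
Proof.
move=> nz2 /dvdnP[k cardF].
have /cyclicP[g gE] := field_unit_group_cyclic [set: {unit F}]%G.
have order_g : #[g]%g = (k * 4)%N by rewrite orderE -gE card_finField_unit.
pose i := val (g ^+ k)%g; exists i.
have i4 : (i * i) * (i * i) = 1.
  have -> : i * i * (i * i) = val ((g ^+ k) ^+ 4)%g by rewrite !expgS expg0 mulg1 /= !mulrA.
  by rewrite -expgM -order_g expg_order.
have i2 : i * i != 1.
  apply/eqP=> i2; have : (g ^+ (k * 2) = 1)%g.
    by apply: val_inj; rewrite expgM expgS expg1.
  move/eqP; rewrite -order_dvdn order_g dvdn_pmul2l //.
  by have := order_gt0 g; rewrite order_g muln_gt0 andbT.
by case: (det1_scalar i4) => // /eqP; rewrite (negPf i2).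
Qed.

Section PSL2Rotations.
Variables (F : finFieldType) (w i : F).
Hypothesis w2 : w * w = w - 1.
Hypothesis i2 : i * i = -1.
Hypothesis nz2 : 2%:R != 0 :> F.
Hypothesis nz3 : 3%:R != 0 :> F.

Definition psl_rot1 := pgl2 (- w) (1 - w) 0 (w - 1).
Definition psl_rot2 := diagonal (i * (w - 1)).
Definition psl_rot3 := pgl2 (- w) 0 (2%:R * w - 1) (w - 1).
Definition psl_dual := pgl2 0 1 (2%:R - w) 0.

Lemma det1_rot1 : - w * (w - 1) = 1 + (1 - w) * 0. Proof. by ring: w2. Qed.
Lemma det1_rot3 : - w * (w - 1) = 1 + 0 * (2%:R * w - 1). Proof. by ring: w2. Qed.

Lemma rot2_param_neq0 : i * (w - 1) != 0.
Proof.
apply: contraNneq (oner_neq0 F) => t0.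
have -> : 1 = i * (w - 1) * (i * w) by ring: w2 i2.
by rewrite t0 mul0r.
Qed.

Lemma rot2_paramV : (i * (w - 1))^-1 = i * w.
Proof. by apply: (mulfI rot2_param_neq0); rewrite mulfV ?rot2_param_neq0 //; ring: w2 i2. Qed.

Lemma psl_rot2E : psl_rot2 = pgl2 (i * (w - 1)) 0 0 (i * w).
Proof. by rewrite /psl_rot2 /diagonal rot2_paramV. Qed.

Lemma det1_rot2 : i * (w - 1) * (i * w) = 1 + 0 * 0. Proof. by ring: w2 i2. Qed.

Lemma psl_rot2V : psl_rot2^-1%g = diagonal (i * w).
Proof. by rewrite diagonalV ?rot2_param_neq0 // rot2_paramV. Qed.

Lemma rot2V_param_neq0 : i * w != 0.
Proof. by rewrite -rot2_paramV invr_eq0 rot2_param_neq0. Qed.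

(* [w] is a primitive sixth root of unity. *)
Lemma upperJ_rot2V x : (upper x ^ psl_rot2^-1)%g = upper (w * x).
Proof.
rewrite psl_rot2V upperJ_diagonal ?rot2V_param_neq0 //; congr upper.
apply: (canLR (mulfK _)); first by rewrite expf_neq0 ?rot2V_param_neq0.
have : (i * w) ^+ 2 * w = 1 by rewrite expr2; ring: w2 i2.
by move=> E; rewrite -mulrA mulrCA mulrA -[LHS]mulr1 -E; ring.
Qed.

Lemma psl_rot12 : (psl_rot1 * psl_rot2)%g = pgl2 i i 0 (- i).
Proof.
by rewrite psl_rot2E; apply: psl2M; rewrite ?det1_rot1 ?det1_rot2 //; ring: w2 i2.
Qed.

Lemma psl_rot2_expg3 : (psl_rot2 ^+ 3)%g = pgl2 (- i) 0 0 i.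
Proof.
have sqrE : (psl_rot2 * psl_rot2)%g = pgl2 w 0 0 (1 - w).
  by rewrite psl_rot2E; apply: psl2M; ring: w2 i2.
by rewrite expgSr expg2 sqrE psl_rot2E; apply: psl2M; ring: w2 i2.
Qed.

Lemma psl_unit_transl : unit_transl psl_rot1 psl_rot2 = upper 1.
Proof.
rewrite /unit_transl psl_rot2_expg3 -mulgA psl_rot12.
by apply: psl2M; ring: i2.
Qed.

Lemma psl_hex_action : hex_action psl_rot2^-1%g (upper 1).
Proof.
split.
- by rewrite upperJ_rot2V /commute -!upperD addrC.
- by rewrite expg2 conjgM !upperJ_rot2V -upperN -upperD; congr upper; ring: w2.
- rewrite expVgn -[6%N]/(3 * 2)%N expgM psl_rot2_expg3 expg2.
  have -> : (pgl2 (- i) 0 0 i * pgl2 (- i) 0 0 i)%g = pgl2 (-1) 0 0 (-1).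
    by apply: psl2M; ring: i2.
  by rewrite pgl2_scalarN1 invg1.
Qed.

Lemma psl_translE v : transl psl_rot2^-1%g (upper 1) v = upper (v.1%:~R + w * v.2%:~R).
Proof. by rewrite /transl upperJ_rot2V -!upperMz -upperD mulr1 mulrzr. Qed.

Lemma psl_rotation_faithful : rotation_faithful psl_rot2^-1%g (upper 1).
Proof.
move=> v k; rewrite /rotransl psl_translE psl_rot2V diagonalX ?rot2V_param_neq0 //.
set y := _ + _; set t := _ ^+ k => E.
have t0 : t != 0 by rewrite expf_neq0 ?rot2V_param_neq0.
have sixth : (1 - w) * (1 - w) = 1 - w - 1 by ring: w2.
rewrite (prim_order_dvd (sixth_root_primitive sixth nz2 nz3)).
have -> : 1 - w = (i * w) * (i * w) by ring: w2 i2.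
have triangular : (diagonal t * upper y)%g = pgl2 t (t * y) 0 t^-1.
  by apply: psl2M; rewrite ?det1_diagonal //; ring.
have Dt : t * t^-1 = 1 + t * y * 0 by rewrite mulfV // mulr0 addr0.
rewrite exprMn -/t; move: E; rewrite triangular -upper0 => /(psl2_inj Dt (det1_upper 0)).
by case=> -[-> _ _ _]; rewrite ?mulrNN mulr1.
Qed.

Lemma vertex_stab_lower_triangular z : z \in <<[set psl_rot2; psl_rot3]>>%g ->
  exists a c d, a * d = 1 + 0 * c /\ z = pgl2 a 0 c d.
Proof.
move: z; apply: gen_ind => [|s z].
  by exists 1, 0, 1; rewrite pgl2_1; split=> //; ring.
case/set2P=> -> [a [c [d [D ->]]]].
  exists (i * (w - 1) * a), (i * w * c), (i * w * d); split; first by ring: w2 i2 D.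
  by rewrite psl_rot2E; apply: psl2M => //; rewrite ?det1_rot2 //; ring.
exists (- w * a), ((2%:R * w - 1) * a + (w - 1) * c), ((w - 1) * d).
by split; [ring: w2 D | apply: psl2M => //; rewrite ?det1_rot3 //; ring].
Qed.

Lemma dual_param_neq0 : 2%:R - w != 0.
Proof.
apply: contraNneq nz3 => y0; have -> : 3%:R = (2%:R - w) * (1 + w) by ring: w2.
by rewrite y0 mul0r.
Qed.

Lemma psl2J_dual a b c d : a * d = 1 + b * c ->
  (pgl2 a b c d ^ psl_dual)%g = pgl2 d (c / (2%:R - w)) (b * (2%:R - w)) a.
Proof.
move=> D; have y0 := dual_param_neq0; apply: (mulgI psl_dual); rewrite -conjgC.
have D_dual : 0 * 0 - 1 * (2%:R - w) != 0 by rewrite mul0r add0r mul1r oppr_eq0.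
have D_conj : d * a = 1 + c / (2%:R - w) * (b * (2%:R - w)) by rewrite mulrC D; field.
rewrite /psl_dual (pgl2M (det1_neq0 D) D_dual) (pgl2M D_dual (det1_neq0 D_conj)).
rewrite !(mulr0, mul0r, mulr1, mul1r, addr0, add0r).
by rewrite [_ * d]mulrC [_ * (c / _)]mulrC divfK.
Qed.

Lemma psl_rot1_dual : (psl_rot1 ^ psl_dual = psl_rot3^-1)%g.
Proof.
rewrite (psl2J_dual det1_rot1) (psl2V det1_rot3) oppr0 mul0r.
by congr pgl2; ring: w2.
Qed.

Lemma psl_rot2_dual : (psl_rot2 ^ psl_dual = psl_rot2^-1)%g.
Proof.
by rewrite psl_rot2E (psl2J_dual det1_rot2) (psl2V det1_rot2) !mul0r oppr0.
Qed.

Lemma psl_rot3_dual : (psl_rot3 ^ psl_dual = psl_rot1^-1)%g.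
Proof.
rewrite (psl2J_dual det1_rot3) (psl2V det1_rot1) oppr0 mul0r.
congr pgl2; apply: (mulIf dual_param_neq0); rewrite divfK ?dual_param_neq0 //.
by ring: w2.
Qed.

Lemma psl_toroidal_rotations : toroidal_rotations psl_rot1 psl_rot2 psl_rot3 psl_dual
  (fun v => v.1%:~R + w * v.2%:~R = 0).
Proof.
split; rewrite ?psl_unit_transl.
- rewrite expgSr expg2 -pgl2_1.
  have -> : (psl_rot1 * psl_rot1)%g = pgl2 (w - 1) (w - 1) 0 (- w).
    by apply: psl2M; ring: w2.
  by apply: psl2M; ring: w2.
- by rewrite psl_rot12 expg2 -pgl2_scalarN1; apply: psl2M; ring: i2.
- rewrite psl_rot12 expg2 -pgl2_scalarN1.
  have -> : (pgl2 i i 0 (- i) * psl_rot3)%g =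
      pgl2 (i * (w - 1)) (i * (w - 1)) (i * (1 - 2%:R * w)) (i * (1 - w)).
    by apply: psl2M; ring: w2 i2.
  by apply: psl2M; ring: w2 i2.
- exact: psl_hex_action.
- by move=> v; rewrite psl_translE; split=> [/upper_eq1|->] //; apply: upper0.
- move=> v; rewrite psl_translE => /vertex_stab_lower_triangular[a [c [d [D E]]]].
  have [[_ -> _ _]|[_ -> _ _]] := psl2_inj (det1_upper _) D E => //.
  by rewrite oppr0.
- exact: psl_rot1_dual.
- exact: psl_rot2_dual.
- exact: psl_rot3_dual.
Qed.

Hypothesis F_prime : forall x : F, exists n : nat, x = n%:R.

Lemma prime_field_mulrn (x y : F) : x != 0 -> exists n, y = x *+ n.
Proof.
move=> x0; have [n E] := F_prime (y / x); exists n.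
by rewrite -mulr_natr -E mulrC divfK.
Qed.

Lemma psl_rotations_gen : <<[set psl_rot1; psl_rot2; psl_rot3]>>%g = PSL2F F.
Proof.
apply/eqP; rewrite eqEsubset; apply/andP; split.
  rewrite gen_subG; apply/subsetP=> z.
  case/setUP=> [/set2P[]|/set1P]->; rewrite ?psl_rot2E; apply: pgl2_PSL2F.
  - exact: det1_rot1.
  - exact: det1_rot2.
  - exact: det1_rot3.
pose K := <<[set psl_rot1; psl_rot2; psl_rot3]>>%G.
have [m1 m2 m3] : [/\ psl_rot1 \in K, psl_rot2 \in K & psl_rot3 \in K].
  by split; apply: mem_gen; rewrite !inE eqxx ?orbT.
have upK : upper 1 \in K by rewrite -psl_unit_transl !groupM ?groupX.
have lowK : lower (2%:R - w) \in K.
  have <- : (upper 1 ^ psl_dual)%g = lower (2%:R - w).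
    by apply: etrans (psl2J_dual (det1_upper 1)) _; rewrite mul0r mul1r.
  rewrite -psl_unit_transl /unit_transl 2!conjMg conjXg psl_rot1_dual psl_rot2_dual.
  by rewrite !groupM ?groupX ?groupV.
apply: (PSL2F_sub_unipotent (N := K)) => x.
  by have [n ->] := prime_field_mulrn x (oner_neq0 F); rewrite upperMn groupX.
by have [n ->] := prime_field_mulrn x dual_param_neq0; rewrite lowerMn groupX.
Qed.

End PSL2Rotations.

Lemma PSL2_rotations (p b c : nat) :
  prime p -> p = 1 %[mod 12] -> (0 < b)%N -> (0 < c)%N ->
  p = (b ^ 2 + b * c + c ^ 2)%N ->
  exists s1 s2 s3 d : coset_of 'Z(SL2 p)%g,
  [/\ toroidal_rotations s1 s2 s3 d (fun v => (p%:Z %| c%:Z * v.1 - b%:Z * v.2)%Z),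
      <<[set s1; s2; s3]>>%g = PSL2 p
    & rotation_faithful s2^-1%g (unit_transl s1 s2)].
Proof.
move=> p_pr p12 b0 c0 pE; have p_gt1 := prime_gt1 p_pr.
have nz n : ~~ (p %| n)%N -> n%:R != 0 :> 'F_p by rewrite (dvdn_pcharf (pchar_Fp p_pr)).
have small n : (0 < n < 13)%N -> n%:R != 0 :> 'F_p.
  case/andP=> n0 n13; apply: nz; apply: contraL n13 => /dvdn_leq-/(_ n0).
  by move: p12 p_gt1; clear; lia.
have nzc : c%:R != 0 :> 'F_p.
  by apply: nz; apply/negP=> /dvdn_leq-/(_ c0); rewrite pE; move: b0 c0; clear; nia.
have sum0 : b%:R * b%:R + b%:R * c%:R + c%:R * c%:R = 0 :> 'F_p.
  by rewrite -!natrM -!natrD !mulnn -pE pchar_Fp_0.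
pose w : 'F_p := - (b%:R / c%:R).
have w2 : w * w = w - 1.
  apply/eqP; rewrite -subr_eq0; apply/eqP.
  by apply: (mulIf (mulf_neq0 nzc nzc)); rewrite mul0r -sum0 /w; field.
have [i i2] : exists i : 'F_p, i * i = -1.
  apply: finField_sqrtN1; first exact: small.
  by rewrite card_Fp //; move: p12 p_gt1; clear; lia.
have F_prime (x : 'F_p) : exists n : nat, x = n%:R by exists (x : nat); rewrite natr_Zp.
have [nz2 nz3] : 2%:R != 0 :> 'F_p /\ 3%:R != 0 :> 'F_p by split; apply: small.
exists (psl_rot1 w), (psl_rot2 w i), (psl_rot3 w), (psl_dual w); split.
- apply: toroidal_rotations_iff (psl_toroidal_rotations w2 i2 nz3) => v.
  have E : (c%:Z * v.1 - b%:Z * v.2)%:~R = c%:R * (v.1%:~R + w * v.2%:~R) :> 'F_p.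
    by rewrite rmorphB !rmorphM /= -!pmulrn /w; field.
  rewrite (dvdz_pcharf (pchar_Fp p_pr)) E mulf_eq0 (negPf nzc) /=.
  by split=> [->|/eqP].
- exact: psl_rotations_gen.
- by rewrite psl_unit_transl //; apply: psl_rotation_faithful.
Qed.

Lemma PSL2_simple (p : nat) : prime p -> (5 < p)%N -> simple (PSL2 p).
Proof.
move=> p_pr p_gt5.
have nz n : (0 < n < 6)%N -> n%:R != 0 :> 'F_p.
  rewrite -(dvdn_pcharf (pchar_Fp p_pr)) => /andP[n0 n6].
  by apply: contraL n6 => /dvdn_leq-/(_ n0); move: p_gt5; clear; lia.
apply: (@PSL2F_simple _ 2%:R); rewrite ?nz // -subr_eq0.
by rewrite (_ : _ - 1 = 3%:R * 5%:R) ?mulf_neq0 ?nz //; ring.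
Qed.

Lemma card_PSL2 (p : nat) : prime p -> (p * (p ^ 2 - 1) %| 2 * #|PSL2 p|)%N.
Proof. by move=> p_pr; have := card_PSL2F 'F_p; rewrite card_Fp. Qed.

Lemma card_PSL2_ndvd (p : nat) (gT : finGroupType) (G H : {group gT}) : prime p ->
  H \subset G -> #|G : H|%g = 2%N -> ~~ (p * (p ^ 2 - 1) %| #|G|)%N ->
  ~~ (#|PSL2 p| %| #|H|)%N.
Proof.
move=> p_pr sHG index2; apply: contra => dvdH; apply: dvdn_trans (card_PSL2 p_pr) _.
by rewrite -(Lagrange sHG) index2 mulnC dvdn_pmul2r.
Qed.

(** * Coset geometries *)

Local Close Scope ring_scope.
Local Open Scope group_scope.

Definition proper_rank (i : nat) : bool := (0 < i < 5)%N.

Definition transitions (gT : finGroupType) (a : nat -> gT) (J : pred nat) : {set gT} :=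
  [set z | [exists i : 'I_6, exists j : 'I_6,
    [&& proper_rank i, proper_rank j, ~~ J i, ~~ J j & z == (a i)^-1 * a j]]].

Lemma transitionsP (gT : finGroupType) (a : nat -> gT) (J : pred nat) z :
  reflect (exists i j : 'I_6,
             [/\ proper_rank i, proper_rank j, ~~ J i, ~~ J j & z = (a i)^-1 * a j])
          (z \in transitions a J).
Proof.
rewrite inE; apply: (iffP existsP) => [[i /existsP[j /and5P[? ? ? ? /eqP ?]]]|].
  by exists i, j.
by case=> i [j [? ? ? ? ?]]; exists i; apply/existsP; exists j; apply/and5P; split=> //; apply/eqP.
Qed.

Lemma mem_transitions (gT : finGroupType) (a : nat -> gT) (J : pred nat) i j :
  proper_rank i -> proper_rank j -> ~~ J i -> ~~ J j -> (a i)^-1 * a j \in transitions a J.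
Proof.
have lt6 k : proper_rank k -> (k < 6)%N by case/andP=> _; apply: ltnW.
move=> pi pj Ji Jj; apply/transitionsP.
by exists (Ordinal (lt6 i pi)), (Ordinal (lt6 j pj)).
Qed.

Lemma transitionsS (gT : finGroupType) (a : nat -> gT) (J J' : pred nat) :
  (forall i, proper_rank i -> J' i -> J i) -> transitions a J \subset transitions a J'.
Proof.
move=> subJ; apply/subsetP=> z /transitionsP[i [j [pi pj Ji Jj ->]]].
by apply: mem_transitions => //; [apply: contra Ji | apply: contra Jj]; apply: subJ.
Qed.

(** The groups [geo_stab 1], ..., [geo_stab 4] are the stabilisers in
    [geo_group] of the faces of ranks 0, ..., 3 of a base flag, so that ranks
    are shifted by one; the two improper faces have index 0 and 5. The flag
    adjacent to the base flag at index [i] is the image under [geo_shift i] of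
    the one adjacent at index 1. *)
Record coset_geometry := CosetGeometry {
  geo_type : finGroupType;
  geo_group : {group geo_type};
  geo_stab : nat -> {group geo_type};
  geo_shift : nat -> geo_type;
  geo_stab_sub : forall i, geo_stab i \subset geo_group;
  geo_stab_least : geo_stab 0 = geo_group :> {set geo_type};
  geo_stab_greatest : geo_stab 5 = geo_group :> {set geo_type};
  geo_stab_factor : forall i j k, (i < j < k)%N -> (k <= 5)%N ->
    geo_stab j \subset (geo_stab j :&: geo_stab i) * (geo_stab j :&: geo_stab k);
  geo_stab_diamond : forall i, (i < 4)%N -> exists z,
    [/\ z \in geo_stab i :&: geo_stab i.+2, z \notin geo_stab i.+1 &
        geo_stab i :&: geo_stab i.+2 \subset geo_stab i.+1 :|: geo_stab i.+1 :* z];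
  geo_shift_vertex : geo_shift 1 = 1;
  geo_shift_group : forall i, geo_shift i \in geo_group;
  geo_shift_stab : forall i j l, proper_rank i -> proper_rank j -> proper_rank l ->
    l != i -> l != j -> (geo_shift i)^-1 * geo_shift j \in geo_stab l;
  geo_shift_edge : geo_shift 2 \in geo_stab 2 * geo_stab 1;
  geo_shift_edge_notin : geo_shift 2 \notin geo_stab 1;
  geo_stab_gen : forall (J : pred nat) g, g \in geo_group ->
    (forall j, proper_rank j -> J j -> g \in geo_stab j) ->
    g \in <<transitions geo_shift J>>
}.

Section CosetFaces.
Variable X : coset_geometry.
Local Notation gT := (geo_type X).
Local Notation G := (geo_group X).
Local Notation K := (@geo_stab X).
Local Notation a := (@geo_shift X).

Definition is_coset_face : pred ('I_6 * {set gT}) := fun z => z.2 \in rcosets (K z.1) G.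
Definition coset_face : Type := {z | is_coset_face z}.
HB.instance Definition _ := Finite.copy coset_face {z | is_coset_face z}.

Implicit Types (x y z : coset_face) (g h : gT) (A B C D S : {set coset_face}).

Definition face_index x : 'I_6 := (val x).1.
Definition face_coset x : {set gT} := (val x).2.

Lemma stab_subG i g : g \in K i -> g \in G.
Proof. exact/subsetP/geo_stab_sub. Qed.

Lemma face_cosetE x g : g \in face_coset x -> face_coset x = K (face_index x) :* g.
Proof.
have /rcosetsP[h hG] := valP x; rewrite -/(face_index x) -/(face_coset x) => -> gx.
exact/esym/rcoset_eqP.
Qed.

Lemma face_coset_sub x g : g \in face_coset x -> g \in G.
Proof.
have /rcosetsP[h hG] := valP x; rewrite -/(face_index x) -/(face_coset x) => ->.
by case/rcosetP=> k /stab_subG kG ->; rewrite groupM.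
Qed.

Lemma face_coset_ex x : exists g, g \in face_coset x.
Proof.
have /rcosetsP[h hG] := valP x; rewrite -/(face_index x) -/(face_coset x) => ->.
by exists h; apply: rcoset_refl.
Qed.

Lemma mem_face_coset x g h : g \in face_coset x ->
  (h \in face_coset x) = (h * g^-1 \in K (face_index x)).
Proof. by move=> gx; rewrite (face_cosetE gx) mem_rcoset. Qed.

Lemma coset_face_eq x y g : face_index x = face_index y ->
  g \in face_coset x -> g \in face_coset y -> x = y.
Proof.
move=> eq_index gx gy; apply: val_inj; rewrite [val x]surjective_pairing.
rewrite [val y]surjective_pairing -/(face_index x) -/(face_index y).
by rewrite -/(face_coset x) -/(face_coset y) (face_cosetE gx) (face_cosetE gy) eq_index.
Qed.

Lemma improper_face_coset x : ~~ proper_rank (face_index x) -> face_coset x = G.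
Proof.
have [g gx] := face_coset_ex x; rewrite (face_cosetE gx) => improper.
suff -> : K (face_index x) = G by rewrite rcoset_id // (face_coset_sub gx).
apply: val_inj; rewrite /=; case: (face_index x) improper => -[|[|[|[|[|[|//]]]]]] //= _ _.
  exact: geo_stab_least.
exact: geo_stab_greatest.
Qed.

Definition coset_face_le x y : bool :=
  (face_index x <= face_index y)%N && (face_coset x :&: face_coset y != set0).

Lemma coset_face_leP x y :
  reflect ((face_index x <= face_index y)%N /\
           exists2 g, g \in face_coset x & g \in face_coset y)
          (coset_face_le x y).
Proof.
apply: (iffP andP) => [[le_xy /set0Pn[g /setIP[gx gy]]]|[le_xy [g gx gy]]].
  by split=> //; exists g.
by split=> //; apply/set0Pn; exists g; rewrite inE gx.
Qed.

Lemma coset_face_le_eq x y :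
  coset_face_le x y -> face_index x = face_index y -> x = y.
Proof. by case/coset_face_leP=> _ [g gx gy] eq_index; apply: coset_face_eq gx gy. Qed.

(* The factorisation of the stabiliser of the middle face moves a common element
   of the first two faces into the third. *)
Lemma coset_face_le_common x y z : coset_face_le x y -> coset_face_le y z ->
  exists g, [/\ g \in face_coset x, g \in face_coset y & g \in face_coset z].
Proof.
move=> xy yz; have /coset_face_leP[le_xy [g gx gy]] := xy.
have /coset_face_leP[le_yz [h hy hz]] := yz.
have [eq_xy|neq_xy] := eqVneq (face_index x) (face_index y).
  by exists h; rewrite (coset_face_le_eq xy eq_xy).
have [eq_yz|neq_yz] := eqVneq (face_index y) (face_index z).
  by exists g; rewrite -(coset_face_le_eq yz eq_yz).
have lt : (face_index x < face_index y < face_index z)%N.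
  by rewrite !ltn_neqAle le_xy le_yz neq_xy neq_yz.
have hg : g * h^-1 \in K (face_index y) by rewrite -(mem_face_coset _ hy).
have := subsetP (geo_stab_factor X lt (leq_ord (face_index z))) _ hg.
case/mulsgP=> u v /setIP[uy ux] /setIP[vy vz] E.
have E2 : u^-1 * g = v * h by rewrite -[g](mulgKV h) E !mulgA mulVg mul1g.
exists (u^-1 * g); rewrite (mem_face_coset _ gx) (mem_face_coset _ gy) mulgK !groupV.
by split=> //; rewrite E2 (mem_face_coset _ hz) mulgK.
Qed.

Lemma coset_face_le_refl : reflexive coset_face_le.
Proof.
by move=> x; apply/coset_face_leP; split=> //; have [g gx] := face_coset_ex x; exists g.
Qed.

Lemma coset_face_le_anti : antisymmetric coset_face_le.
Proof.
move=> x y /andP[xy yx]; apply: (coset_face_le_eq xy); apply/val_inj/anti_leq.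
by case/andP: xy yx => -> _ /andP[].
Qed.

Lemma coset_face_le_trans : transitive coset_face_le.
Proof.
move=> y x z xy yz; have [g [gx _ gz]] := coset_face_le_common xy yz.
apply/coset_face_leP; split; last by exists g.
by case/andP: xy yz => xy _ /andP[/(leq_trans xy)].
Qed.

HB.instance Definition _ := Order.Le_isPOrder.Build (Order.Disp tt tt) coset_face
  coset_face_le_refl coset_face_le_anti coset_face_le_trans.

Lemma face_index_le x y : (x <= y)%O -> (face_index x <= face_index y)%N.
Proof. by case/andP. Qed.

Lemma face_index_lt x y : (x < y)%O -> (face_index x < face_index y)%N.
Proof.
rewrite lt_neqAle => /andP[neq xy]; rewrite ltn_neqAle face_index_le // andbT.
by apply: contra neq => /eqP/val_inj/(coset_face_le_eq xy)->.
Qed.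

Lemma comparable_face_le x y :
  (x >=< y)%O -> (face_index x <= face_index y)%N -> (x <= y)%O.
Proof.
case/orP=> // yx le_xy; rewrite (coset_face_le_eq yx) //.
by apply/val_inj/anti_leq; rewrite le_xy face_index_le.
Qed.

Lemma improper_face_le x y : ~~ proper_rank (face_index x) || ~~ proper_rank (face_index y) ->
  (face_index x <= face_index y)%N -> (x <= y)%O.
Proof.
move=> improper le_xy; apply/coset_face_leP; split=> //.
case/orP: improper => /improper_face_coset ->.
  by have [g gy] := face_coset_ex y; exists g; rewrite // (face_coset_sub gy).
by have [g gx] := face_coset_ex x; exists g; rewrite // (face_coset_sub gx).
Qed.

(** Elements outside of the group stand for the identity. *)
Definition group_part g := if g \in G then g else 1.

Lemma group_partG g : group_part g \in G.
Proof. by rewrite /group_part; case: ifP. Qed.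

Lemma coset_face_of_subproof (i : 'I_6) g : is_coset_face (i, K i :* group_part g).
Proof. by apply/rcosetsP; exists (group_part g); rewrite ?group_partG. Qed.

Definition face_of (i : 'I_6) g : coset_face :=
  exist (fun z : 'I_6 * {set gT} => is_true (is_coset_face z)) _ (coset_face_of_subproof i g).

Lemma face_coset_face_of i g : g \in G -> face_coset (face_of i g) = K i :* g.
Proof. by move=> gG; rewrite /face_coset /= /group_part gG. Qed.

Lemma mem_face_of i g : g \in G -> g \in face_coset (face_of i g).
Proof. by move=> gG; rewrite face_coset_face_of // rcoset_refl. Qed.

Lemma face_ofE x g : g \in face_coset x -> x = face_of (face_index x) g.
Proof.
move=> gx; apply: (coset_face_eq _ gx) => //.
by apply: mem_face_of; apply: face_coset_sub gx.
Qed.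

Lemma face_of_eqP i g h : g \in G -> h \in G ->
  reflect (face_of i g = face_of i h) (g * h^-1 \in K i).
Proof.
move=> gG hG; apply: (iffP idP) => [gh|E].
  by apply: (@coset_face_eq _ _ g); rewrite ?mem_face_of // face_coset_face_of // mem_rcoset.
by rewrite -mem_rcoset -face_coset_face_of // -E mem_face_of.
Qed.

Lemma face_of_mulK (i : 'I_6) g k : g \in G -> k \in K i -> face_of i (k * g) = face_of i g.
Proof. by move=> gG kK; apply/face_of_eqP; rewrite ?mulgK // groupM // (stab_subG kK). Qed.

Lemma face_of_le (i j : 'I_6) g : g \in G -> (i <= j)%N -> (face_of i g <= face_of j g)%O.
Proof. by move=> gG le_ij; apply/coset_face_leP; split=> //; exists g; rewrite mem_face_of. Qed.

Lemma chain_index_inj A : chain A -> {in A &, injective face_index}.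
Proof.
move=> /chainP cA x y xA yA eq_index; apply: coset_face_le_eq (eq_index).
by apply: comparable_face_le; [apply: cA | rewrite eq_index].
Qed.

Lemma flag_index_inj A : flag A -> {in A &, injective face_index}.
Proof. by move/flag_chain; apply: chain_index_inj. Qed.

Lemma improper_face_in_flag A z : flag A -> ~~ proper_rank (face_index z) -> z \in A.
Proof.
move=> fA improper; apply: mem_flag => // x _.
by case/orP: (leq_total (face_index z) (face_index x)) => le_zx; apply/orP; [left | right];
  apply: improper_face_le; rewrite ?improper ?orbT.
Qed.

(* Between two incident faces there is a face of any intermediate index: take
   the coset of a common element. *)
Lemma flag_index_surj A i : flag A -> exists2 x, x \in A & face_index x = i.
Proof.
move=> fA; have /chainP cA := flag_chain fA.
have [proper_i|] := boolP (proper_rank i); last first.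
  by exists (face_of i 1) => //; apply: improper_face_in_flag.
have [/exists_inP[x xA /eqP]|none] := boolP [exists x in A, face_index x == i].
  by exists x.
have botA : face_of ord0 1 \in A by apply: improper_face_in_flag.
have topA : face_of ord_max 1 \in A by apply: improper_face_in_flag.
have [/= i_gt0 i_lt5] := andP proper_i.
case: (@arg_maxnP _ (face_of ord0 1) (fun x => (x \in A) && (face_index x < i)%N)
                  (fun x => face_index x : nat)); first by rewrite botA.
move=> x /andP[xA lt_xi] x_max.
case: (@arg_minnP _ (face_of ord_max 1) (fun x => (x \in A) && (i < face_index x)%N)
                  (fun x => face_index x : nat)); first by rewrite topA.
move=> y /andP[yA lt_iy] y_min.
have /coset_face_leP[_ [g gx gy]] : (x <= y)%O.
  by apply: comparable_face_le; rewrite ?cA // ltnW // (ltn_trans lt_xi).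
have gG := face_coset_sub gx.
have le_xz : (x <= face_of i g)%O by rewrite (face_ofE gx) face_of_le // ltnW.
have le_zy : (face_of i g <= y)%O by rewrite (face_ofE gy) face_of_le // ltnW.
exists (face_of i g) => //; apply: mem_flag => // w wA.
have neq_wi : face_index w != i.
  by apply: contraNneq none => wi; apply/exists_inP; exists w => //; apply/eqP.
have := neq_wi; rewrite -val_eqE /= neq_ltn => /orP[lt_wi|lt_iw]; apply/orP.
  right; apply: le_trans le_xz; apply: comparable_face_le; first exact: cA.
  by apply: x_max; rewrite wA.
left; apply: le_trans le_zy _; apply: comparable_face_le; first exact: cA.
by apply: y_min; rewrite wA.
Qed.

Lemma coset_flag_size A : flag A -> #|A| = 6%N.
Proof.
move=> fA; rewrite -(card_in_imset (flag_index_inj fA)) -[RHS](card_ord 6) -cardsT.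
congr #|pred_of_set _|; apply/setP=> i; rewrite !inE.
by have [x xA <-] := flag_index_surj i fA; rewrite imset_f.
Qed.

Lemma flag_of_faces (f : 'I_6 -> coset_face) : (forall i, face_index (f i) = i) ->
  (forall i j : 'I_6, (i < j)%N -> (f i <= f j)%O) -> flag [set f i | i : 'I_6].
Proof.
move=> index_f f_le; set A := [set f i | i : 'I_6].
have cA : chain A.
  apply/chainP=> _ _ /imsetP[i _ ->] /imsetP[j _ ->].
  case: (ltngtP i j) => [lt_ij|lt_ji|/val_inj->]; last exact: comparablexx.
    by apply/orP; left; apply: f_le.
  by apply/orP; right; apply: f_le.
apply/maxsetP; split=> // B cB sAB; apply/eqP; rewrite eqEsubset sAB andbT.
apply/subsetP=> y yB; have fA : f (face_index y) \in A by apply: imset_f.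
by rewrite (chain_index_inj cB yB (subsetP sAB _ fA)) ?index_f.
Qed.

Definition base_flag g : {set coset_face} := [set face_of i g | i : 'I_6].

(** The flag adjacent to [base_flag g] at index 1 is [mirror_flag g]. *)
Definition mirror_face (i : 'I_6) g : coset_face :=
  if i == 1%N :> nat then face_of i ((a 2)^-1 * g) else face_of i g.
Definition mirror_flag g : {set coset_face} := [set mirror_face i g | i : 'I_6].

Lemma flag_base_flag g : g \in G -> flag (base_flag g).
Proof. by move=> gG; apply: flag_of_faces => // i j /ltnW/face_of_le->. Qed.

Lemma mem_base_flag g x : g \in G -> (x \in base_flag g) = (g \in face_coset x).
Proof.
move=> gG; apply/imsetP/idP=> [[i _ ->]|gx]; first exact: mem_face_of.
by exists (face_index x) => //; apply: face_ofE.
Qed.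

Lemma face_index_mirror i g : face_index (mirror_face i g) = i.
Proof. by rewrite /mirror_face; case: ifP. Qed.

Lemma mirror_vertex_le (i j : 'I_6) g : g \in G -> i = 1%N :> nat -> (i < j)%N ->
  (face_of i ((a 2)^-1 * g) <= face_of j g)%O.
Proof.
move=> gG i1 lt_ij; have hG : (a 2)^-1 * g \in G by rewrite groupM // groupV geo_shift_group.
have [proper_j|improper_j] := boolP (proper_rank j); last first.
  by apply: improper_face_le; rewrite ?improper_j ?orbT // ltnW.
have [j2|j2] := eqVneq (j : nat) 2%N.
  have /mulsgP[u v u2 v1 E] := geo_shift_edge X.
  apply/coset_face_leP; split; first exact: ltnW.
  exists (v * (a 2)^-1 * g).
    by rewrite face_coset_face_of // -mulgA mem_rcoset mulgK i1.
  by rewrite face_coset_face_of // mem_rcoset mulgK E invMg mulgA mulgV mul1g groupV j2.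
have -> : face_of j g = face_of j ((a 2)^-1 * g).
  rewrite face_of_mulK // groupV -[a 2]mul1g -invg1 -(geo_shift_vertex X).
  by apply: geo_shift_stab => //; apply: contraTneq lt_ij => ->; rewrite i1.
exact/face_of_le/ltnW.
Qed.

Lemma flag_mirror_flag g : g \in G -> flag (mirror_flag g).
Proof.
move=> gG; apply: flag_of_faces => [i|i j lt_ij]; first exact: face_index_mirror.
rewrite /mirror_face; case: eqP => [i1|_]; case: eqP => [j1|_].
- by rewrite i1 j1 in lt_ij.
- exact: mirror_vertex_le.
- apply: improper_face_le; last exact: ltnW.
  by move: lt_ij; rewrite j1; case: (i : nat).
- exact/face_of_le/ltnW.
Qed.

Lemma mirror_face_shift (i l : 'I_6) g : g \in G -> proper_rank i -> l != i ->
  mirror_face l (a i * g) = face_of l g.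
Proof.
move=> gG proper_i neq_li; have aG := geo_shift_group X.
have [proper_l|improper_l] := boolP (proper_rank l); last first.
  apply: (@coset_face_eq _ _ g); rewrite ?face_index_mirror ?mem_face_of //.
  by rewrite improper_face_coset ?face_index_mirror.
rewrite /mirror_face; case: eqP => [l1|l1].
  rewrite mulgA face_of_mulK //.
  have [->|i2] := eqVneq (i : nat) 2%N; first by rewrite mulVg group1.
  by apply: geo_shift_stab => //; rewrite l1.
rewrite face_of_mulK // -[a i]mul1g -invg1 -(geo_shift_vertex X).
by apply: geo_shift_stab => //; apply/eqP.
Qed.

Lemma stab_trivial g i : g \in G -> proper_rank i ->
  (forall j, proper_rank j -> j != i -> g \in K j) -> g = 1.
Proof.
move=> gG proper_i gK; have := geo_stab_gen (J := [pred j | j != i]) gG gK.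
suff -> : <<transitions a [pred j | j != i]>> = 1 by move/set1gP.
apply/trivgP; rewrite gen_subG; apply/subsetP=> z /transitionsP[k [l []]] _ _.
by rewrite /= !negbK => /eqP-> /eqP-> ->; rewrite mulVg inE.
Qed.

Lemma base_flag_eq g h i : g \in G -> h \in G -> proper_rank i ->
  (forall j : 'I_6, proper_rank j -> j != i :> nat -> face_of j g = face_of j h) -> g = h.
Proof.
move=> gG hG proper_i eq_faces; apply/eqP; rewrite eq_mulgV1; apply/eqP.
apply: (stab_trivial _ proper_i) => [|j proper_j neq_ji]; first by rewrite groupM ?groupV.
have lt_j6 : (j < 6)%N by case/andP: proper_j => _; apply: ltnW.
by apply/(face_of_eqP (Ordinal lt_j6) gG hG)/eq_faces.
Qed.

Lemma base_flag_neq_mirror_flag g h : g \in G -> h \in G -> base_flag g <> mirror_flag h.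
Proof.
move=> gG hG E; have eq_face (l : 'I_6) : face_of l g = mirror_face l h.
  apply: (flag_index_inj (flag_base_flag gG)); last by rewrite face_index_mirror.
    exact: imset_f.
  by rewrite E; apply: imset_f.
have gh : g = h.
  apply: (base_flag_eq gG hG (isT : proper_rank 1)) => j _ j1.
  by rewrite eq_face /mirror_face (negPf j1).
have := eq_face (inord 1); rewrite /mirror_face inordK //= -gh.
have aG : (a 2)^-1 * g \in G by rewrite groupM // groupV geo_shift_group.
move/esym/(face_of_eqP _ aG gG); rewrite inordK // mulgK groupV.
by rewrite (negPf (geo_shift_edge_notin X)).
Qed.

Lemma other_proper_ranks (i : 'I_6) : proper_rank i ->
  exists j k l : 'I_6, (j < k < l)%N /\
    forall m : 'I_6, proper_rank m -> m != i -> [|| m == j, m == k | m == l].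
Proof.
case: i => -[|[|[|[|[|[|//]]]]]] // lt_i6 _.
- exists (@Ordinal 6 2 isT), (@Ordinal 6 3 isT), (@Ordinal 6 4 isT).
  by split=> // -[[|[|[|[|[|[|//]]]]]] ?].
- exists (@Ordinal 6 1 isT), (@Ordinal 6 3 isT), (@Ordinal 6 4 isT).
  by split=> // -[[|[|[|[|[|[|//]]]]]] ?].
- exists (@Ordinal 6 1 isT), (@Ordinal 6 2 isT), (@Ordinal 6 4 isT).
  by split=> // -[[|[|[|[|[|[|//]]]]]] ?].
- exists (@Ordinal 6 1 isT), (@Ordinal 6 2 isT), (@Ordinal 6 3 isT).
  by split=> // -[[|[|[|[|[|[|//]]]]]] ?].
Qed.

Lemma flag_common_element A (i : 'I_6) : flag A -> proper_rank i ->
  exists2 g, g \in G & {in A, forall x, face_index x != i -> x \in base_flag g}.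
Proof.
move=> fA /other_proper_ranks[j [k [l [/andP[lt_jk lt_kl] others]]]].
have /chainP cA := flag_chain fA.
have [x xA ix] := flag_index_surj j fA; have [y yA iy] := flag_index_surj k fA.
have [z zA iz] := flag_index_surj l fA.
have xy : coset_face_le x y by apply: comparable_face_le; rewrite ?cA // ix iy ltnW.
have yz : coset_face_le y z by apply: comparable_face_le; rewrite ?cA // iz iy ltnW.
have [g [gx gy gz]] := coset_face_le_common xy yz.
have gG := face_coset_sub gx; exists g => // w wA wi; rewrite mem_base_flag //.
have [proper_w|improper_w] := boolP (proper_rank (face_index w)); last first.
  by rewrite improper_face_coset.
have := others _ proper_w wi; rewrite -ix -iy -iz.
by case/or3P=> /eqP/(flag_index_inj fA) ->.
Qed.

Section Connectedness.
Variable S : {set coset_face}.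

Definition adjacent_through : rel {set coset_face} :=
  [rel C D | [&& adjacent C D, S \subset C & S \subset D]].

Definition avoids (i : nat) : Prop := {in S, forall x, face_index x != i :> nat}.

Lemma connect_off_index C D (i : 'I_6) : flag C -> flag D ->
  S \subset C -> S \subset D -> {in C, forall x, face_index x != i -> x \in D} ->
  connect adjacent_through C D.
Proof.
move=> fC fD sC sD subCD; have [->|neqCD] := eqVneq C D; first exact: connect0.
apply: connect1; rewrite /adjacent_through /= sC sD !andbT.
apply: (adjacent_off_fiber fC fD _ (flag_index_inj fC) neqCD subCD).
by rewrite !coset_flag_size.
Qed.

Lemma avoids_sub C D i : avoids i -> S \subset C ->
  {in C, forall x, face_index x != i :> nat -> x \in D} -> S \subset D.
Proof.
move=> Si sC subCD; apply/subsetP=> x xS.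
by apply: subCD; [apply: (subsetP sC) | apply: Si].
Qed.

Lemma connect_transition (i j : 'I_6) g : proper_rank i -> proper_rank j ->
    avoids i -> avoids j -> g \in G -> S \subset base_flag g ->
  S \subset base_flag ((a i)^-1 * a j * g) /\
  connect adjacent_through (base_flag g) (base_flag ((a i)^-1 * a j * g)).
Proof.
move=> proper_i proper_j Si Sj gG sg; set h := _ * g; have aG := geo_shift_group X.
have hG : h \in G by rewrite !groupM ?groupV.
have ajE : a j * g = a i * h by rewrite /h !mulgA mulgV mul1g.
have to_mirror : {in base_flag g, forall x, face_index x != j -> x \in mirror_flag (a j * g)}.
  by move=> _ /imsetP[m _ ->] mj; rewrite -(mirror_face_shift gG proper_j mj); apply: imset_f.
have of_mirror : {in mirror_flag (a j * g), forall x, face_index x != i -> x \in base_flag h}.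
  move=> _ /imsetP[m _ ->]; rewrite face_index_mirror ajE => mi.
  by rewrite (mirror_face_shift hG proper_i mi); apply: imset_f.
have sm := avoids_sub Sj sg to_mirror; have sh := avoids_sub Si sm of_mirror.
have [fg fh] := (flag_base_flag gG, flag_base_flag hG).
have fm : flag (mirror_flag (a j * g)) by rewrite flag_mirror_flag ?groupM.
split=> //; apply: (connect_trans (connect_off_index fg fm sg sm to_mirror)).
exact: (connect_off_index fm fh sm sh of_mirror).
Qed.

Lemma connect_base_flags g h : g \in G -> S \subset base_flag g ->
  h \in <<transitions a [pred i | [exists x in S, face_index x == i :> nat]]>> ->
  connect adjacent_through (base_flag g) (base_flag (h * g)).
Proof.
set J := [pred i | _] => gG sg /(gen_ind (Pr := fun h => [/\ h * g \in G,
  S \subset base_flag (h * g) & connect adjacent_through (base_flag g) (base_flag (h * g))])).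
case=> // [|z k /transitionsP[i [j [proper_i proper_j Ji Jj ->]]] [kG sk gk]].
  by rewrite mul1g.
have avoidsJ l : ~~ J l -> avoids l.
  by rewrite negb_exists_in => /forall_inP Jl x /Jl.
have aG := geo_shift_group X.
have [s c] := connect_transition proper_i proper_j (avoidsJ i Ji) (avoidsJ j Jj) kG sk.
rewrite -mulgA; split=> //; last exact: connect_trans gk c.
exact: groupM (groupM (groupVr (aG i)) (aG j)) kG.
Qed.

Lemma connect_to_base_flag C i : flag C -> S \subset C -> proper_rank i -> avoids i ->
  exists g, [/\ g \in G, S \subset base_flag g & connect adjacent_through C (base_flag g)].
Proof.
move=> fC sC proper_i Si.
have lt_i6 : (i < 6)%N by case/andP: proper_i => _; apply: ltnW.
have [g gG Cg] := flag_common_element (i := Ordinal lt_i6) fC proper_i.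
have sg := avoids_sub Si sC Cg.
by exists g; split=> //; apply: connect_off_index Cg; rewrite ?flag_base_flag.
Qed.

End Connectedness.

Lemma coset_face_connected : strongly_flag_connected coset_face.
Proof.
move=> A B fA fB; have [->|neqAB] := eqVneq A B; first exact: connect0.
set S := A :&: B; have [sA sB] : S \subset A /\ S \subset B by rewrite subsetIl subsetIr.
have [i proper_i Si] : exists2 i, proper_rank i & avoids S i.
  have [x xA xB] : exists2 x, x \in A & x \notin B.
    by apply/subsetPn; apply: contra neqAB => sAB; rewrite eqEcard sAB !coset_flag_size.
  exists (face_index x).
    by apply: contraNT xB => improper_x; apply: improper_face_in_flag.
  move=> y /setIP[yA yB]; apply: contraNneq xB => /val_inj eq_index.
  by rewrite -(flag_index_inj fA yA xA eq_index).
have [g [gG sg Ag]] := connect_to_base_flag fA sA proper_i Si.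
have [h [hG sh Bh]] := connect_to_base_flag fB sB proper_i Si.
have sym : connect_sym (adjacent_through S).
  apply: sym_connect_sym => C D; rewrite /adjacent_through /= adjacent_sym.
  by congr (_ && _); apply: andbC.
apply: (connect_trans Ag); rewrite sym; apply: (connect_trans Bh); rewrite sym.
rewrite -(mulgKV g h); apply: connect_base_flags => //.
apply: geo_stab_gen => [|j proper_j /exists_inP[x xS /eqP<-]].
  by rewrite groupM ?groupV.
have gx : g \in face_coset x by rewrite -mem_base_flag // (subsetP sg).
by rewrite -(mem_face_coset _ gx) -mem_base_flag // (subsetP sh).
Qed.

Definition coset_rank x : int := ((face_index x : nat)%:Z - 1)%R.

Lemma coset_face_between x y g z : g \in face_coset x -> g \in face_coset y ->
    face_index y = (face_index x).+2 :> nat ->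
  (x < z < y)%O <-> exists2 k, k \in K (face_index x) :&: K (face_index y) &
    z = face_of (inord (face_index x).+1) (k * g).
Proof.
move=> gx gy iy; have gG := face_coset_sub gx.
have lt_z6 : ((face_index x).+1 < 6)%N by rewrite -ltnS -iy ltnW // ltnS ltn_ord.
split=> [/andP[xz zy]|[k /setIP[kx ky] ->]].
  have [h [hx hz hy]] := coset_face_le_common (ltW xz) (ltW zy).
  have iz : face_index z = inord (face_index x).+1.
    apply: val_inj; rewrite /= inordK //.
    by have := face_index_lt xz; have := face_index_lt zy; rewrite iy; clear; lia.
  exists (h * g^-1); first by rewrite inE -!mem_face_coset ?hx.
  by rewrite mulgKV -iz; apply: face_ofE.
have kgG : k * g \in G by rewrite groupM // (stab_subG kx).
rewrite !lt_neqAle; apply/andP; split; apply/andP; split.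
- by apply/eqP=> /(congr1 (fun w => face_index w : nat)); rewrite /= inordK //; clear; lia.
- apply/coset_face_leP; split; first by rewrite /= inordK.
  by exists (k * g); rewrite ?mem_face_of // (mem_face_coset _ gx) mulgK.
- by apply/eqP=> /(congr1 (fun w => face_index w : nat)); rewrite /= inordK // iy; clear; lia.
- apply/coset_face_leP; split; first by rewrite /= inordK // iy.
  by exists (k * g); rewrite ?mem_face_of // (mem_face_coset _ gy) mulgK.
Qed.

Lemma coset_face_diamond x y : (x < y)%O -> coset_rank y = (coset_rank x + 2%:Z)%R ->
  #|[set z | (x < z < y)%O]| = 2%N.
Proof.
move=> xy rxy; have iy : face_index y = (face_index x).+2 :> nat.
  by move: rxy; rewrite /coset_rank; clear; lia.
have /coset_face_leP[_ [g gx gy]] := ltW xy; have gG := face_coset_sub gx.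
have lt_x4 : (face_index x < 4)%N by have := ltn_ord (face_index y); rewrite iy.
have [u [u_xy u_notin sub_u]] := geo_stab_diamond X lt_x4.
set i : 'I_6 := inord (face_index x).+1.
have i_val : i = (face_index x).+1 :> nat by rewrite inordK // !ltnS (ltnW lt_x4).
rewrite -i_val in u_notin sub_u.
have uG : u * g \in G by case/setIP: u_xy => /stab_subG uG _; rewrite groupM.
suff -> : [set z | (x < z < y)%O] = [set face_of i g; face_of i (u * g)].
  rewrite cards2; case: eqP => // /esym/(face_of_eqP i uG gG).
  by rewrite mulgK (negPf u_notin).
apply/setP=> z; rewrite !inE; apply/idP/orP=> [/(coset_face_between _ gx gy iy)[k]|].
  rewrite iy -i_val => /(subsetP sub_u)/setUP[kK|/rcosetP[l lK ->]] ->; rewrite inord_val.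
    by left; apply/eqP/face_of_mulK.
  by right; apply/eqP; rewrite -mulgA; apply: face_of_mulK.
case=> /eqP->; apply/(coset_face_between _ gx gy iy).
  by exists 1; rewrite ?group1 ?mul1g.
by exists u; rewrite // iy.
Qed.

Lemma coset_face_polytope : is_polytope 4 coset_rank.
Proof.
split.
- by move=> x; rewrite /coset_rank; have := ltn_ord (face_index x); clear; lia.
- by move=> x y /face_index_lt; rewrite /coset_rank; clear; lia.
- by exists (face_of ord0 1) => x; apply: improper_face_le.
- exists (face_of ord_max 1) => x; apply: improper_face_le; rewrite ?orbT //.
  exact: leq_ord.
- exact: coset_flag_size.
- exact: coset_face_connected.
- exact: coset_face_diamond.
Qed.

End CosetFaces.

Definition coset_polytope (X : coset_geometry) : polytope 4 :=
  Polytope (coset_face_polytope X).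

Section CosetAutomorphisms.
Variable X : coset_geometry.
Local Notation gT := (geo_type X).
Local Notation G := (geo_group X).
Local Notation K := (@geo_stab X).
Local Notation a := (@geo_shift X).
Local Notation P := (coset_polytope X).
Local Notation base_flag := (@base_flag X : gT -> {set P}).
Local Notation mirror_flag := (@mirror_flag X : gT -> {set P}).
Implicit Types (x y z : P) (g h : gT) (i : 'I_6) (k l : nat) (gam : {perm P}).

Lemma rank_face_index x : rank x = ((face_index x : nat)%:Z - 1)%R. Proof. by []. Qed.

Lemma right_mul_subproof x g : is_coset_face (face_index x, face_coset x :* group_part g).
Proof.
have [h hx] := face_coset_ex x; rewrite (face_cosetE hx); apply/rcosetsP.
exists (h * group_part g); first by rewrite groupM ?group_partG ?(face_coset_sub hx).
by rewrite rcosetM.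
Qed.

Definition right_mul g x : P :=
  exist (fun z : 'I_6 * {set gT} => is_true (is_coset_face z)) _ (right_mul_subproof x g).

Lemma right_mul_inj g : injective (right_mul g).
Proof.
move=> x y /(congr1 val)[eq_index eq_coset]; apply: val_inj => /=.
rewrite [val x]surjective_pairing [val y]surjective_pairing.
rewrite -/(face_index x) -/(face_index y) -/(face_coset x) -/(face_coset y) eq_index.
by congr (_, _); apply: (can_inj (rcosetK (group_part g))).
Qed.

Definition rmul g : {perm P} := perm (@right_mul_inj g).

Lemma face_coset_rmul g x : g \in G ->
  face_coset (rmul g x) = face_coset x :* g.
Proof. by move=> gG; rewrite permE /face_coset /= /group_part gG. Qed.

Lemma face_index_rmul g x : face_index (rmul g x) = face_index x.
Proof. by rewrite permE. Qed.

Lemma rmul_face_of g h i : g \in G -> h \in G ->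
  rmul g (face_of i h) = face_of i (h * g).
Proof.
move=> gG hG; apply: (@coset_face_eq _ _ _ (h * g)).
- by rewrite face_index_rmul.
- by rewrite face_coset_rmul // mem_rcoset mulgK mem_face_of.
- by rewrite mem_face_of // groupM.
Qed.

Lemma rmul_Gamma g : g \in G -> rmul g \in Gamma P.
Proof.
move=> gG; apply/GammaP=> x y.
rewrite -[LHS]/(coset_face_le _ _) -[RHS]/(coset_face_le _ _) /coset_face_le.
rewrite !face_index_rmul !face_coset_rmul //; congr (_ && _).
apply/set0Pn/set0Pn=> -[h]; rewrite !inE.
  by rewrite !mem_rcoset => hg; exists (h * g^-1); rewrite inE.
by exists (h * g); rewrite !inE !mem_rcoset mulgK.
Qed.

Lemma rmulM : {in G &, {morph rmul : g h / g * h}}.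
Proof.
move=> g h gG hG; apply/permP=> x; rewrite permM.
have [k kx] := face_coset_ex x; have kG := face_coset_sub kx.
by rewrite (face_ofE kx) !rmul_face_of ?groupM // mulgA.
Qed.

Canonical rmul_morphism := Morphism rmulM.

Lemma rmul_base_flag g h : g \in G -> h \in G ->
  rmul g @: base_flag h = base_flag (h * g).
Proof.
by move=> gG hG; rewrite -imset_comp; apply: eq_imset => i; apply: rmul_face_of.
Qed.

Lemma rmul_mirror_flag g h : g \in G -> h \in G ->
  rmul g @: mirror_flag h = mirror_flag (h * g).
Proof.
move=> gG hG; rewrite -imset_comp; apply: eq_imset => i /=.
rewrite /mirror_face; case: ifP => _; rewrite rmul_face_of ?mulgA //.
by rewrite groupM ?groupV ?geo_shift_group.
Qed.

Lemma base_flag_inj : {in G &, injective base_flag}.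
Proof.
move=> g h gG hG E; apply: (base_flag_eq gG hG (isT : proper_rank 1)) => j _ _.
apply: (flag_index_inj (flag_base_flag gG)) => //; first exact: imset_f.
by rewrite E; apply: imset_f.
Qed.

Lemma injm_rmul : 'injm rmul.
Proof.
apply/injmP=> g h gG hG E; apply: base_flag_inj => //.
by rewrite -[g]mul1g -[h]mul1g -!rmul_base_flag // E.
Qed.

Lemma i_adjacent_off_index (k : nat) (A B : {set P}) : flag A -> flag B -> A <> B ->
  {in A, forall x, face_index x != k.+1 :> nat -> x \in B} -> i_adjacent k A B.
Proof.
move=> fA fB neqAB subAB; apply/i_adjacentP => //; split=> // x xA rx.
apply: subAB => //; apply: contra_notN rx => /eqP ix.
by rewrite rank_face_index ix; clear; lia.
Qed.

Lemma base_mirror_adjacent k g : (k < 4)%N -> g \in G ->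
  i_adjacent k (base_flag g) (mirror_flag (a k.+1 * g)).
Proof.
move=> lt_k4 gG; have lt_k6 : (k.+1 < 6)%N by rewrite ltnS ltnW // ltnS.
have aG : a k.+1 * g \in G by rewrite groupM ?geo_shift_group.
apply: i_adjacent_off_index.
- exact: flag_base_flag.
- exact: flag_mirror_flag.
- exact: base_flag_neq_mirror_flag.
move=> _ /imsetP[l _ ->] lk.
by rewrite -(mirror_face_shift (i := Ordinal lt_k6) gG) //; apply: imset_f.
Qed.

Lemma coset_flag_cases (A : {set P}) : flag A ->
  exists2 g, g \in G & A = base_flag g \/ A = mirror_flag g.
Proof.
move=> fA; have [|g gG Ag] := flag_common_element (i := inord 1) fA; first by rewrite inordK.
exists g => //; have [->|/eqP neq] := eqVneq A (base_flag g); [by left | right].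
apply: (@i_adjacent_uniq 4 P 0 (base_flag g)) => //; last first.
  by have := @base_mirror_adjacent 0 g isT gG; rewrite geo_shift_vertex mul1g.
apply: i_adjacent_sym; apply: i_adjacent_off_index => //; first exact: flag_base_flag.
by move=> x xA ix; apply: Ag => //; rewrite -val_eqE /= inordK.
Qed.

Lemma base_flags_not_adjacent g h k : (k < 4)%N -> g \in G -> h \in G ->
  ~~ i_adjacent k (base_flag g) (base_flag h).
Proof.
move=> lt_k4 gG hG; apply/negP=> adj; have [fg fh] := i_adjacent_flags adj.
have [neq sub] := i_adjacentP _ fg fh adj.
case: neq; congr base_flag; apply: (base_flag_eq gG hG (lt_k4 : proper_rank k.+1)) => j _ jk.
apply: (flag_index_inj fh) => //; last exact: imset_f.
apply: sub; first exact: imset_f.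
by rewrite rank_face_index -[face_index _]/j; move: (j : nat) jk; clear; lia.
Qed.

Lemma mirror_flags_not_adjacent g h k : (k < 4)%N -> g \in G -> h \in G ->
  ~~ i_adjacent k (mirror_flag g) (mirror_flag h).
Proof.
move=> lt_k4 gG hG; apply/negP=> adj.
have aG : (a k.+1)^-1 * g \in G by rewrite groupM ?groupV ?geo_shift_group.
have := base_mirror_adjacent lt_k4 aG; rewrite mulgA mulgV mul1g => /i_adjacent_sym adj'.
by have /esym := i_adjacent_uniq lt_k4 adj adj'; apply: base_flag_neq_mirror_flag.
Qed.

(** The group has an endomorphism sending each rotation to its mirror image. *)
Definition mirrored : Prop := exists f : {morphism G >-> gT},
  forall k l, (k < 4)%N -> (l < 4)%N -> f ((a k.+1)^-1 * a l.+1) = a k.+1 * (a l.+1)^-1.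

Lemma group_sub_transitions : G \subset
  <<[set z | [exists k : 'I_4, exists l : 'I_4, z == (a k.+1)^-1 * a l.+1]]>>.
Proof.
apply/subsetP=> g gG.
have : g \in <<transitions a pred0>> by apply: geo_stab_gen.
apply/subsetP/genS/subsetP=> z /transitionsP[[[|k] ltk] [[[|l] ltl] []]] // pk pl _ _ ->.
rewrite inE; apply/existsP; exists (Ordinal (pk : (k < 4)%N)).
by apply/existsP; exists (Ordinal (pl : (l < 4)%N)).
Qed.

(* Automorphisms commute with taking adjacent flags. *)
Lemma reflection_conj_rmul gam k l : gam \in Gamma P ->
  gam @: base_flag 1 = mirror_flag 1 -> (k < 4)%N -> (l < 4)%N ->
  rmul ((a k.+1)^-1 * a l.+1) ^ gam = rmul (a k.+1 * (a l.+1)^-1).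
Proof.
move=> gamG gam1 k4 l4; set u := _ * _; set v := _ * _.
have aG := geo_shift_group X; have aVG j : (a j)^-1 \in G by rewrite groupV.
have uG : u \in G by rewrite groupM.
have vG : v \in G by rewrite groupM.
apply: (mulgI gam); rewrite -conjgC.
apply: (Gamma_eq (A := base_flag 1)); rewrite ?groupM ?rmul_Gamma ?flag_base_flag //.
rewrite !imset_permM rmul_base_flag // gam1 rmul_mirror_flag // !mul1g.
have adj_l := Gamma_i_adjacent gamG (base_mirror_adjacent l4 (group1 G)).
have adj_lV := i_adjacent_sym (base_mirror_adjacent l4 (aVG l.+1)).
rewrite mulg1 gam1 in adj_l; rewrite mulgV in adj_lV.
have gam_l := i_adjacent_uniq l4 adj_l adj_lV.
have adj_k := Gamma_i_adjacent gamG (i_adjacent_sym (base_mirror_adjacent k4 uG)).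
rewrite /u mulgA mulgV mul1g gam_l in adj_k.
exact: i_adjacent_uniq k4 adj_k (base_mirror_adjacent k4 (aVG l.+1)).
Qed.

Lemma reflection_mirrored gam : gam \in Gamma P ->
  gam @: base_flag 1 = mirror_flag 1 -> mirrored.
Proof.
move=> gamG gam1; have conjE := reflection_conj_rmul gamG gam1.
have aG := geo_shift_group X.
have tG k l : (a k)^-1 * a l \in G by rewrite groupM ?groupV.
have conj_im g : g \in G -> rmul g ^ gam \in rmul @* G.
  move=> gG; rewrite -mem_conjgV; apply: (subsetP _ _ (mem_morphim _ gG gG)).
  apply: subset_trans (morphimS _ group_sub_transitions) _; rewrite morphim_gen; last first.
    by apply/subsetP=> z; rewrite inE => /existsP[k /existsP[l /eqP->]].
  rewrite gen_subG; apply/subsetP=> _ /morphimP[z zG + ->].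
  rewrite inE => /existsP[k /existsP[l /eqP zE]]; rewrite mem_conjgV zE.
  by rewrite conjE ?ltn_ord // mem_morphim // groupM ?groupV.
have conjM : {in G &, {morph (fun g => invm injm_rmul (rmul g ^ gam))
                         : g h / g * h}}.
  by move=> g h gG hG; rewrite rmulM // conjMg morphM //= conj_im.
exists (Morphism conjM) => k l k4 l4 /=.
by rewrite conjE // invmE // groupM ?groupV.
Qed.

Lemma Gamma_base_flag gam : ~ mirrored -> gam \in Gamma P ->
  exists2 g, g \in G & gam @: base_flag 1 = base_flag g.
Proof.
move=> not_mirrored gamG.
have [g gG [E|E]] := coset_flag_cases (Gamma_flag gamG (flag_base_flag (group1 G))).
  by exists g.
case: not_mirrored; apply: (@reflection_mirrored (gam * rmul g^-1)).
  by rewrite groupM // rmul_Gamma ?groupV.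
by rewrite imset_permM E rmul_mirror_flag ?groupV // mulgV.
Qed.

Lemma Gamma_rmul : ~ mirrored -> Gamma P = rmul @* G.
Proof.
move=> not_mirrored; apply/eqP; rewrite eqEsubset; apply/andP; split; last first.
  by apply/subsetP=> _ /morphimP[g _ gG ->]; apply: rmul_Gamma.
apply/subsetP=> gam gamG; have [g gG E] := Gamma_base_flag not_mirrored gamG.
suff -> : gam = rmul g by apply: mem_morphim.
apply: (Gamma_eq (A := base_flag 1)); rewrite ?rmul_Gamma ?flag_base_flag //.
by rewrite E rmul_base_flag // mul1g.
Qed.

Lemma Gamma_isog : ~ mirrored -> Gamma P \isog G.
Proof. by move/Gamma_rmul->; rewrite isog_sym sub_isog // injm_rmul. Qed.

Lemma orbit_rmul (f : gT -> {set P}) : ~ mirrored ->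
  {in G, forall g, rmul g @: f 1 = f g} -> orbit 'P^* (Gamma P) (f 1) = f @: G.
Proof.
move=> not_mirrored fE; rewrite Gamma_rmul //; apply/setP=> A.
have actE g : 'P^*%act (f 1) (rmul g) = rmul g @: f 1.
  by rewrite /= setactE; apply: eq_imset.
apply/orbitP/imsetP=> [[_ /morphimP[g _ gG ->] <-]|[g gG ->]].
  by exists g => //; rewrite actE fE.
by exists (rmul g); [apply: mem_morphim | rewrite actE fE].
Qed.

Lemma orbit_base_flag : ~ mirrored ->
  orbit 'P^* (Gamma P) (base_flag 1) = [set base_flag g | g in G].
Proof.
move=> not_mirrored; apply: orbit_rmul => // g gG.
by rewrite rmul_base_flag // mul1g.
Qed.

Lemma orbit_mirror_flag : ~ mirrored ->
  orbit 'P^* (Gamma P) (mirror_flag 1) = [set mirror_flag g | g in G].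
Proof.
move=> not_mirrored; apply: orbit_rmul => // g gG.
by rewrite rmul_mirror_flag // mul1g.
Qed.

Lemma coset_flag_orbits : ~ mirrored ->
  flag_orbits P = [set [set base_flag g | g in G]; [set mirror_flag g | g in G]].
Proof.
move=> not_mirrored; apply/setP=> O; rewrite !inE; apply/imsetP/orP.
  case=> A; rewrite inE => /coset_flag_cases[g gG [] -> ->]; [left | right].
    rewrite -orbit_base_flag //; apply/eqP/orbit_eqP; rewrite orbit_base_flag //.
    exact: imset_f.
  rewrite -orbit_mirror_flag //; apply/eqP/orbit_eqP; rewrite orbit_mirror_flag //.
  exact: imset_f.
case=> /eqP->.
  by exists (base_flag 1); rewrite ?orbit_base_flag // inE flag_base_flag.
by exists (mirror_flag 1); rewrite ?orbit_mirror_flag // inE flag_mirror_flag.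
Qed.

Lemma coset_chiral : ~ mirrored -> chiral P.
Proof.
move=> not_mirrored; split=> [|A B ab].
  rewrite coset_flag_orbits // cards2; case: eqP => // E.
  have : base_flag 1 \in [set mirror_flag g | g in G] by rewrite -E imset_f.
  by case/imsetP=> g gG /base_flag_neq_mirror_flag-/(_ (group1 G) gG).
have [k adj k4] := adjacent_i_adjacent ab; have [fA _] := i_adjacent_flags adj.
apply/negP=> B_orbit; have orbitA : orbit 'P^* (Gamma P) A \in flag_orbits P.
  by apply: imset_f; rewrite inE.
have A_orbit := orbit_refl 'P^* (Gamma P) A.
move: orbitA; rewrite coset_flag_orbits // !inE.
case/orP=> /eqP E; rewrite E in A_orbit B_orbit.
  have [[g gG Ag] [h hG Bh]] := (imsetP A_orbit, imsetP B_orbit).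
  by move: adj; rewrite Ag Bh; apply/negP/base_flags_not_adjacent.
have [[g gG Ag] [h hG Bh]] := (imsetP A_orbit, imsetP B_orbit).
by move: adj; rewrite Ag Bh; apply/negP/mirror_flags_not_adjacent.
Qed.

Section Duality.
Variable d : gT.
Hypothesis stab_dual : forall i, K i :^ d = K (rev_ord i).

Lemma group_conj_dual g : (g ^ d \in G) = (g \in G).
Proof.
have := stab_dual ord0; rewrite (geo_stab_least X) (geo_stab_greatest X) => Gd.
by rewrite -{1}Gd memJ_conjg.
Qed.

Lemma coset_dual_subproof x : is_coset_face (rev_ord (face_index x), face_coset x :^ d).
Proof.
have [h hx] := face_coset_ex x; rewrite (face_cosetE hx); apply/rcosetsP.
exists (h ^ d); first by rewrite group_conj_dual (face_coset_sub hx).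
by rewrite conjsMg conjg_set1 stab_dual.
Qed.

Definition coset_dual x : P :=
  exist (fun z : 'I_6 * {set gT} => is_true (is_coset_face z)) _ (coset_dual_subproof x).

Lemma coset_dual_inj : injective coset_dual.
Proof.
move=> x y /(congr1 val)[eq_index eq_coset]; apply: val_inj => /=.
rewrite [val x]surjective_pairing [val y]surjective_pairing.
rewrite -/(face_index x) -/(face_index y) -/(face_coset x) -/(face_coset y).
congr (_, _); last exact: (can_inj (conjsgK d)) eq_coset.
by apply: (can_inj (@rev_ordK 6)); apply: val_inj.
Qed.

Definition dual_perm : {perm P} := perm coset_dual_inj.

Lemma dual_perm_duality : duality dual_perm.
Proof.
move=> x y; rewrite !permE -[LHS]/(coset_face_le _ _) -[RHS]/(coset_face_le _ _).
rewrite /coset_face_le /face_index /face_coset /= -/(face_index x) -/(face_index y).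
rewrite -/(face_coset x) -/(face_coset y).
rewrite !subSS -conjIg setIC -!card_gt0 cardJg; congr (_ && _).
by have := ltn_ord (face_index x); have := ltn_ord (face_index y); clear; lia.
Qed.

Lemma dual_perm_base_flag g : g \in G -> dual_perm @: base_flag g = base_flag (g ^ d).
Proof.
move=> gG; have gdG : g ^ d \in G by rewrite group_conj_dual.
apply: flag_sub_eq; [|exact: flag_base_flag|].
  by apply: (duality_flag dual_perm_duality); apply: flag_base_flag.
apply/subsetP=> _ /imsetP[x xg ->]; rewrite mem_base_flag //.
by rewrite permE /face_coset /= memJ_conjg -/(face_coset x) -mem_base_flag.
Qed.

Lemma coset_properly_self_dual : ~ mirrored -> properly_self_dual P.
Proof.
move=> not_mirrored; exists dual_perm; first exact: dual_perm_duality.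
have dual_inj : injective (fun A : {set P} => dual_perm @: A).
  by move=> A B /(imset_inj perm_inj).
pose base_flags := [set base_flag g | g in G].
have dual_base : [set dual_perm @: A | A : {set P} in base_flags] = base_flags.
  apply/eqP; rewrite eqEcard (card_imset _ dual_inj) leqnn andbT.
  apply/subsetP=> _ /imsetP[_ /imsetP[g gG ->] ->].
  by rewrite dual_perm_base_flag // imset_f // group_conj_dual.
move=> O; rewrite coset_flag_orbits // !inE => /orP[] /eqP-> //.
apply/eqP; rewrite eqEcard (card_imset _ dual_inj) leqnn andbT.
apply/subsetP=> _ /imsetP[_ /imsetP[g gG ->] ->].
have [h hG [E|->]] := coset_flag_cases (duality_flag dual_perm_duality (flag_mirror_flag gG));
  last exact: imset_f.
have : base_flag h \in base_flags by apply: imset_f.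
rewrite -dual_base -E => /imsetP[_ /imsetP[k kG ->]] /dual_inj/esym.
by move/(base_flag_neq_mirror_flag kG gG).
Qed.

End Duality.
End CosetAutomorphisms.

(** The rotation fixing the face of index [i] of the flag [(0, 0)]. *)
Definition facet_rot (gT : finGroupType) (q x : gT) (i : nat) : gT :=
  match i with 1 => q^-1 | 2 => tri_rot q x * q^-1 | _ => tri_rot q x end.

Section CosetFacets.
Variable X : coset_geometry.
Local Notation gT := (geo_type X).
Local Notation G := (geo_group X).
Local Notation K := (@geo_stab X).
Local Notation P := (coset_polytope X).
Variables (q x : gT) (u : point).
Local Notation rotransl := (rotransl q x).
Local Notation tri_rot := (tri_rot q x).
Local Notation facet_rot := (facet_rot q x).
Implicit Types (v w t : point) (f : tess_face) (i j k l : nat).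

Hypothesis qx : hex_action q x.
Hypothesis facet_stab : K 4 = <<[set q^-1; tri_rot]>> :> {set gT}.
Hypothesis facet_face_stab : forall i, (0 < i < 4)%N -> K i :&: K 4 = <[facet_rot i]>.
Hypothesis faithful : rotation_faithful q x.
Hypothesis transl_eq1 : forall v, transl q x v = 1 <-> in_lattice u v.

Lemma facet_rot_rotransl i v k : (0 < i < 4)%N -> exists v' k',
  facet_rot i * rotransl v k = rotransl v' k' /\ tface i v' k' = tface i v k.
Proof.
case: i => [|[|[|[|]]]] //= _.
- by exists v, (k + 5)%N; rewrite rotation_inv_rotransl.
- by exists (v + unit_vec k)%R, (k + 3)%N; rewrite edge_rot_rotransl ?tedgeD3.
- by exists (v + unit_vec k.+1)%R, (k + 4)%N; rewrite tri_rot_rotransl ?ttriD4.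
Qed.

Lemma facet_rotX_rotransl i n v k : (0 < i < 4)%N -> exists v' k',
  facet_rot i ^+ n * rotransl v k = rotransl v' k' /\ tface i v' k' = tface i v k.
Proof.
move=> ri; elim: n => [|n [v1 [k1 [E1 t1]]]]; first by exists v, k; rewrite mul1g.
have [v2 [k2 [E2 t2]]] := facet_rot_rotransl v1 k1 ri; exists v2, k2.
by rewrite expgS -mulgA E1 E2 t2.
Qed.

Lemma facet_rot_stab i : (0 < i < 4)%N -> facet_rot i \in K i.
Proof.
by move=> ri; have := cycle_id (facet_rot i); rewrite -facet_face_stab // => /setIP[].
Qed.

Lemma rotransl_facet_stab v k : rotransl v k \in K 4.
Proof. by rewrite facet_stab; apply/(gen_rotranslP qx); exists v, k. Qed.

Section FacetMap.
Variable g : gT.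
Hypothesis gG : g \in G.

Definition facet_map f : P :=
  match f with
  | TEmpty => face_of ord0 g
  | TVertex v => face_of (inord 1) (rotransl v 0 * g)
  | TEdge v k => face_of (inord 2) (rotransl v k * g)
  | TTriangle v k => face_of (inord 3) (rotransl v k * g)
  | TPlane => face_of (inord 4) g
  end.

Lemma rotransl_mulG v k : rotransl v k * g \in G.
Proof. by rewrite groupM // (stab_subG (rotransl_facet_stab v k)). Qed.

Lemma face_of_facet_rot i v k : (0 < i < 4)%N ->
  face_of (inord i) (facet_rot i * rotransl v k * g) = face_of (inord i) (rotransl v k * g).
Proof.
move=> ri; rewrite -mulgA; apply: face_of_mulK; first exact: rotransl_mulG.
by rewrite inordK ?facet_rot_stab //; move: ri; clear; lia.
Qed.

Lemma face_of_rotation v k :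
  face_of (inord 1) (rotransl v k * g) = face_of (inord 1) (rotransl v 0 * g).
Proof.
rewrite /rotransl -(mulgA (q ^+ k)) expg0 mul1g; apply: face_of_mulK.
  by have := rotransl_mulG v 0; rewrite /rotransl expg0 mul1g.
by rewrite inordK //; apply: groupX; rewrite -groupV; apply: (@facet_rot_stab 1).
Qed.

Lemma facet_map_tedge v k : facet_map (tedge v k) = face_of (inord 2) (rotransl v k * g).
Proof.
rewrite /tedge; have := ltn_pmod k (isT : 0 < 6)%N; case: ifP => k3 k6 /=.
  by rewrite inordK // (rotransl_eqmod qx v (modn_mod k 6)).
rewrite inordK; last by move: k6 k3; clear; lia.
rewrite -(@face_of_facet_rot 2 v k) //= edge_rot_rotransl //.
congr (face_of _ (_ * _)); apply: rotransl_eqmod => //.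
by move: k6 k3; clear; lia.
Qed.

Lemma facet_map_ttri v k : facet_map (ttri v k) = face_of (inord 3) (rotransl v k * g).
Proof.
have rot3 v' k' l : (k' + 4 = l %[mod 6])%N ->
    face_of (inord 3) (rotransl v' k' * g) =
    face_of (inord 3) (rotransl (v' + unit_vec k'.+1)%R l * g).
  move=> kl; rewrite -(@face_of_facet_rot 3 v' k') //= tri_rot_rotransl //.
  by rewrite (rotransl_eqmod qx _ kl).
rewrite -[LHS]/(facet_map (tface 3 v k)) -tface_mod6 -(rotransl_eqmod qx v (modn_mod k 6)).
case_mod6 k; rewrite /= /ttri /= ?inordK //.
- by rewrite (rot3 v 2 0%N).
- by rewrite (rot3 v 3 1%N).
- by rewrite (rot3 v 4 2%N) // (rot3 _ 2 0%N) // -addrA.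
- by rewrite (rot3 v 5 3%N) // (rot3 _ 3 1%N) // -addrA.
Qed.

Lemma facet_map_tface i v k : (i <= 4)%N ->
  facet_map (tface i v k) = face_of (inord i) (rotransl v k * g).
Proof.
case: i => [|[|[|[|[|//]]]]] _ /=.
- have -> : ord0 = inord 0 :> 'I_6 by apply: val_inj; rewrite /= inordK.
  by rewrite face_of_mulK // inordK // geo_stab_least (stab_subG (rotransl_facet_stab v k)).
- by rewrite face_of_rotation.
- exact: facet_map_tedge.
- exact: facet_map_ttri.
- by rewrite face_of_mulK // inordK // rotransl_facet_stab.
Qed.

Lemma face_index_facet_map f : face_index (facet_map f) = tess_rank f :> nat.
Proof. by case: f => * /=; rewrite ?inordK. Qed.

Lemma facet_map_translate t f : in_lattice u t -> facet_map (translate t f) = facet_map f.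
Proof.
move=> ut; have [v [k fE]] := tfaceP f; have le_f4 : (tess_rank f <= 4)%N by case: (f).
rewrite [in LHS]fE -tface_translate facet_map_tface // [in RHS]fE facet_map_tface //.
by rewrite /rotransl translD // (transl_eq1 t).2 // mulg1.
Qed.

Lemma facet_map_fiber f f' : facet_map f = facet_map f' <-> translation_orbit u f f'.
Proof.
split=> [E|[t ut ->]]; last by rewrite facet_map_translate.
have eq_rank : tess_rank f' = tess_rank f by rewrite -!face_index_facet_map E.
have [v [k fE]] := tfaceP f; have [w [l fE']] := tfaceP f'.
have i4 : (tess_rank f <= 4)%N by case: (f).
rewrite eq_rank in fE'; move: (tess_rank f) i4 fE fE' E {eq_rank} => i i4 -> -> {f f'}.
rewrite !facet_map_tface //.
have [i03|] := boolP (0 < i < 4)%N; last first.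
  by case: i i4 => [|[|[|[|[|]]]]] // *; apply: translation_orbit_refl.
move/(face_of_eqP _ (rotransl_mulG _ _) (rotransl_mulG _ _)).
rewrite inordK; last by move: i4; clear; lia.
rewrite invMg mulgA mulgK => diffK.
have : rotransl v k * (rotransl w l)^-1 \in <[facet_rot i]>.
  by rewrite -facet_face_stab // inE diffK /= groupM ?groupV ?rotransl_facet_stab.
case/cycleP=> n E; have [v2 [k2 [E2 t2]]] := facet_rotX_rotransl n w l i03.
have : rotransl v k = rotransl v2 k2 by rewrite -E2 -E mulgKV.
case/(rotransl_inj qx faithful)=> /transl_eq1 uv kk; rewrite -t2 (tface_eqmod i v kk).
exists (v2 - v)%R; first by rewrite -opprB; apply: in_latticeN.
by rewrite -tface_translate addrC subrK.
Qed.

Lemma facet_elements h : h \in face_coset (face_of (inord 4) g : P) ->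
  exists v k, h = rotransl v k * g.
Proof.
rewrite face_coset_face_of // mem_rcoset inordK // facet_stab.
by case/(gen_rotranslP qx)=> v [k E]; exists v, k; rewrite -E mulgKV.
Qed.

Lemma facet_map_below f : (facet_map f <= face_of (inord 4) g)%O.
Proof.
have [v [k fE]] := tfaceP f; have le_f4 : (tess_rank f <= 4)%N by case: (f).
rewrite -[face_of _ g]/(facet_map (tface 4 v k)) fE !facet_map_tface //.
by rewrite face_of_le ?rotransl_mulG // !inordK // ltnS leqW.
Qed.

Lemma facet_map_incident f f' : (facet_map f <= facet_map f')%O -> exists v k,
  [/\ (tess_rank f <= tess_rank f')%N, translation_orbit u f (tface (tess_rank f) v k)
    & translation_orbit u f' (tface (tess_rank f') v k)].
Proof.
move=> le_ff'; have [h [hf hf' /facet_elements[v [k hE]]]] :=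
  coset_face_le_common le_ff' (facet_map_below f').
have flagE f2 : h \in face_coset (facet_map f2) ->
    translation_orbit u f2 (tface (tess_rank f2) v k).
  move=> hf2; apply/facet_map_fiber; rewrite facet_map_tface; last by case: (f2).
  by rewrite -face_index_facet_map inord_val -hE; apply: face_ofE.
exists v, k; split; [|exact: flagE|exact: flagE].
by rewrite -!face_index_facet_map face_index_le.
Qed.

Lemma facet_map_cover : torus_cover u (face_of (inord 4) g : P) facet_map.
Proof.
split=> [y|f f'|f f']; last 1 first.
- split=> [/facet_map_incident[v [k [le_ff' [t ut tE] orbit']]]|[f2 [t ut ->] le_f]].
    exists (translate (- t)%R (tface (tess_rank f') v k)).
      apply: translation_orbit_trans orbit' _.
      by exists (- t)%R => //; apply: in_latticeN.
    apply/(tri_le_translate t); rewrite -tE translateD addNr translate0.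
    by apply: tface_le; rewrite le_ff'; case: (f').
  rewrite -(facet_map_translate f' ut); have [v [k [le_rank -> ->]]] := tri_leP le_f.
  have [i4 j4] : (tess_rank f <= 4)%N /\ (tess_rank (translate t f') <= 4)%N.
    by split; [case: (f) | case: (f')].
  rewrite !facet_map_tface // face_of_le ?rotransl_mulG //.
  by rewrite !inordK // ltnS leqW.
- split=> [yF|[f <-]]; last exact: facet_map_below.
  have /coset_face_leP[_ [h hy /facet_elements[v [k hE]]]] := yF.
  exists (tface (face_index y) v k).
  rewrite facet_map_tface; last by have := face_index_le yF; rewrite /= inordK.
  by rewrite inord_val -hE; apply/esym/face_ofE.
- exact: facet_map_fiber.
Qed.

End FacetMap.

Lemma coset_facet_cover (F : P) : rank F = 3%:Z%R -> exists h, torus_cover u F h.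
Proof.
rewrite rank_face_index => rF; have iF : face_index F = inord 4.
  by apply: val_inj; rewrite /= inordK //; move: rF; clear; lia.
have [g gF] := face_coset_ex F; have gG := face_coset_sub gF.
by exists (facet_map g); rewrite (face_ofE gF) iF; apply: facet_map_cover.
Qed.

End CosetFacets.

(** * Coset geometries from rotations *)

Section RotationGroups.
Variables (gT : finGroupType) (s1 s2 s3 d : gT) (L : point -> Prop).

Definition rotation_group : {group gT} := <<[set s1; s2; s3]>>%G.

Definition rot_stab (i : nat) : {group gT} :=
  match i with
  | 1 => <<[set s2; s3]>>%G
  | 2 => <<[set (s1 * s2)%g; s3]>>%G
  | 3 => <<[set s1; (s2 * s3)%g]>>%G
  | 4 => <<[set s1; s2]>>%G
  | _ => rotation_group
  end.

Definition rot_shift (i : nat) : gT :=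
  match i with 2 => s1 | 3 => s1 * s2 | 4 => s1 * s2 * s3 | _ => 1 end.

Local Notation q := (s2^-1).
Local Notation x := (unit_transl s1 s2).
Local Notation K := rot_stab.
Local Notation a := rot_shift.
Local Notation s12 := (s1 * s2).
Local Notation s23 := (s2 * s3).
Local Notation s123 := (s1 * s2 * s3).
Implicit Types (g h z : gT) (i j k l : nat) (v : point).

Lemma rotation_group_mem :
  [/\ s1 \in rotation_group, s2 \in rotation_group & s3 \in rotation_group].
Proof. by split; apply: mem_gen; rewrite !inE eqxx ?orbT. Qed.

Lemma rotation_group_sub (H : {group gT}) :
  (rotation_group \subset H) = [&& s1 \in H, s2 \in H & s3 \in H].
Proof. by rewrite gen_subG !subUset !sub1set andbA. Qed.

Lemma rot_stab_sub i : K i \subset rotation_group.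
Proof.
have [m1 m2 m3] := rotation_group_mem.
by case: i => [|[|[|[|[|i]]]]] //; rewrite gen_set2_sub ?groupM ?m1 ?m2 ?m3.
Qed.

Lemma vertex_stab_mem : [/\ s2 \in K 1, s3 \in K 1 & s23 \in K 1].
Proof. by have [m2 m3] := gen_set2 s2 s3; split=> //; apply: groupM. Qed.

Lemma edge_stab_mem : [/\ s12 \in K 2, s3 \in K 2 & s123 \in K 2].
Proof. by have [m12 m3] := gen_set2 s12 s3; split=> //; apply: groupM. Qed.

Lemma face_stab_mem : [/\ s1 \in K 3, s23 \in K 3 & s123 \in K 3].
Proof. by have [m1 m23] := gen_set2 s1 s23; split=> //; rewrite -mulgA; apply: groupM. Qed.

Lemma facet_stab_mem : [/\ s1 \in K 4, s2 \in K 4 & s12 \in K 4].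
Proof. by have [m1 m2] := gen_set2 s1 s2; split=> //; apply: groupM. Qed.

Lemma facet_stabE : K 4 = <<[set q^-1; tri_rot q x]>> :> {set gT}.
Proof. by rewrite invgK tri_rot_unit_transl setUC. Qed.

Lemma rot_shift_group i : a i \in rotation_group.
Proof.
have [m1 m2 m3] := rotation_group_mem.
by case: i => [|[|[|[|[|i]]]]] /=; rewrite ?group1 ?groupM.
Qed.

Lemma rot_shift_quotients :
  [/\ (a 1)^-1 * a 2 = s1, (a 1)^-1 * a 3 = s12, (a 1)^-1 * a 4 = s123 &
  [/\ (a 2)^-1 * a 3 = s2, (a 2)^-1 * a 4 = s23 & (a 3)^-1 * a 4 = s3]].
Proof. by rewrite /= invg1 !mul1g -(mulgA s1) !mulKg (mulgA s1) mulKg. Qed.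

Lemma rot_shift_stab i j l : proper_rank i -> proper_rank j -> proper_rank l ->
  l != i -> l != j -> (a i)^-1 * a j \in K l.
Proof.
have [E12 E13 E14 [E23 E24 E34]] := rot_shift_quotients.
have lt i' j' : proper_rank i' -> proper_rank j' -> proper_rank l ->
    l != i' -> l != j' -> (i' < j')%N -> (a i')^-1 * a j' \in K l.
  have [v2 v3 v23] := vertex_stab_mem; have [e12 e3 e123] := edge_stab_mem.
  have [f1 f23 f123] := face_stab_mem; have [c1 c2 c12] := facet_stab_mem.
  case: i' => [|[|[|[|[|i']]]]] //; case: j' => [|[|[|[|[|j']]]]] // _ _;
  rewrite ?E12 ?E13 ?E14 ?E23 ?E24 ?E34; by case: l => [|[|[|[|[|l]]]]].
move=> pi pj pl li lj; case: (ltngtP i j) => [ij|ji|->].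
- exact: lt.
- by rewrite -groupV invMg invgK; apply: lt.
- by rewrite mulVg group1.
Qed.

Lemma rot_shift_edge : a 2 \in K 2 * K 1.
Proof.
have [m2 _ _] := vertex_stab_mem; have [m12 _ _] := edge_stab_mem.
by rewrite -[a 2](mulgK s2); apply: mem_mulg; rewrite ?groupV.
Qed.

Hypothesis rotations : toroidal_rotations s1 s2 s3 d L.
Hypothesis faithful : rotation_faithful q x.
Hypothesis L_unit : ~ L (1, 0)%R.

Let hex : hex_action q x := rot_hex_action rotations.
Let s1_expg3 : s1 ^+ 3 = 1 := rot1_expg3 rotations.
Let s12_expg2 : s12 ^+ 2 = 1 := rot12_expg2 rotations.
Let s123_expg2 : s123 ^+ 2 = 1 := rot123_expg2 rotations.
Let s1_d : s1 ^ d = s3^-1 := rot1_dual rotations.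
Let s2_d : s2 ^ d = s2^-1 := rot2_dual rotations.
Let s3_d : s3 ^ d = s1^-1 := rot3_dual rotations.

Lemma rot12_dual : s12 ^ d = s23^-1.
Proof. by rewrite conjMg s1_d s2_d invMg. Qed.

Lemma rot23_dual : s23 ^ d = s12^-1.
Proof. by rewrite conjMg s2_d s3_d invMg. Qed.

Lemma rot123_dual : s123 ^ d = s123.
Proof.
by rewrite -[RHS](invg_expg2 s123_expg2) !conjMg s1_d s2_d s3_d !invMg mulgA.
Qed.

Lemma rot23_expg2 : s23 ^+ 2 = 1.
Proof. by apply: invg_inj; rewrite -expVgn -rot12_dual -conjXg s12_expg2 conj1g invg1. Qed.

Lemma rot3_expg3 : s3 ^+ 3 = 1.
Proof. by apply: invg_inj; rewrite -expVgn -s1_d -conjXg s1_expg3 conj1g invg1. Qed.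

Lemma rot_stab_dual i : (i <= 5)%N -> K i :^ d = K (5 - i).
Proof.
have conj_gen2 g h : <<[set g; h]>> :^ d = <<[set g ^ d; h ^ d]>>.
  by rewrite -genJ conjUg !conjg_set1.
have conj_group : rotation_group :^ d = rotation_group.
  apply/eqP; rewrite eqEcard cardJg leqnn andbT sub_conjg rotation_group_sub.
  have [m1 m2 m3] := rotation_group_mem.
  by rewrite !mem_conjgV s1_d s2_d s3_d !groupV m1 m2 m3.
case: i => [|[|[|[|[|[|//]]]]]] _ //=; rewrite conj_gen2.
- by rewrite s2_d s3_d gen_set2V setUC.
- by rewrite rot12_dual s3_d gen_set2V setUC.
- by rewrite s1_d rot23_dual gen_set2V setUC.
- by rewrite s1_d s2_d gen_set2V setUC.
Qed.

Lemma rot_stab_cap_dual i j z : (i <= 5)%N -> (j <= 5)%N ->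
  K i :&: K j = <[z]> -> K (5 - i) :&: K (5 - j) = <[z ^ d]>.
Proof. by move=> i5 j5 E; rewrite -!rot_stab_dual // -conjIg E cycleJ. Qed.

Lemma face_stab_prod : K 3 = <[s1]> * <[s23]> :> {set gT}.
Proof. by rewrite -dihedral_prod ?rot23_expg2 // mulgA. Qed.

Lemma face_stab_prod123 : K 3 = <[s1]> * <[s123]> :> {set gT}.
Proof. by rewrite -mulgA -dihedral_prod_mul ?rot23_expg2 // mulgA. Qed.

Lemma edge_stab_prod : K 2 = <[s3]> * <[s12]> :> {set gT}.
Proof.
rewrite -[K 2]/(K (5 - 3)) -rot_stab_dual // face_stab_prod conjsMg -!cycleJ.
by rewrite s1_d rot23_dual !cycleV.
Qed.

Lemma edge_stab_prod123 : K 2 = <[s3]> * <[s123]> :> {set gT}.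
Proof.
rewrite -[K 2]/(K (5 - 3)) -rot_stab_dual // face_stab_prod123 conjsMg -!cycleJ.
by rewrite s1_d rot123_dual cycleV.
Qed.

Lemma vertex_facet_cap : K 1 :&: K 4 = <[s2]>.
Proof.
have [m2 _ _] := vertex_stab_mem; have [_ m2' _] := facet_stab_mem.
apply/eqP; rewrite eqEsubset cycle_subG inE m2 m2' !andbT.
apply/subsetP=> g /setIP[g1]; rewrite facet_stabE => /(gen_rotranslP hex)[v [k gE]].
have qk1 : q ^+ k \in K 1 by rewrite groupX // groupV.
have : transl q x v \in K 1.
  by rewrite -(groupMl _ qk1) -[_ * _]/(rotransl q x v k) -gE.
move/(rot_transl_vertex rotations)/(rot_transl_eq1 rotations) => tr1.
by rewrite gE /rotransl tr1 mulg1 expVgn groupV mem_cycle.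
Qed.

Lemma rot1_notin_cycle_rot2 : s1 \notin <[s2]>.
Proof.
apply/negP; rewrite -cycleV => /cycleP[n s1E]; apply: L_unit.
have : rotransl q x (unit_vec 1) 4 = rotransl q x 0%R n.
  by rewrite -(tri_rotE hex) tri_rot_unit_transl s1E /rotransl transl0 mulg1.
case/(rotransl_inj hex faithful); rewrite subr0 => tr1 _.
by apply/(rot_transl_eq1 rotations); apply: (conjg_inj q); rewrite translJ // conj1g.
Qed.

Lemma rot3_notin_cycle_rot2 : s3 \notin <[s2]>.
Proof.
by rewrite -(memJ_conjg _ d) -cycleJ s2_d s3_d cycleV groupV rot1_notin_cycle_rot2.
Qed.

Lemma rot2_expg3_neq1 : s2 ^+ 3 <> 1.
Proof.
move=> s2_3; have : rotransl q x 0%R 3 = 1 by rewrite /rotransl transl0 mulg1 expVgn s2_3 invg1.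
by move/faithful.
Qed.

Lemma rot2_notin_cycle3 z : z ^+ 3 = 1 -> s2 \notin <[z]>.
Proof.
move=> z3; apply/negP=> /cycleP[n s2E]; apply: rot2_expg3_neq1.
by rewrite s2E -expgM mulnC expgM z3 expg1n.
Qed.

Lemma rot12_notin_vertex_stab : s12 \notin K 1.
Proof.
apply: contra rot1_notin_cycle_rot2 => h; have [_ _ c12] := facet_stab_mem.
have : s12 \in <[s2]> by rewrite -vertex_facet_cap inE h.
by rewrite groupMr ?cycle_id.
Qed.

Lemma rot23_notin_facet_stab : s23 \notin K 4.
Proof.
by rewrite -(memJ_conjg _ d) rot23_dual rot_stab_dual // groupV rot12_notin_vertex_stab.
Qed.

Lemma edge_facet_cap : K 2 :&: K 4 = <[s12]>.
Proof.
have [e12 _ _] := edge_stab_mem; have [_ _ c12] := facet_stab_mem.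
have [_ v3 _] := vertex_stab_mem.
apply/eqP; rewrite eqEsubset cycle_subG inE e12 c12 !andbT.
apply/subsetP=> g /setIP[]; rewrite edge_stab_prod => /mulsgP[y z y3 z12 ->].
have z4 : z \in K 4 by apply: subsetP z12; rewrite cycle_subG.
have y1 : y \in K 1 by apply: subsetP y3; rewrite cycle_subG.
rewrite groupMr // => y4; rewrite (cycle3_disjoint rot3_expg3 rot3_notin_cycle_rot2 y3) ?mul1g //.
by rewrite -vertex_facet_cap inE y1.
Qed.

Lemma face_facet_cap : K 3 :&: K 4 = <[s1]>.
Proof.
have [f1 _ _] := face_stab_mem; have [c1 _ _] := facet_stab_mem.
apply/eqP; rewrite eqEsubset cycle_subG inE f1 c1 !andbT.
apply/subsetP=> g /setIP[]; rewrite face_stab_prod => /mulsgP[y z y1 z23 ->].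
have y4 : y \in K 4 by apply: subsetP y1; rewrite cycle_subG.
rewrite groupMl //; have [->|->] := cycle_expg2 rot23_expg2 z23; first by rewrite mulg1.
by rewrite (negPf rot23_notin_facet_stab).
Qed.

Lemma vertex_edge_cap : K 1 :&: K 2 = <[s3]>.
Proof.
by rewrite setIC -[s3]invgK cycleV -s1_d; apply: (@rot_stab_cap_dual 3 4) face_facet_cap.
Qed.

Lemma vertex_face_cap : K 1 :&: K 3 = <[s23]>.
Proof.
by rewrite setIC -[s23]invgK cycleV -rot12_dual; apply: (@rot_stab_cap_dual 2 4) edge_facet_cap.
Qed.

Lemma rot23_notin_cycle_rot3 : s23 \notin <[s3]>.
Proof. by rewrite groupMr ?cycle_id // rot2_notin_cycle3 // rot3_expg3. Qed.

Lemma rot12_notin_cycle_rot1 : s12 \notin <[s1]>.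
Proof. by rewrite groupMl ?cycle_id // rot2_notin_cycle3. Qed.

Lemma edge_face_cap : K 2 :&: K 3 = <[s123]>.
Proof.
have [_ e3 e123] := edge_stab_mem; have [_ _ f123] := face_stab_mem.
have [_ v3 _] := vertex_stab_mem.
apply/eqP; rewrite eqEsubset cycle_subG inE e123 f123 !andbT.
apply/subsetP=> g /setIP[]; rewrite edge_stab_prod123 => /mulsgP[y z y3 z123 ->].
have z3 : z \in K 3 by apply: subsetP z123; rewrite cycle_subG.
have y1 : y \in K 1 by apply: subsetP y3; rewrite cycle_subG.
rewrite groupMr // => yK3; have : y \in <[s23]> by rewrite -vertex_face_cap inE y1.
case/(cycle_expg2 rot23_expg2) => yE; first by rewrite yE mul1g.
by case/negP: rot23_notin_cycle_rot3; rewrite -yE.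
Qed.

Lemma rot_stab_factor i j k : (i < j < k)%N -> (k <= 5)%N ->
  K j \subset (K j :&: K i) * (K j :&: K k).
Proof.
have least j' k' : K j' \subset (K j' :&: K 0) * (K j' :&: K k').
  by rewrite (setIidPl (rot_stab_sub j')) mulG_subl.
have greatest j' i' : K j' \subset (K j' :&: K i') * (K j' :&: K 5).
  by rewrite (setIidPl (rot_stab_sub j')) mulG_subr.
case: i => [|i]; first by move=> _ _; apply: least.
case/andP=> ij jk k5; have [->|k5'] := eqVneq k 5; first exact: greatest.
case: i j k ij jk k5 k5' => [|[|[|[|i]]]] [|[|[|[|[|j]]]]] [|[|[|[|[|[|k]]]]]] // _ _ _ _.
- by rewrite setIC vertex_edge_cap edge_face_cap -edge_stab_prod123.
- by rewrite setIC vertex_edge_cap edge_facet_cap -edge_stab_prod.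
- rewrite setIC vertex_face_cap face_facet_cap.
  by rewrite -(group_mulC face_stab_prod) -face_stab_prod.
- rewrite setIC edge_face_cap face_facet_cap.
  by rewrite -(group_mulC face_stab_prod123) -face_stab_prod123.
Qed.

Lemma rot_stab_diamond i : (i < 4)%N -> exists z,
  [/\ z \in K i :&: K i.+2, z \notin K i.+1 & K i :&: K i.+2 \subset K i.+1 :|: K i.+1 :* z].
Proof.
have [_ v3 v23] := vertex_stab_mem; have [e12 _ _] := edge_stab_mem.
have [_ f23 _] := face_stab_mem; have [c1 _ c12] := facet_stab_mem.
have coset_cover (S : {set gT}) (H : {group gT}) z :
    z ^+ 2 = 1 -> S \subset H * <[z]> -> S \subset H :|: H :* z.
  by move=> z2 /subset_trans; apply; apply: mulg_cycle2_sub.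
case: i => [|[|[|[|//]]]] _.
- exists s12; rewrite (setIidPr (rot_stab_sub 2)) e12 rot12_notin_vertex_stab; split=> //.
  by apply: coset_cover => //; rewrite {1}edge_stab_prod mulSg // cycle_subG.
- exists s23; rewrite vertex_face_cap cycle_id; split=> //.
    by apply: contra rot23_notin_cycle_rot3 => e23; rewrite -vertex_edge_cap inE v23.
  by apply: coset_cover; [apply: rot23_expg2 | apply: mulG_subr].
- exists s12; rewrite edge_facet_cap cycle_id; split=> //.
    by apply: contra rot12_notin_cycle_rot1 => f12; rewrite -face_facet_cap inE f12.
  by apply: coset_cover; [apply: s12_expg2 | apply: mulG_subr].
- exists s23; rewrite (setIidPl (rot_stab_sub 3)) f23 rot23_notin_facet_stab; split=> //.
  by apply: coset_cover; rewrite ?rot23_expg2 // {1}face_stab_prod mulSg // cycle_subG.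
Qed.

Lemma rot1_notin_vertex_stab : a 2 \notin K 1.
Proof.
apply: contra rot1_notin_cycle_rot2 => v1; have [c1 _ _] := facet_stab_mem.
by rewrite -vertex_facet_cap inE v1.
Qed.

Lemma rot_stab_cap_transition i j g : (0 < i < j)%N -> (j < 5)%N -> g \in K i -> g \in K j ->
  exists k l, [/\ proper_rank k, proper_rank l, k \notin [:: i; j], l \notin [:: i; j]
                & g \in <[(a k)^-1 * a l]> ].
Proof.
have [E12 E13 E14 [E23 E24 E34]] := rot_shift_quotients.
have cap i' j' z : K i' :&: K j' = <[z]> -> g \in K i' -> g \in K j' -> g \in <[z]>.
  by move=> <- gi gj; rewrite inE gi.
case: i j => [|[|[|[|[|i]]]]] // [|[|[|[|[|j]]]]] // _ _ gi gj.
- by exists 3, 4; rewrite E34 (cap _ _ _ vertex_edge_cap).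
- by exists 2, 4; rewrite E24 (cap _ _ _ vertex_face_cap).
- by exists 2, 3; rewrite E23 (cap _ _ _ vertex_facet_cap).
- by exists 1%N, 4; rewrite E14 (cap _ _ _ edge_face_cap).
- by exists 1%N, 3; rewrite E13 (cap _ _ _ edge_facet_cap).
- by exists 1%N, 2; rewrite E12 (cap _ _ _ face_facet_cap).
Qed.

Lemma rot_stab_cap3 i j k g : (0 < i)%N -> (i < j)%N -> (j < k)%N -> (k < 5)%N ->
  g \in K i -> g \in K j -> g \in K k -> g = 1.
Proof.
have cap i' j' z : K i' :&: K j' = <[z]> -> g \in K i' -> g \in K j' -> g \in <[z]>.
  by move=> <- gi gj; rewrite inE gi.
case: i j k => [|[|[|[|[|i]]]]] // [|[|[|[|[|j]]]]] // [|[|[|[|[|k]]]]] // _ _ _ _ gi gj gk.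
- have g3 := cap _ _ _ vertex_edge_cap gi gj.
  have [//|gE] := cycle_expg2 rot23_expg2 (cap _ _ _ vertex_face_cap gi gk).
  by case/negP: rot23_notin_cycle_rot3; rewrite -gE.
- exact: cycle3_disjoint rot3_expg3 rot3_notin_cycle_rot2 (cap _ _ _ vertex_edge_cap gi gj)
    (cap _ _ _ vertex_facet_cap gi gk).
- exact: cycle3_disjoint s1_expg3 rot1_notin_cycle_rot2 (cap _ _ _ face_facet_cap gj gk)
    (cap _ _ _ vertex_facet_cap gi gk).
- have g1 := cap _ _ _ face_facet_cap gj gk.
  have [//|gE] := cycle_expg2 s12_expg2 (cap _ _ _ edge_facet_cap gi gk).
  by case/negP: rot12_notin_cycle_rot1; rewrite -gE.
Qed.

Lemma rot_stab_pair_gen (J : pred nat) i j g : (0 < i < j)%N -> (j < 5)%N ->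
  J i -> J j -> (forall l, proper_rank l -> J l -> g \in K l) -> g \in <<transitions a J>>.
Proof.
move=> /andP[i0 ij] j5 Ji Jj gJ; have i5 := ltn_trans ij j5; have j0 := ltn_trans i0 ij.
have [gi gj] : g \in K i /\ g \in K j by split; apply: gJ => //; apply/andP.
have cap3 l : proper_rank l -> l \notin [:: i; j] -> J l -> g \in <<transitions a J>>.
  move=> pl l_new Jl; have gl := gJ l pl Jl; have [l0 l5] := andP pl.
  suff -> : g = 1 by apply: group1.
  move: l_new; rewrite !inE negb_or; case: (ltngtP l i) => // [li|il] /= lj_neq.
    exact: rot_stab_cap3 l0 li ij j5 gl gi gj.
  move: lj_neq; case: (ltngtP l j) => // [lj|jl] _.
    exact: rot_stab_cap3 i0 il lj j5 gi gl gj.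
  exact: rot_stab_cap3 i0 ij jl l5 gi gj gl.
have [|k [l [pk pl k_new l_new gkl]]] := rot_stab_cap_transition _ j5 gi gj; first by rewrite i0.
have [/(cap3 k pk k_new)//|Jk] := boolP (J k).
have [/(cap3 l pl l_new)//|Jl] := boolP (J l).
by apply: (subsetP _ _ gkl); rewrite cycle_subG mem_gen ?mem_transitions.
Qed.

Lemma rot_stab_sub_transitions i : (i < 5)%N -> K i \subset <<transitions a (pred1 i)>>.
Proof.
have [E12 E13 E14 [E23 E24 E34]] := rot_shift_quotients.
case: i => [|[|[|[|[|//]]]]] _; rewrite ?rotation_group_sub ?gen_set2_sub /=.
- by rewrite -{1}E12 -E23 -E34 !mem_gen ?mem_transitions.
- by rewrite -{1}E23 -E34 !mem_gen ?mem_transitions.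
- by rewrite -{1}E13 -E34 !mem_gen ?mem_transitions.
- by rewrite -{1}E12 -E24 !mem_gen ?mem_transitions.
- by rewrite -{1}E12 -E23 !mem_gen ?mem_transitions.
Qed.

Lemma rot_stab_gen (J : pred nat) g : g \in rotation_group ->
  (forall j, proper_rank j -> J j -> g \in K j) -> g \in <<transitions a J>>.
Proof.
move=> gG gJ; have single i : (i < 5)%N -> g \in K i ->
    (forall j, proper_rank j -> J j -> j = i) -> g \in <<transitions a J>>.
  move=> i5 gi uniqJ; apply: (subsetP (genS _)) (subsetP (rot_stab_sub_transitions i5) g gi).
  by apply: transitionsS => j pj /(uniqJ j pj)->; apply: eqxx.
have [i /andP[i0 Ji]|noJ] := pickP (fun i : 'I_5 => (0 < i)%N && J i); last first.
  by apply: (single 0) => // j /andP[j0 j5] Jj; have := noJ (Ordinal j5); rewrite /= j0 Jj.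
have i5 := ltn_ord i; have pi : proper_rank i by rewrite /proper_rank i0.
have [/existsP[j /and3P[j0 Jj ij]]|one] := boolP [exists j : 'I_5, [&& (0 < j)%N, J j & j != i]].
  wlog ltij : i j i0 Ji i5 pi j0 Jj ij / (i < j)%N.
    move=> pair_gen; case: (ltngtP i j) => [ltij|ltji|/val_inj eqij].
    - exact: pair_gen ltij.
    - by apply: (pair_gen j i) => //; rewrite 1?eq_sym // /proper_rank j0 ltn_ord.
    - by rewrite eqij eqxx in ij.
  by apply: (rot_stab_pair_gen (i := i) (j := j)) => //; rewrite i0.
apply: (single i i5 (gJ i pi Ji)) => j /andP[j0 j5] Jj.
move/existsPn/(_ (Ordinal j5)): one.
by rewrite j0 Jj /= negbK => /eqP/(congr1 val).
Qed.

Definition rotation_geometry : coset_geometry :=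
  @CosetGeometry gT rotation_group rot_stab rot_shift rot_stab_sub erefl erefl
    rot_stab_factor rot_stab_diamond erefl rot_shift_group rot_shift_stab rot_shift_edge
    rot1_notin_vertex_stab rot_stab_gen.

Lemma facet_rot_cap i : (0 < i < 4)%N -> K i :&: K 4 = <[facet_rot q x i]>.
Proof.
case: i => [|[|[|[|]]]] //= _; rewrite ?tri_rot_unit_transl ?invgK.
- exact: vertex_facet_cap.
- exact: edge_facet_cap.
- exact: face_facet_cap.
Qed.

Lemma rotation_geometry_facets u : (forall v, L v <-> in_lattice u v) ->
  forall F : coset_polytope rotation_geometry, rank F = 3%:Z%R ->
    exists f : tess_face -> coset_polytope rotation_geometry, torus_cover u F f.
Proof.
move=> Lu; apply: (@coset_facet_cover rotation_geometry q x u hex facet_stabE).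
- exact: facet_rot_cap.
- exact: faithful.
- by move=> v; rewrite -Lu; apply: (rot_transl_eq1 rotations).
Qed.

Section Mirror.
Variable f : {morphism rotation_group >-> gT}.
Hypothesis f_mirror : forall k l, (k < 4)%N -> (l < 4)%N ->
  f ((a k.+1)^-1 * a l.+1) = a k.+1 * (a l.+1)^-1.

Lemma mirror_rot1 : f s1 = s1^-1.
Proof. by have := f_mirror (isT : 0 < 4)%N (isT : 1 < 4)%N; rewrite /= invg1 !mul1g. Qed.

Lemma mirror_rot2 : f s2 = s2^-1 ^ s1^-1.
Proof.
have := f_mirror (isT : 1 < 4)%N (isT : 2 < 4)%N.
by rewrite /= mulKg invMg conjgE invgK mulgA.
Qed.

Lemma mirror_rot3 : f s3 = s3^-1 ^ s12^-1.
Proof.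
have := f_mirror (isT : 2 < 4)%N (isT : 3 < 4)%N.
by rewrite [LHS]/= mulKg /= invMg conjgE invgK mulgA.
Qed.

Lemma mirror_image : f @* rotation_group = rotation_group.
Proof.
have [m1 m2 m3] := rotation_group_mem.
have mem_image z : z \in rotation_group -> f z \in f @* rotation_group.
  by move=> zG; apply: mem_morphim.
have i1 : s1 \in f @* rotation_group by rewrite -groupV -mirror_rot1 mem_image.
have i2 : s2 \in f @* rotation_group.
  by rewrite -groupV -(memJ_conjg _ s1^-1) conjGid ?groupV // -mirror_rot2 mem_image.
have i3 : s3 \in f @* rotation_group.
  rewrite -groupV -(memJ_conjg _ s12^-1) conjGid ?groupV; last exact: groupM.
  by rewrite -mirror_rot3 mem_image.
apply/eqP; rewrite eq_sym eqEcard leq_morphim andbT.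
by rewrite rotation_group_sub i1 i2 i3.
Qed.

Lemma mirror_unit_transl : f x = transl q x (0, 1)%R ^ s1^-1.
Proof.
have [m1 m2 _] := rotation_group_mem; have [_ _ q6] := hex.
have f1 : f s1 = s1^-1 ^ s1^-1 by rewrite mirror_rot1 [RHS]mulKg.
rewrite morphM ?(groupM (groupX 3 m2) m1) // morphM ?groupX // morphX //.
rewrite mirror_rot2 f1 -conjXg -!conjMg; congr (_ ^ _).
have -> : transl q x (0, 1)%R = x^-1 ^ (q ^+ 4).
  by rewrite -[in RHS](transl_unit q x) -translN // translJX.
have -> : x^-1 = q * s1^-1 * q ^+ 3 by rewrite 2!invMg -expVgn mulgA.
have q4V : (q ^+ 4)^-1 = q ^+ 2 by apply: (mulgI (q ^+ 4)); rewrite mulgV -expgD.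
by rewrite conjgE q4V -[LHS]mulg1 -q6 !mulgA -expgSr.
Qed.

(* In coordinates turned by 240 degrees, [f] exchanges the two unit translations
   and inverts the rotation [q]. *)
Lemma mirror_transl v : f (transl q x v) = transl q x (v.2, v.1)%R ^ s1^-1.
Proof.
have [m1 m2 _] := rotation_group_mem.
have mx : x \in rotation_group by rewrite !groupM ?groupX.
have fq : f q = s2 ^ s1^-1 by rewrite morphV // mirror_rot2 conjVg invgK.
have unit_s2 : transl q x (0, 1)%R ^ s2 = x.
  have <- : x ^ q = transl q x (0, 1)%R by rewrite -[in LHS](transl_unit q x) translJ.
  by rewrite -conjgM mulVg conjg1.
rewrite morph_transl ?groupV // fq mirror_unit_transl transl_conjg; congr (_ ^ _).
rewrite {1}/transl unit_s2 -[in X in _ * X](transl_unit q x) !translXz // -translD //.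
by rewrite !point_mulz; congr transl; congr pair => /=; ring.
Qed.

End Mirror.

Lemma mirrored_morphism : mirrored rotation_geometry ->
  exists2 f : {morphism rotation_group >-> gT}, f @* rotation_group = rotation_group
    & forall v, f (transl q x v) = transl q x (v.2, v.1)%R ^ s1^-1.
Proof.
case=> f f_mirror; exists f; first exact: mirror_image f_mirror.
exact: mirror_transl f_mirror.
Qed.

Lemma rotation_geometry_dual (i : 'I_6) :
  geo_stab rotation_geometry i :^ d = geo_stab rotation_geometry (rev_ord i).
Proof. exact: rot_stab_dual (ltn_ord i). Qed.

Lemma rotation_geometry_type u : (forall v, L v <-> in_lattice u v) ->
  has_type (coset_polytope rotation_geometry) (@map36 u) (@map63 u).
Proof.
move=> Lu; apply: dual_has_type (dual_perm_duality rotation_geometry_dual) _.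
exact: rotation_geometry_facets Lu.
Qed.

End RotationGroups.

(** * Products of rotation groups *)

Section DirectProducts.
Variables (aT bT : finGroupType).
Implicit Types (A : {group aT}) (B : {group bT}) (G : {group aT * bT}).

Lemma pair_ext (g h : aT * bT) : g.1 = h.1 -> g.2 = h.2 -> g = h.
Proof. by case: g h => [g1 g2] [h1 h2] /= -> ->. Qed.

Lemma transl_fst (q x : aT * bT) v : (transl q x v).1 = transl q.1 x.1 v.
Proof. by apply: (morph_transl [morphism of (@fst aT bT)]); rewrite inE. Qed.

Lemma transl_snd (q x : aT * bT) v : (transl q x v).2 = transl q.2 x.2 v.
Proof. by apply: (morph_transl [morphism of (@snd aT bT)]); rewrite inE. Qed.

Lemma rotransl_fst (q x : aT * bT) v k : (rotransl q x v k).1 = rotransl q.1 x.1 v k.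
Proof. by apply: (morph_rotransl [morphism of (@fst aT bT)]); rewrite inE. Qed.

Lemma hex_action_prod (q x : aT * bT) :
  hex_action q.1 x.1 -> hex_action q.2 x.2 -> hex_action q x.
Proof. by case=> [A1 A2 A3] [B1 B2 B3]; split; apply: pair_ext. Qed.

Lemma mem_gen_proj (D : {set aT * bT}) g : g \in <<D>> ->
  g.1 \in <<[set y.1 | y in D]>> /\ g.2 \in <<[set y.2 | y in D]>>.
Proof.
move=> gD; split.
  have := mem_morphim [morphism of (@fst aT bT)] (in_setT g) gD.
  by rewrite morphim_gen ?subsetT // morphimEsub ?subsetT.
have := mem_morphim [morphism of (@snd aT bT)] (in_setT g) gD.
by rewrite morphim_gen ?subsetT // morphimEsub ?subsetT.
Qed.

Lemma sub_setX_proj G : G \subset setX (fst @* G) (snd @* G).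
Proof.
apply/subsetP=> g gG; rewrite inE; apply/andP; split.
  by apply: (mem_morphim [morphism of fst]); rewrite ?inE.
by apply: (mem_morphim [morphism of snd]); rewrite ?inE.
Qed.

(* Goursat's lemma: [G] is the whole product unless its intersection with [A] is
   trivial, and then [G] is isomorphic to [B]. *)
Lemma goursat_simple A B G : simple A -> ~~ (#|A| %| #|B|)%N ->
  fst @* G = A -> snd @* G = B -> G = setX A B :> {set _}.
Proof.
move=> /simpleP[_ simpleA] AB GA GB; pose S := 'ker_G (@snd aT bT).
have ker_snd z : z \in S -> z.2 = 1 by case/setIP=> _ /(kerP _ (in_setT _)).
have cardG : #|G| = (#|fst @* S| * #|B|)%N.
  have -> : #|B| = #|G : 'ker (@snd aT bT)| by rewrite -GB card_morphim setTI.
  rewrite -(LagrangeI G ('ker (@snd aT bT))); congr (_ * _)%N.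
  rewrite morphimEsub ?subsetT // card_in_imset // => y z yS zS /= yz1.
  by apply: pair_ext => //; rewrite !ker_snd.
have normS : fst @* S <| A
  by rewrite -GA morphim_normal // (normalGI (subsetT G)) // ker_normal.
have [S1|SA] := simpleA _ normS.
  case/negP: AB; have -> : #|B| = #|G| by rewrite cardG /= S1 cards1 mul1n.
  by rewrite -GA dvdn_morphim.
have := sub_setX_proj G; rewrite GA GB => subG.
by apply/eqP; rewrite eqEcard subG cardG /= SA [#|setX A B|]cardsX leqnn.
Qed.

Lemma simple_factor_stable A B G (f : {morphism G >-> aT * bT}) :
  simple A -> ~~ (#|A| %| #|B|)%N -> G = setX A B :> {set _} -> f @* G = G ->
  {in B, forall y, (f (1, y)).1 = 1}.
Proof.
move=> /simpleP[_ simpleA] AB GE fG y yB; have := setX_dprod A B.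
case/dprod_normal2 => _; set B1 := setX 1 B => normB1.
have normN : fst @* (f @* B1) <| A.
  have <- : fst @* G = A by rewrite GE morphim_fstX.
  by rewrite -[X in _ <| fst @* X]fG !morphim_normal // GE.
have yB1 : ((1, y) : aT * bT) \in B1 by rewrite inE /= group1.
have : (f (1, y)).1 \in fst @* (f @* B1).
  apply: (mem_morphim [morphism of fst]); rewrite ?inE // mem_morphim //.
  by rewrite GE (subsetP (normal_sub normB1)).
have [->/set1P//|NA] := simpleA _ normN; case/negP: AB.
have -> : #|B| = #|B1| by rewrite [#|B1|]cardsX cards1 mul1n.
by rewrite -NA (dvdn_trans (dvdn_morphim _ _)) // dvdn_morphim.
Qed.

End DirectProducts.

Section ProductRotations.
Variables (aT bT : finGroupType) (s1 s2 s3 d : aT) (t1 t2 t3 e : bT) (L M : point -> Prop).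
Local Notation A := (rotation_group s1 s2 s3).
Local Notation B := (rotation_group t1 t2 t3).
Local Notation S1 := (s1, t1).
Local Notation S2 := (s2, t2).
Local Notation S3 := (s3, t3).
Hypothesis rotations_s : toroidal_rotations s1 s2 s3 d L.
Hypothesis rotations_t : toroidal_rotations t1 t2 t3 e M.

Lemma toroidal_rotations_prod :
  @toroidal_rotations (aT * bT)%type S1 S2 S3 (d, e) (fun v => L v /\ M v).
Proof.
case: rotations_s rotations_t => [a1 a12 a123 aH a1L aV ad1 ad2 ad3].
case=> [b1 b12 b123 bH b1M bV bd1 bd2 bd3].
split; try by apply: pair_ext.
- exact: hex_action_prod.
- move=> v; rewrite -a1L -b1M; split=> [E|[E1 E2]].
    by move: (congr1 fst E) (congr1 snd E); rewrite transl_fst transl_snd.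
  by apply: pair_ext; rewrite ?transl_fst ?transl_snd.
- move=> v /mem_gen_proj[]; rewrite !imsetU1 !imset_set1 transl_fst transl_snd.
  by move=> /aV Lv /bV.
Qed.

Hypothesis faithful_s : rotation_faithful s2^-1 (unit_transl s1 s2).
Hypothesis simpleA : simple A.
Hypothesis AB : ~~ (#|A| %| #|B|)%N.

Lemma rotation_faithful_prod : rotation_faithful S2^-1 (unit_transl S1 S2).
Proof. by move=> v k /(congr1 fst); rewrite rotransl_fst => /faithful_s. Qed.

Lemma rotation_group_prod : rotation_group S1 S2 S3 = setX A B :> {set _}.
Proof.
by apply: goursat_simple => //=; rewrite morphim_gen ?subsetT // morphimEsub ?subsetT //
  !imsetU !imset_set1.
Qed.

Variable v : point.
Hypotheses (Lv : L v) (L_swap : ~ L (v.2, v.1)%R).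

Lemma unit_not_translation : ~ (L (1, 0)%R /\ M (1, 0)%R).
Proof.
rewrite -(rot_transl_eq1 rotations_s) transl_unit => -[x1 _]; apply: L_swap.
by apply/(rot_transl_eq1 rotations_s); rewrite x1 /transl conj1g !exp1gz mulg1.
Qed.

(* An automorphism of [A \x B] preserves [B], so it cannot turn the translation
   by [v], which lies in [B], into a conjugate of the translation by the mirror
   image of [v], which does not. *)
Lemma prod_not_mirrored :
  ~ mirrored
      (rotation_geometry toroidal_rotations_prod rotation_faithful_prod unit_not_translation).
Proof.
case/mirrored_morphism=> f fG f_transl.
have [m1 m2 _] := rotation_group_mem S1 S2 S3.
set q := S2^-1 in f_transl; set x := unit_transl S1 S2 in f_transl.
have tG : transl q x v \in setX A B.
  by rewrite -rotation_group_prod transl_mem ?groupV ?groupM ?groupX.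
have tE : transl q x v = (1, (transl q x v).2).
  by apply: pair_ext => //; rewrite transl_fst; apply/(rot_transl_eq1 rotations_s).
case/setXP: tG => _ /(simple_factor_stable simpleA AB rotation_group_prod fG).
rewrite -tE f_transl -[LHS]/(conjg (transl q x (v.2, v.1)%R).1 _) transl_fst.
by move/eqP; rewrite conjg_eq1 => /eqP/(rot_transl_eq1 rotations_s).
Qed.

Lemma chiral_polytope_of_product : exists P : polytope 4,
  [/\ chiral P, properly_self_dual P, Gamma P \isog setX A B
    & forall u, (forall w, L w /\ M w <-> in_lattice u w) -> has_type P (@map36 u) (@map63 u)].
Proof.
exists (coset_polytope (rotation_geometry toroidal_rotations_prod rotation_faithful_prod
                          unit_not_translation)); split.
- exact/coset_chiral/prod_not_mirrored.
- apply: coset_properly_self_dual prod_not_mirrored; exact: rotation_geometry_dual.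
- by rewrite -rotation_group_prod; apply/Gamma_isog/prod_not_mirrored.
- exact: rotation_geometry_type.
Qed.

End ProductRotations.

(** * Lattices *)

Local Close Scope group_scope.
Local Open Scope ring_scope.

Lemma in_lattice_m0 (m : int) (v : point) :
  in_lattice (m, 0) v <-> (m %| v.1)%Z && (m %| v.2)%Z.
Proof.
case: v => v1 v2; split=> [[r [s]]|/andP[/dvdzP[r /= ->] /dvdzP[s ->]]].
  rewrite !point_mulz /= => -[-> ->]; rewrite !oppr0 !mul0r !addr0 !add0r.
  by rewrite !dvdz_mulr.
by exists r, s; rewrite /rot60 /= !point_mulz; congr pair => /=; ring.
Qed.

Lemma in_lattice_mulzP (m : int) (u v : point) :
  in_lattice (u *~ m) v <-> exists2 w, in_lattice u w & v = w *~ m.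
Proof.
have lin r s : u *~ m *~ r + rot60 (u *~ m) *~ s = (u *~ r + rot60 u *~ s) *~ m.
  by case: u => u1 u2; rewrite /rot60 /= !point_mulz; congr pair => /=; ring.
split=> [[r [s ->]]|[_ [r [s ->]] ->]]; last by exists r, s.
by exists (u *~ r + rot60 u *~ s); [exists r, s | apply: lin].
Qed.

Lemma Euclid_dvdzM (p : nat) (x y : int) : prime p ->
  (p%:Z %| x * y)%Z = (p%:Z %| x)%Z || (p%:Z %| y)%Z.
Proof. by move=> p_prime; rewrite !dvdzE abszM Euclid_dvdM. Qed.

Section PrimeNormLattice.
Variables (p b c : nat).
Hypotheses (p_prime : prime p) (b_gt0 : (0 < b)%N) (c_gt0 : (0 < c)%N)
  (p_eq : p = (b ^ 2 + b * c + c ^ 2)%N).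

Let L (v : point) : Prop := (p%:Z %| c%:Z * v.1 - b%:Z * v.2)%Z.

Lemma prime_normE : p%:Z = b%:Z ^+ 2 + b%:Z * c%:Z + c%:Z ^+ 2.
Proof. by rewrite p_eq !PoszD !PoszM !expr2 -!PoszM. Qed.

Lemma prime_norm_ndvd (n : nat) : (0 < n < p)%N -> ~~ (p%:Z %| n%:Z)%Z.
Proof. by rewrite dvdzE /= => /andP[n_gt0 n_ltp]; rewrite gtnNdvd. Qed.

Lemma prime_norm_ndvd_bc : ~~ (p%:Z %| b%:Z * c%:Z)%Z.
Proof.
rewrite Euclid_dvdzM // negb_or !prime_norm_ndvd //.
all: by rewrite p_eq; move: b_gt0 c_gt0; clear; nia.
Qed.

(* [p] divides neither [b + c], as [(b + c) ^ 2 = p + b c], nor [b - c], as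
   [(b - c) ^ 2 = p - 3 b c]. *)
Lemma prime_norm_lattice_swap : p != 3 -> ~ L (c%:Z, b%:Z).
Proof.
move=> p3; rewrite /L /= => dvd_sqr; case/negP: prime_norm_ndvd_bc.
have : (p%:Z %| (c%:Z - b%:Z) * (c%:Z + b%:Z))%Z.
  by move: dvd_sqr; congr (dvdz _ _); ring.
rewrite Euclid_dvdzM // => /orP[]/(dvdz_mull _) dvd_sqr'.
  have : (p%:Z %| 3 * (b%:Z * c%:Z))%Z.
    have -> : 3 * (b%:Z * c%:Z) = p%:Z - (c%:Z - b%:Z) * (c%:Z - b%:Z).
      by rewrite prime_normE; ring.
    by rewrite rpredB.
  rewrite Euclid_dvdzM // => /orP[|//].
  by rewrite dvdzE /= dvdn_prime2 // (negPf p3).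
have -> : b%:Z * c%:Z = (c%:Z + b%:Z) * (c%:Z + b%:Z) - p%:Z by rewrite prime_normE; ring.
by rewrite rpredB.
Qed.

Lemma prime_norm_latticeP v : L v <-> in_lattice (b%:Z, c%:Z) v.
Proof.
have p_neq0 : p%:Z != 0 by rewrite eqz_nat -lt0n prime_gt0.
case: v => v1 v2; rewrite /L /=; split=> [/dvdzP[k kE]|[r [s]]]; last first.
  rewrite !point_mulz /= => -[-> ->]; apply/dvdzP; exists (- s).
  by rewrite prime_normE; ring.
have /dvdzP[r rE] : (p%:Z %| (b%:Z + c%:Z) * v1 + c%:Z * v2)%Z.
  have : (p%:Z %| c%:Z * ((b%:Z + c%:Z) * v1 + c%:Z * v2))%Z.
    apply/dvdzP; exists ((b%:Z + c%:Z) * k + v2).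
    transitivity ((b%:Z + c%:Z) * (k * p%:Z) + v2 * p%:Z); last by rewrite /=; ring.
    by rewrite -kE prime_normE; ring.
  rewrite Euclid_dvdzM // => /orP[/(dvdz_mull b%:Z)|//].
  by rewrite (negPf prime_norm_ndvd_bc).
exists r, (- k); rewrite !point_mulz /=; congr pair; apply: (mulIf p_neq0).
  transitivity (b%:Z * (r * p%:Z) + c%:Z * (k * p%:Z)); last by rewrite /=; ring.
  by rewrite -rE -kE prime_normE; ring.
transitivity (c%:Z * (r * p%:Z) - (b%:Z + c%:Z) * (k * p%:Z)); last by rewrite /=; ring.
by rewrite -rE -kE prime_normE; ring.
Qed.

Variable m : int.

Lemma in_prime_norm_lattice_dvd v : (p%:Z %| m)%Z ->
  L v /\ in_lattice (m, 0) v <-> in_lattice (m, 0) v.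
Proof.
move=> pm; split=> [[]//|vm]; split=> //; case/in_lattice_m0/andP: vm => m1 m2.
by rewrite /L rpredB // dvdz_mull // (dvdz_trans pm).
Qed.

Lemma in_prime_norm_lattice_ndvd v : ~~ (p%:Z %| m)%Z ->
  L v /\ in_lattice (m, 0) v <-> in_lattice (m * b%:Z, m * c%:Z) v.
Proof.
move=> pm; have -> : (m * b%:Z, m * c%:Z) = (b%:Z, c%:Z) *~ m :> point.
  by rewrite point_mulz; congr pair; rewrite mulrC.
split=> [[Lv /in_lattice_m0/andP[/dvdzP[w1 w1E] /dvdzP[w2 w2E]]]|].
  have vE : v = (w1, w2) *~ m by rewrite point_mulz -w1E -w2E; case: (v).
  rewrite vE; apply/in_lattice_mulzP; exists (w1, w2) => //; apply/prime_norm_latticeP.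
  have : (p%:Z %| (c%:Z * w1 - b%:Z * w2) * m)%Z by rewrite mulrBl -!mulrA -w1E -w2E.
  by rewrite Euclid_dvdzM // (negPf pm) orbF.
case/in_lattice_mulzP=> -[w1 w2] /prime_norm_latticeP/= Lw ->.
rewrite point_mulz in_lattice_m0 /= !dvdz_mull //; split=> //.
by rewrite /L /= !mulrA -mulrBl dvdz_mulr.
Qed.

End PrimeNormLattice.
Theorem theorem8p2 (p b c : nat) (m : int) (Q : polytope 4) (Phi : {set Q})
    (p_prime : prime p) (p_mod12 : p = 1 %[mod 12])
    (b_gt0 : (0 < b)%N) (c_gt0 : (0 < c)%N)
    (p_eq : p = (b ^ 2 + b * c + c ^ 2)%N)
    (m_odd : ~~ (2 %| m)%Z) (m_not3 : ~~ (3 %| m)%Z)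
    (Phi_flag : flag Phi)
    (Q_self_dual : self_dual Q)
    (Q_directly_regular : directly_regular Phi)
    (Q_type : has_type Q (@map36 (m, 0)) (@map63 (m, 0)))
    (Q_order : ~~ (p * (p ^ 2 - 1) %| #|Gamma Q|)%N) :
  exists P : polytope 4,
    [/\ chiral P,
        properly_self_dual P,
        Gamma P \isog setX (PSL2 p) (Gamma_plus Phi),
        ((p%:Z %| m)%Z -> has_type P (@map36 (m, 0)) (@map63 (m, 0)))
      & (~~ (p%:Z %| m)%Z ->
           has_type P (@map36 (m * b%:Z, m * c%:Z)) (@map63 (m * b%:Z, m * c%:Z)))].
Proof.
have [regQ index2] := Q_directly_regular; have [facetsQ _] := Q_type.
have p_gt5 : (5 < p)%N by move: p_mod12 (prime_gt1 p_prime); clear; lia.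
have [e rotQ] : exists e, toroidal_rotations (sigma Phi 1) (sigma Phi 2) (sigma Phi 3) e
    (in_lattice (m, 0)).
  by apply: regular_toroidal_rotations => // F F3; apply/torus_coverP/facetsQ.
have [s1 [s2 [s3 [d [rotL genL faithful]]]]] :=
  PSL2_rotations p_prime p_mod12 b_gt0 c_gt0 p_eq.
have {}genL : rotation_group s1 s2 s3 = PSL2 p by apply: val_inj.
have genQ : rotation_group (sigma Phi 1) (sigma Phi 2) (sigma Phi 3) = Gamma_plus Phi.
  exact/val_inj/esym/Gamma_plusE.
have [||||P [chiP dualP isoP typeP]] := chiral_polytope_of_product rotL rotQ faithful
    _ _ (v := (b%:Z, c%:Z)).
- by rewrite genL; apply: PSL2_simple.
- by rewrite genL genQ; apply: card_PSL2_ndvd index2 Q_order; last exact: Gamma_plus_sub.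
- by rewrite /= mulrC subrr dvdz0.
- by apply: prime_norm_lattice_swap => //; rewrite gtn_eqF // ltnW // ltnW.
rewrite genL genQ in isoP; exists P; split=> // pm; apply: typeP => v.
  exact: in_prime_norm_lattice_dvd.
exact: in_prime_norm_lattice_ndvd.
Qed.
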